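(* Suppose that the standing assumption on the data and the boundedness of $\sigma$ stated in the context hold, that the interpolation between the grids has the positive interpolation property stated in the context, and that $\theta>C\lambda$, where $\lambda=\Delta t/h$ and $C$ is the Lipschitz constant of the Hamiltonian $\bar f^\alpha(\mathbf x,u,p,k)=f(\alpha,\mathbf x,u,(\tilde\sigma^\alpha(x))^Tp,k)$. Consider the implicit scheme ($j=1,\dots,J$, $\alpha=\alpha_j$): $U^0_{j,i}=g(x_{j,i})$ and, for $n\ge1$, $$U^n_{j,i}-\Delta t\Big(A^\alpha_{\varepsilon,h,k}U^n_{j,i}+K^{\alpha,1}_{\varepsilon,h}U^n_{j,i}+\tilde f^\alpha(\mathbf x^n_{j,i},U^n_{j,i},\Delta U^n_{j,i},B^\alpha_{\varepsilon,h}U^n_{j,i})\Big)-U^{n-\frac12}_{j,i}=0,$$ $$U^{n-\frac12}_{j,i}=\max\Big[\zeta(t^{n},x_{j,i}),\ U^{n-1}_{j,i},\ \max_{k'\ne j}(\tilde U^{n-1}_{k',i(j)}-c)\Big].$$ Then: (1) There exists a unique bounded solution $U^n$ of the scheme. (2) The scheme is $\ell^\infty$ stable and weakly monotone. It is consistent with the switching system $$\begin{cases}\min\Big[U_j-\zeta,\ \min\big(\partial_tU_j-L_\varepsilon^{\alpha_j}U_j-f(\alpha_j,\mathbf x,U_j,(\tilde\sigma^{\alpha_j})^TDU_j,B_\varepsilon^{\alpha_j}U_j);\ U_j-\max_{k'\ne j}(U_{k'}-c)\big)\Big]=0 & \text{on }\mathcal Q_T,\\ U_j-g=0 & \text{on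 }\{0\}\times\mathbb R^d,\end{cases}$$ $j=1,\dots,J$, provided $h^2/\Delta t\to0$ and $h/k\to0$ as $h,k,\Delta t\to0$ (with $\varepsilon$ fixed). (The terms $\ell^\infty$ stable, weakly monotone and consistent are defined in the context.)
   Context: Notation. $a\wedge b=\min(a,b)$; $T>0$; $\mathcal Q_T=(0,T]\times\mathbb R^d$, $\bar{\mathcal Q}_T=[0,T]\times\mathbb R^d$, $\mathbf x=(t,x)$; $D,D^2$ are the gradient and Hessian in $x$. $E=\mathbb R^n\setminus\{0\}$ and $\nu$ is a $\sigma$-finite Borel measure on $E$ with $\int_E(1\wedge|e|^2)\,\nu(de)<\infty$. $\mathbf A$ is a compact subset of a Euclidean space. The measurable data are $b:\mathbf A\times\mathbb R^d\to\mathbb R^d$, $\sigma:\mathbf A\times\mathbb R^d\to\mathbb R^{d\times d}$, $\eta:\mathbf A\times\mathbb R^d\times E\to\mathbb R^d$, $\gamma:\mathbb R^d\times E\to\mathbb R$, $f:\mathbf A\times[0,T]\times\mathbb R^d\times\mathbb R\times\mathbb R^d\times\mathbb R\to\mathbb R$, $\zeta:[0,T]\times\mathbb R^d\to\mathbb R$, $g:\mathbb R^d\to\mathbb R$. Dependence on $\alpha$ is also written as a superscript, and $f(\alpha,\mathbf x,\cdot)=f(\alpha,t,x,\cdot)$. Standing assumption on the data. There is a constant $C>0$ such that for all $\alpha,\alpha'\in\mathbf A$, $t\in[0,T]$, $e\in E$, $x,x'\in\mathbb R^d$, $u,v\in\mathbb R$, $p,q\in\mathbb R^d$, $k,k'\in\mathbb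 R$: (1) $|b(\alpha,x)-b(\alpha',x')|+|\sigma(\alpha,x)-\sigma(\alpha',x')|\le C(|x-x'|+|\alpha-\alpha'|)$; (2) $|\eta(\alpha,x,e)-\eta(\alpha',x',e)|\le C(|x-x'|+|\alpha-\alpha'|)(1\wedge|e|)$ and $|\eta(\alpha,x,e)|\le C(1\wedge|e|)$; (3) $|\gamma(x,e)-\gamma(x',e)|\le C|x-x'|(1\wedge|e|^2)$, $|\gamma(x,e)|\le C(1\wedge|e|)$, $\gamma(x,e)\ge0$; (4) $f$ is continuous in $t$ and: (a) $|f(\alpha,t,x,0,0,0)|\le C$; (b) $f(\alpha,t,x,v,p,k)-f(\alpha,t,x,u,p,k)\ge C(u-v)$ when $u\ge v$, and $k\mapsto f(\alpha,t,x,u,p,k)$ is non-decreasing; (c) $|f(\alpha,t,x,u,p,k)-f(\alpha',t,x,v,q,k')|\le C(|\alpha-\alpha'|+|u-v|+|p-q|+|k-k'|)$; (d) for each $R>0$ there is a continuous $m_R:\mathbb R_+\to\mathbb R_+$ with $m_R(0)=0$ and $|f(\alpha,t,x,u,p,k)-f(\alpha,t,x',u,p,k)|\le m_R(|x-x'|(1+|p|))$ whenever $|x|,|x'|,|u|\le R$; (5) $\zeta$ is continuous in $t$, $|g(x)-g(x')|+|\zeta(t,x)-\zeta(t,x')|\le C|x-x'|$, $|g(x)|+|\zeta(t,x)|\le C$, and $g(x)\ge\zeta(0,x)$. In addition $\sigma$ is bounded, so that $\bar f^\alpha$ is Lipschitz in $p$. Truncated operators. Fix $\varepsilon>0$. Let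 $\nu_\varepsilon(de)=1_{|e|>\varepsilon}\nu(de)$, $\tilde\sigma^\alpha_{ij}=\sigma^\alpha_{ij}$ for $i\ne j$ and $\tilde\sigma^\alpha_{ii}(x)=\big((\sigma^\alpha_{ii}(x))^2+\int_{|e|<\varepsilon}|\eta^\alpha_i(x,e)|^2\nu(de)\big)^{1/2}$. For $\phi\in C^{1,2}(\bar{\mathcal Q}_T)$, $A^\alpha_\varepsilon\phi=\frac12\mathrm{tr}(\tilde\sigma^\alpha(\tilde\sigma^\alpha)^TD^2\phi)+b^\alpha\cdot D\phi$, $K^\alpha_\varepsilon\phi(\mathbf x)=\int_E(\phi(t,x+\eta^\alpha(x,e))-\phi(\mathbf x)-\eta^\alpha(x,e)\cdot D\phi(\mathbf x))\nu_\varepsilon(de)$, $B^\alpha_\varepsilon\phi(\mathbf x)=\int_E(\phi(t,x+\eta^\alpha(x,e))-\phi(\mathbf x))\gamma(x,e)\nu_\varepsilon(de)$, $L^\alpha_\varepsilon=A^\alpha_\varepsilon+K^\alpha_\varepsilon$. $\mathbf A_\delta=\{\alpha_1,\dots,\alpha_J\}\subset\mathbf A$ is finite with $\max_{\alpha\in\mathbf A}\min_{\tilde\alpha\in\mathbf A_\delta}|\alpha-\tilde\alpha|<\delta$; $c>0$. Grids and discrete operators. $t^n=n\Delta t\in[0,T]$; for each $j$, $\Omega_{j,h}=\{x_{j,i}\}_{i\in\mathbb Z^d}$ is a uniform grid of mesh size $h$ ($x_{j,i+m}=x_{j,i}+hm$); $\mathbf x^n_{j,i}=(t^n,x_{j,i})$.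 For a uniform grid $\{x_m\}_{m\in\mathbb Z^d}$, $\omega_m(\cdot;h)$ are the basis (''tent'') functions of piecewise linear or multilinear interpolation: $0\le\omega_m\le1$, $\omega_m(x_i;h)=\delta_{mi}$, $\sum_m\omega_m=1$, $\mathrm{supp}\,\omega_m\subset B(x_m,2h)$, $|D\omega_m|\le C/h$. With $k>0$, $b^\alpha_\varepsilon(x)=-\int_{|e|>\varepsilon}\eta^\alpha(x,e)\nu(de)$, $\tilde b^\alpha=b^\alpha+b^\alpha_\varepsilon$, $\tilde\sigma^\alpha_l$ the $l$-th column of $\tilde\sigma^\alpha$, and on a given grid function $U_i$: $A^\alpha_{\varepsilon,h,k}U_i=\sum_md_{m,i}(U_m-U_i)$, $d_{m,i}=\frac12\sum_{l=1}^d\frac{\omega_m(x_i+k\tilde\sigma_l^\alpha(x_i);h)+\omega_m(x_i-k\tilde\sigma_l^\alpha(x_i);h)}{k^2}+\frac{\omega_m(x_i+k^2\tilde b^\alpha(x_i);h)}{k^2}$ (basis of the grid itself); $K^{\alpha,1}_{\varepsilon,h}U_i=\sum_m\kappa_{m,i}(U_{i+m}-U_i)$, $\kappa_{m,i}=\int_{|e|>\varepsilon}\omega_m(\eta^\alpha(x_i,e);h)\nu(de)$, and $B^\alpha_{\varepsilon,h}U_i=\sum_m\beta_{m,i}(U_{i+m}-U_i)$, $\beta_{m,i}=\int_{|e|>\varepsilon}\omega_m(\eta^\alpha(x_i,e);h)\gamma(x_i,e)\nu(de)$ (basis of $h\mathbb Z^d$). Let $\Delta^{(l)}_+U_i=U_{i+e_l}-U_i$,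 $\Delta^{(l)}_-U_i=U_i-U_{i-e_l}$ ($e_l$ the $l$-th unit vector), $\Delta U_i=(\Delta^{(l)}_+U_i+\Delta^{(l)}_-U_i)_{l=1}^d$. For $\theta>0$, the Lax–Friedrichs flux is $\tilde f^\alpha(\mathbf x,u,\Delta U_i,q)=\bar f^\alpha(\mathbf x,u,\frac{\Delta U_i}{2h},q)+\sum_{l=1}^d\frac\theta\lambda\,\frac{\Delta_+^{(l)}U_i-\Delta_-^{(l)}U_i}{h}$. $\Delta t$ and $k$ are regarded as functions of $h$. Positive interpolation. $\tilde U^n_{k',i(j)}$ is the interpolant of the values on grid $k'$ at node $x_{j,i}$; with $N^{k'}(j,i,n)$ a set of indices of neighbours on $\Omega_{k',h}$ ($\mathbf x^n_{k',a}\to\mathbf x^n_{j,i}$), there are weights $\omega^n_{k',i(j),a}\ge0$, $\sum_a\omega^n_{k',i(j),a}=1$, with $\tilde U^n_{k',i(j)}=\sum_{a\in N^{k'}(j,i,n)}\omega^n_{k',i(j),a}U^n_{k',a}$. Equivalent form and properties. With $S=A^{\alpha_j}_{\varepsilon,h,k}U^{n+1}_{j,i}+K^{\alpha_j,1}_{\varepsilon,h}U^{n+1}_{j,i}+\tilde f^{\alpha_j}(\mathbf x^{n+1}_{j,i},U^{n+1}_{j,i},\Delta U^{n+1}_{j,i},B^{\alpha_j}_{\varepsilon,h}U^{n+1}_{j,i})$, the scheme is $0=G_j(\mathbf x^{n+1}_{j,i},h,U^{n+1}_{j,i},\{U^{b+1}_{j,a}\}_{(a,b)\ne(i,n)},\{\tilde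 U^n_{k'}\}_{k'\ne j})$ with $$G_j=\min\Big[U^{n+1}_{j,i}-\zeta(\mathbf x^{n+1}_{j,i})-\Delta t\,S,\ \tfrac{U^{n+1}_{j,i}-U^n_{j,i}}{\Delta t}-S,\ U^{n+1}_{j,i}-\max_{k'\ne j}(\tilde U^n_{k',i(j)}-c)-\Delta t\,S\Big].$$ ''$\ell^\infty$ stable'': the solution exists and is bounded uniformly in $h$ and $c$. ''Weakly monotone'': if $V^n_{j,i}\ge U^n_{j,i}$ for all $(i,j,n)$ and $\tilde V^n_{k',i(j)}\ge\tilde U^n_{k',i(j)}$ for all $(i,k',n)$, then $G_j(\mathbf x^{n+1}_{j,i},h,U^{n+1}_{j,i},\{V^{b+1}_{j,a}\}_{(a,b)\ne(i,n)},\{\tilde V^n_{k'}\}_{k'\ne j})\le G_j(\mathbf x^{n+1}_{j,i},h,U^{n+1}_{j,i},\{U^{b+1}_{j,a}\}_{(a,b)\ne(i,n)},\{\tilde U^n_{k'}\}_{k'\ne j})$. ''Consistent'': for fixed $\varepsilon,\delta,c$ and any test functions $\phi_j\in C^{1,2}(\bar{\mathcal Q}_T)$ and continuous $\varphi_{k'}$, there exist functions $\omega_1(h)$ and $\omega_2(\xi)$, possibly depending on $\varepsilon$, such that $\omega_1(h)\to0$ as $h\to0$, $\omega_2(\xi)\to0$ as $\xi\to0$, and $$\big|G_j(\mathbf x^{n+1}_{j,i},h,\phi^{n+1}_{j,i}+\xi,\{\phi^{b+1}_{j,a}+\xi\}_{(a,b)\ne(i,n)},\{\tilde\varphi^n_{k'}\}_{k'\ne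 j})-F_j\big|\le\omega_1(h)+\omega_2(\xi),$$ where $\phi^n_{j,i}=\phi_j(\mathbf x^n_{j,i})$, $\tilde\varphi^n_{k',i(j)}$ is the interpolant of the grid values of $\varphi_{k'}(t^n,\cdot)$, and $F_j=\min[\phi_j-\zeta,\ \partial_t\phi_j-L_\varepsilon^{\alpha_j}\phi_j-f(\alpha_j,\mathbf x,\phi_j,(\tilde\sigma^{\alpha_j})^TD\phi_j,B_\varepsilon^{\alpha_j}\phi_j),\ \phi_j-\max_{k'\ne j}(\tilde\varphi^n_{k',i(j)}-c)]$ at $\mathbf x^{n+1}_{j,i}$.
   Formalization: Consistency is proved with ω₁, ω₂ uniform over the nodes in each bounded region |x| ≤ r (the moduli may depend on r); one pair of moduli for all nodes of ℝ^d fails for unbounded test functions such as φ = −e^x. *)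

(* Defs.v *)
From HB Require Import structures.
From mathcomp Require Import all_boot all_order all_algebra.
From mathcomp Require Import all_classical all_reals all_analysis.
Set Implicit Arguments.
Unset Strict Implicit.
Unset Printing Implicit Defensive.
Import Order.TTheory GRing.Theory Num.Theory.
Import numFieldNormedType.Exports.
Local Open Scope classical_set_scope.
Local Open Scope ring_scope.

(* Vectors are row vectors.  The norm of the library on matrices is the max
   norm; |.| is the Euclidean (Frobenius) norm. *)
Definition enorm (R : realType) (m n : nat) (A : 'M[R]_(m, n)) : R :=
  Num.sqrt (\sum_i \sum_j A i j ^+ 2).

Definition dotv (R : realType) (d : nat) (u v : 'rV[R]_d) : R :=
  \sum_l u 0 l * v 0 l.

Notation borel_rV R n := (g_sigma_algebraType (@open 'rV[R]_n)).

(* The domains A, [0, T] and E = R^n \ {0} are encoded by restricting the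
   hypotheses and the integrals to them: a Borel measure on E is a Borel
   measure on R^n whose value at {0} is never looked at. *)
Record problem (R : realType) (d n q : nat) := Problem {
  horizon  : R;
  ctrl     : set 'rV[R]_q;
  drift    : 'rV[R]_q -> 'rV[R]_d -> 'rV[R]_d;
  vol      : 'rV[R]_q -> 'rV[R]_d -> 'M[R]_d;
  jump     : 'rV[R]_q -> 'rV[R]_d -> 'rV[R]_n -> 'rV[R]_d;
  jweight  : 'rV[R]_d -> 'rV[R]_n -> R;
  driver   : 'rV[R]_q -> R -> 'rV[R]_d -> R -> 'rV[R]_d -> R -> R;
  obstacle : R -> 'rV[R]_d -> R;
  initial  : 'rV[R]_d -> R;
  levy     : {measure set (borel_rV R n) -> \bar R} }.

(* One constant C serves for all upper bounds, but the monotonicity of f in u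
   has its own constant C0 > 0: if C0 = C, the Lipschitz bound in u would force
   f to be affine in u with slope -C.
   Measurability is required of eta and gamma only; b, sigma, f, zeta and g are
   continuous in all their arguments by the other fields. *)
Record standing_assumption (R : realType) (d n q : nat)
    (P : problem R d n q) (C C0 : R) : Prop := StandingAssumption {
  sa_C : 0 < C;
  sa_C0 : 0 < C0;
  sa_T : 0 < horizon P;
  sa_ctrl : compact (ctrl P);
  sa_sfinite : sigma_finite [set e : borel_rV R n | e != 0] (levy P);
  sa_levy : (\int[levy P]_(e in [set e | e != 0%R])
               (Num.min 1%R (enorm e ^+ 2))%:E < +oo)%E;
  sa_jump_meas : forall l : 'I_d, measurable_fun
    [set z : borel_rV R q * borel_rV R d * borel_rV R n |
       ctrl P z.1.1 /\ z.2 != 0]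
    (fun z => jump P z.1.1 z.1.2 z.2 0 l);
  sa_jweight_meas : measurable_fun
    [set z : borel_rV R d * borel_rV R n | z.2 != 0]
    (fun z => jweight P z.1 z.2);
  sa_drift_vol : forall a a' x x', ctrl P a -> ctrl P a' ->
    enorm (drift P a x - drift P a' x') + enorm (vol P a x - vol P a' x')
      <= C * (enorm (x - x') + enorm (a - a'));
  sa_jump_lip : forall a a' x x' e, ctrl P a -> ctrl P a' -> e != 0 ->
    enorm (jump P a x e - jump P a' x' e)
      <= C * (enorm (x - x') + enorm (a - a')) * Num.min 1 (enorm e);
  sa_jump_bnd : forall a x e, ctrl P a -> e != 0 ->
    enorm (jump P a x e) <= C * Num.min 1 (enorm e);
  sa_jweight_lip : forall x x' e, e != 0 ->
    `|jweight P x e - jweight P x' e|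
      <= C * enorm (x - x') * Num.min 1 (enorm e ^+ 2);
  sa_jweight_bnd : forall x e, e != 0 ->
    `|jweight P x e| <= C * Num.min 1 (enorm e);
  sa_jweight_ge0 : forall x e, e != 0 -> 0 <= jweight P x e;
  sa_driver_t : forall a x u p k, ctrl P a ->
    {within `[0, horizon P], continuous (fun t => driver P a t x u p k)};
  sa_driver_bnd : forall a t x, ctrl P a -> 0 <= t <= horizon P ->
    `|driver P a t x 0 0 0| <= C;
  sa_driver_u : forall a t x u v p k, ctrl P a -> 0 <= t <= horizon P ->
    v <= u -> C0 * (u - v) <= driver P a t x v p k - driver P a t x u p k;
  sa_driver_k : forall a t x u p k k', ctrl P a -> 0 <= t <= horizon P ->
    k <= k' -> driver P a t x u p k <= driver P a t x u p k';
  sa_driver_lip : forall a a' t x u v p p' k k',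
    ctrl P a -> ctrl P a' -> 0 <= t <= horizon P ->
    `|driver P a t x u p k - driver P a' t x v p' k'|
      <= C * (enorm (a - a') + `|u - v| + enorm (p - p') + `|k - k'|);
  sa_driver_x : forall rad : R, 0 < rad -> exists m : R -> R,
    [/\ {within `[0, +oo[, continuous m},
        forall s, 0 <= s -> 0 <= m s,
        m 0 = 0 &
        forall a t x x' u p k, ctrl P a -> 0 <= t <= horizon P ->
          enorm x <= rad -> enorm x' <= rad -> `|u| <= rad ->
          `|driver P a t x u p k - driver P a t x' u p k|
            <= m (enorm (x - x') * (1 + enorm p))];
  sa_obstacle_t : forall x,
    {within `[0, horizon P], continuous (fun t => obstacle P t x)};
  sa_lip : forall t x x', 0 <= t <= horizon P ->
    `|initial P x - initial P x'| + `|obstacle P t x - obstacle P t x'|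
      <= C * enorm (x - x');
  sa_bnd : forall t x, 0 <= t <= horizon P ->
    `|initial P x| + `|obstacle P t x| <= C;
  sa_compat : forall x, obstacle P 0 x <= initial P x }.

Definition vol_bounded (R : realType) (d n q : nat) (P : problem R d n q) :=
  exists M : R, forall a x, ctrl P a -> enorm (vol P a x) <= M.

Definition control_net (R : realType) (d n q J : nat) (P : problem R d n q)
    (delta : R) (al : 'I_J -> 'rV[R]_q) : Prop :=
  [/\ injective al, forall j, ctrl P (al j) &
      forall a, ctrl P a -> exists j, enorm (a - al j) < delta].

Section Truncated.
Variables (R : realType) (d n q : nat) (P : problem R d n q) (eps : R).
Implicit Types (a : 'rV[R]_q) (t : R) (x : 'rV[R]_d).

Definition big_jumps : set (borel_rV R n) := [set e | eps < enorm e].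
Definition small_jumps : set (borel_rV R n) :=
  [set e | e != 0 /\ enorm e < eps].

Definition tvol a x : 'M[R]_d := \matrix_(i, j)
  if i == j then
    Num.sqrt (vol P a x i i ^+ 2 +
      \int[levy P]_(e in small_jumps) (jump P a x e 0 i ^+ 2))
  else vol P a x i j.

(* For a row vector p, [p *m tvol a x] is the transpose of sigma~^T p. *)
Definition hamiltonian a t x (u : R) (p : 'rV[R]_d) (k : R) : R :=
  driver P a t x u (p *m tvol a x) k.

Definition hamiltonian_lipschitz (L : R) : Prop :=
  forall a t x u p p' k, ctrl P a -> 0 <= t <= horizon P ->
    `|hamiltonian a t x u p k - hamiltonian a t x u p' k|
      <= L * enorm (p - p').

(* The operators act on phi at (t, x) through the values phi(t, .), the
   gradient D and the Hessian D2 at (t, x). *)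
Definition A_op a x (D : 'rV[R]_d) (D2 : 'M[R]_d) : R :=
  2^-1 * \tr (tvol a x *m (tvol a x)^T *m D2) + dotv (drift P a x) D.

Definition K_op a x (phit : 'rV[R]_d -> R) (D : 'rV[R]_d) : R :=
  \int[levy P]_(e in big_jumps)
    (phit (x + jump P a x e) - phit x - dotv (jump P a x e) D).

Definition B_op a x (phit : 'rV[R]_d -> R) : R :=
  \int[levy P]_(e in big_jumps)
    ((phit (x + jump P a x e) - phit x) * jweight P x e).

Definition L_op a x (phit : 'rV[R]_d -> R) (D : 'rV[R]_d) (D2 : 'M[R]_d) : R :=
  A_op a x D D2 + K_op a x phit D.

Definition tdrift a x : 'rV[R]_d :=
  drift P a x + \row_l (- \int[levy P]_(e in big_jumps) (jump P a x e 0 l)).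

Definition closed_cylinder : set (R * 'rV[R]_d) :=
  [set z | 0 <= z.1 <= horizon P].

(* phi is in C^{1,2} on the closed cylinder, with derivatives dtphi, Dphi and
   D2phi; the time derivative is one-sided at t = 0 and t = T. *)
Record C12 (phi dtphi : R -> 'rV[R]_d -> R) (Dphi : R -> 'rV[R]_d -> 'rV[R]_d)
    (D2phi : R -> 'rV[R]_d -> 'M[R]_d) : Prop := MkC12 {
  C12_cont : {within closed_cylinder, continuous (fun z => phi z.1 z.2)};
  C12_contt : {within closed_cylinder, continuous (fun z => dtphi z.1 z.2)};
  C12_contD : {within closed_cylinder, continuous (fun z => Dphi z.1 z.2)};
  C12_contD2 : {within closed_cylinder, continuous (fun z => D2phi z.1 z.2)};
  C12_dt : forall t x, 0 <= t <= horizon P ->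
    (phi s x - phi t x) / (s - t)
      @[s --> within `[0, horizon P] t^'] --> dtphi t x;
  C12_D : forall t x (l : 'I_d), 0 <= t <= horizon P ->
    is_derive x (delta_mx 0 l : 'rV[R]_d) (phi t) (Dphi t x 0 l);
  C12_D2 : forall t x (l m : 'I_d), 0 <= t <= horizon P ->
    is_derive x (delta_mx 0 l : 'rV[R]_d) (fun y => Dphi t y 0 m)
      (D2phi t x l m) }.

End Truncated.

Definition grid (R : realType) (d : nat) (h : R) (x0 : 'rV[R]_d)
    (i : 'rV[int]_d) : 'rV[R]_d := x0 + h *: map_mx intr i.

(* Every x lies in a simplex whose vertices are grid nodes and on which each
   om m is affine, with values 1 at node m and 0 at the other vertices. *)
Definition piecewise_linear (R : realType) (d : nat) (h : R) (x0 : 'rV[R]_d)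
    (om : 'rV[int]_d -> 'rV[R]_d -> R) : Prop :=
  let bary (w : 'I_d.+1 -> R) := (forall v, 0 <= w v) /\ \sum_v w v = 1 in
  let point (s : 'I_d.+1 -> 'rV[int]_d) w := \sum_v w v *: grid h x0 (s v) in
  forall x, exists s : 'I_d.+1 -> 'rV[int]_d,
    (exists2 w, bary w & x = point s w) /\
    (forall w m, bary w -> om m (point s w) = \sum_(v | s v == m) w v).

Definition multilinear (R : realType) (d : nat) (h : R) (x0 : 'rV[R]_d)
    (om : 'rV[int]_d -> 'rV[R]_d -> R) : Prop :=
  forall m x,
    om m x = \prod_l Num.max 0 (1 - `|x 0 l - grid h x0 m 0 l| / h).

(* The ball B(x_m, 2h) is taken in the max norm: it contains the Euclidean one,
   and the support of a multilinear tent is not inside the latter for d > 4.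
   The bound |D om| <= Cw / h is a Lipschitz bound, as om is only Lipschitz. *)
Record tent_basis (R : realType) (d : nat) (Cw h : R) (x0 : 'rV[R]_d)
    (om : 'rV[int]_d -> 'rV[R]_d -> R) : Prop := TentBasis {
  tb_range : forall m x, 0 <= om m x <= 1;
  tb_node : forall m i, om m (grid h x0 i) = (m == i)%:R;
  tb_sum : forall x, \sum_(m \in [set: 'rV[int]_d]) om m x = 1;
  tb_supp : forall m x, om m x != 0 ->
    forall l, `|x 0 l - grid h x0 m 0 l| <= 2 * h;
  tb_lip : forall m x y, `|om m x - om m y| <= Cw / h * enorm (x - y);
  tb_kind : piecewise_linear h x0 om \/ multilinear h x0 om }.

(* Parameters of the scheme.  The mesh size h ranges over ]0, hmax];
   [origin h j] is the node of index 0 of the j-th grid; [tent h x0] is the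
   basis used on the uniform grid of mesh size h through x0; [nbr h n j i k']
   and [wgt h n j i k'] are the neighbours on grid k' of the node (j, i) and
   their interpolation weights at time level n. *)
Record discretization (R : realType) (d J : nat) := Discretization {
  hmax   : R;
  dt     : R -> R;
  kstep  : R -> R;
  theta  : R;
  origin : R -> 'I_J -> 'rV[R]_d;
  tent   : R -> 'rV[R]_d -> 'rV[int]_d -> 'rV[R]_d -> R;
  nbr    : R -> nat -> 'I_J -> 'rV[int]_d -> 'I_J -> set 'rV[int]_d;
  wgt    : R -> nat -> 'I_J -> 'rV[int]_d -> 'I_J -> 'rV[int]_d -> R }.

Section Scheme.
Variables (R : realType) (d n q J : nat) (P : problem R d n q) (eps : R).
Variables (al : 'I_J -> 'rV[R]_q) (Q : discretization R d J).
Implicit Types (h c : R) (j : 'I_J) (i m : 'rV[int]_d) (N : nat).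

Definition mesh h : Prop := 0 < h <= hmax Q.
Definition time h N : R := N%:R * dt Q h.
Definition level h N : Prop := time h N <= horizon P.
Definition node h j i : 'rV[R]_d := grid h (origin Q h j) i.

Record admissible_discretization : Prop := AdmissibleDiscretization {
  ad_hmax : 0 < hmax Q;
  ad_dt : forall h, mesh h -> 0 < dt Q h;
  ad_kstep : forall h, mesh h -> 0 < kstep Q h;
  ad_theta : 0 < theta Q;
  ad_tent : exists Cw : R, forall h x0, mesh h ->
    tent_basis Cw h x0 (tent Q h x0) }.

Record positive_interpolation : Prop := PositiveInterpolation {
  pi_finite : forall h N j i k', mesh h -> level h N -> k' != j ->
    finite_set (nbr Q h N j i k');
  pi_near : forall r : R, 0 < r -> \forall h \near 0^'+,
    forall N j i k' a, mesh h -> level h N -> k' != j ->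
      nbr Q h N j i k' a -> enorm (node h k' a - node h j i) < r;
  pi_ge0 : forall h N j i k' a, mesh h -> level h N -> k' != j ->
    nbr Q h N j i k' a -> 0 <= wgt Q h N j i k' a;
  pi_sum1 : forall h N j i k', mesh h -> level h N -> k' != j ->
    \sum_(a \in nbr Q h N j i k') wgt Q h N j i k' a = 1 }.

Definition interpolant h N j i (V : 'I_J -> 'rV[int]_d -> R) (k' : 'I_J) : R :=
  \sum_(a \in nbr Q h N j i k') wgt Q h N j i k' a * V k' a.

Definition A_coef h j i m : R :=
  let x := node h j i in
  let k := kstep Q h in
  let om := tent Q h (origin Q h j) m in
  2^-1 * (\sum_l (om (x + k *: (col l (tvol P eps (al j) x))^T) +
                  om (x - k *: (col l (tvol P eps (al j) x))^T)) / k ^+ 2) +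
  om (x + k ^+ 2 *: tdrift P eps (al j) x) / k ^+ 2.

Definition A_disc h j (U : 'rV[int]_d -> R) i : R :=
  \sum_(m \in [set: 'rV[int]_d]) A_coef h j i m * (U m - U i).

Definition K_coef h j i m : R :=
  \int[levy P]_(e in big_jumps eps) tent Q h 0 m (jump P (al j) (node h j i) e).

Definition K_disc h j (U : 'rV[int]_d -> R) i : R :=
  \sum_(m \in [set: 'rV[int]_d]) K_coef h j i m * (U (i + m) - U i).

Definition B_coef h j i m : R :=
  \int[levy P]_(e in big_jumps eps)
    (tent Q h 0 m (jump P (al j) (node h j i) e) * jweight P (node h j i) e).

Definition B_disc h j (U : 'rV[int]_d -> R) i : R :=
  \sum_(m \in [set: 'rV[int]_d]) B_coef h j i m * (U (i + m) - U i).

Definition fwd (U : 'rV[int]_d -> R) i (l : 'I_d) : R := U (i + delta_mx 0 l) - U i.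
Definition bwd (U : 'rV[int]_d -> R) i (l : 'I_d) : R := U i - U (i - delta_mx 0 l).
Definition lambda h : R := dt Q h / h.

Definition lax_friedrichs h N j (U : 'rV[int]_d -> R) i (v : R) : R :=
  hamiltonian P eps (al j) (time h N) (node h j i) (U i)
    ((2 * h)^-1 *: \row_l (fwd U i l + bwd U i l)) v +
  \sum_l theta Q / lambda h * ((fwd U i l - bwd U i l) / h).

Definition S_op h N j (U : 'rV[int]_d -> R) i : R :=
  A_disc h j U i + K_disc h j U i + lax_friedrichs h N j U i (B_disc h j U i).

(* The maximum over k' <> j is -oo if J = 1, hence the form of the big maximum
   below and of the big minimum in G_op. *)
Definition half_step h c N j (V : 'I_J -> 'rV[int]_d -> R) i : R :=
  \big[Num.max/Num.max (obstacle P (time h N.+1) (node h j i)) (V j i)]_(k' | k' != j)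
    (interpolant h N j i V k' - c).

Definition solves_scheme h c (U : nat -> 'I_J -> 'rV[int]_d -> R) : Prop :=
  (forall j i, U 0 j i = initial P (node h j i)) /\
  (forall N j i, level h N.+1 ->
     U N.+1 j i - dt Q h * S_op h N.+1 j (U N.+1 j) i
       - half_step h c N j (U N) i = 0).

Definition bounded_by h (U : nat -> 'I_J -> 'rV[int]_d -> R) (M : R) : Prop :=
  forall N j i, level h N -> `|U N j i| <= M.

Definition unique_bounded_solution h c : Prop :=
  exists U, [/\ exists M, bounded_by h U M, solves_scheme h c U &
    forall V, (exists M, bounded_by h V M) -> solves_scheme h c V ->
      forall N j i, level h N -> V N j i = U N j i].

(* G_j at the point (time N.+1, node i), with central value u.  [W b a] stands
   for U^b_{j,a}, its entry at (N.+1, i) being overridden by u; [Wt k'] stands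
   for U~^N_{k',i(j)}.  The last terms are u - max_{k'}(Wt k' - c) - dt S,
   the difference being distributed over the maximum. *)
Definition G_op h c N j i (u : R) (W : nat -> 'rV[int]_d -> R)
    (Wt : 'I_J -> R) : R :=
  let S := S_op h N.+1 j (fun a => if a == i then u else W N.+1 a) i in
  \big[Num.min/
       Num.min (u - obstacle P (time h N.+1) (node h j i) - dt Q h * S)
               ((u - W N i) / dt Q h - S)]_(k' | k' != j)
    (u - (Wt k' - c) - dt Q h * S).

Definition linf_stable : Prop :=
  exists M : R, forall h c, mesh h -> 0 < c ->
    exists2 U, solves_scheme h c U & bounded_by h U M.

Definition weakly_monotone : Prop :=
  forall h c, mesh h -> 0 < c ->
  forall (U V : nat -> 'I_J -> 'rV[int]_d -> R)
         (Ut Vt : nat -> 'I_J -> 'rV[int]_d -> 'I_J -> R),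
    (forall N j i, level h N -> U N j i <= V N j i) ->
    (forall N j i k', level h N -> Ut N j i k' <= Vt N j i k') ->
    forall N j i, level h N.+1 ->
      G_op h c N j i (U N.+1 j i) (fun b => V b j) (Vt N j i)
        <= G_op h c N j i (U N.+1 j i) (fun b => U b j) (Ut N j i).

Definition switching_op c j (phi dtphi : R -> 'rV[R]_d -> R)
    (Dphi : R -> 'rV[R]_d -> 'rV[R]_d) (D2phi : R -> 'rV[R]_d -> 'M[R]_d)
    (Wt : 'I_J -> R) (t : R) (x : 'rV[R]_d) : R :=
  \big[Num.min/
       Num.min (phi t x - obstacle P t x)
         (dtphi t x - L_op P eps (al j) x (phi t) (Dphi t x) (D2phi t x)
          - driver P (al j) t x (phi t x) (Dphi t x *m tvol P eps (al j) x)
              (B_op P eps (al j) x (phi t)))]_(k' | k' != j)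
    (phi t x - (Wt k' - c)).

(* The moduli are uniform over the nodes of each bounded region |x| <= rad: the
   test functions and the coefficients need not be bounded in x, and the
   truncation errors grow with them. *)
Definition consistent : Prop :=
  forall c, 0 < c ->
  forall (phi dtphi : 'I_J -> R -> 'rV[R]_d -> R)
         (Dphi : 'I_J -> R -> 'rV[R]_d -> 'rV[R]_d)
         (D2phi : 'I_J -> R -> 'rV[R]_d -> 'M[R]_d)
         (psi : 'I_J -> R -> 'rV[R]_d -> R),
    (forall j, C12 P (phi j) (dtphi j) (Dphi j) (D2phi j)) ->
    (forall k', {within closed_cylinder P,
                 continuous (fun z => psi k' z.1 z.2)}) ->
  forall rad : R, 0 < rad -> exists w1 w2 : R -> R,
    [/\ w1 h @[h --> 0^'+] --> 0, w2 xi @[xi --> 0] --> 0 &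
      forall h xi N j i, mesh h -> level h N.+1 -> enorm (node h j i) <= rad ->
        let psit := interpolant h N j i (fun k' a => psi k' (time h N) (node h k' a)) in
        let phig := fun b a => phi j (time h b) (node h j a) + xi in
        `|G_op h c N j i (phig N.+1 i) phig psit
          - switching_op c j (phi j) (dtphi j) (Dphi j) (D2phi j) psit
              (time h N.+1) (node h j i)| <= w1 h + w2 xi].

End Scheme.

(* Main.v *)
(** The step operator S is nondecreasing in the off-centre values because the
    coefficients of A, K and B are nonnegative and the Lax-Friedrichs term with
    theta >= L lambda absorbs the Lipschitz dependence of the Hamiltonian on
    the gradient; it decreases by at least C0 m when a constant m >= 0 is added
    to the grid function.  For rho small the relaxation
    U |-> U - rho (U - dt S U - v) is therefore nondecreasing and contracts
    constants.  Existence at each time step follows from the Knaster-Tarski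
    theorem on [-M, M] with the barriers +-M, where M = C + C/C0 depends neither
    on h nor on c, and uniqueness follows from the contraction.
    For consistency, a tent basis averages over the vertices of a cell with
    barycentric weights, so interpolation is exact on affine functions and its
    error is O(h^2): A is consistent since h/k -> 0, the artificial viscosity
    is O(h^2/dt), and the nonlocal terms only need the uniform continuity of
    the test function on compact sets. *)

Require Import Defs.
From HB Require Import structures.
From mathcomp Require Import all_boot all_order all_algebra.
From mathcomp Require Import all_classical all_reals all_analysis.
From mathcomp Require Import measurable_realfun.
From mathcomp Require Import finmap zify ring lra.
Set Implicit Arguments.
Unset Strict Implicit.
Unset Printing Implicit Defensive.
Import Order.TTheory GRing.Theory Num.Theory.
Import numFieldNormedType.Exports.
Local Open Scope classical_set_scope.
Local Open Scope ring_scope.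

(** * Tent functions as barycentric weights *)

(** The coefficients of A, K and B are tents at shifted points, summed over an infinite lattice.
    Each family is brought to one shape, [averaging]: finite support, nonnegative weights and a
    closed form of the weighted sum. Monotonicity uses the first two, consistency the third. [C12]
    provides partial derivatives and joint continuity, so Taylor expansions proceed one coordinate
    at a time and get their uniformity from compactness. In M = C + C/C0 the first term bounds the
    initial value and the obstacle; the second is the level beyond which the decay of f in u
    outweighs |f(a, t, x, 0, 0, 0)| <= C. The switching cost c is only ever subtracted inside a
    maximum, hence bounds free of c. A nondecreasing map that contracts constants contracts sup
    distances (Blackwell's argument): this gives uniqueness among bounded solutions. Existence uses
    only the order completeness of the reals, node by node. Estimates for small h do not yet give
    the modulus [w1], which must bound the error at every h in ]0, hmax]. It is taken to be the
    supremum of the errors over the bounded region, where each h leaves finitely many nodes. *)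

Lemma finite_int_box (d : nat) (B : nat) :
  finite_set [set m : 'rV[int]_d | forall l, `|m 0 l| <= B%:Z].
Proof.
pose f (u : {ffun 'I_d -> 'I_(B + B).+1}) : 'rV[int]_d :=
  \row_l ((u l : nat)%:Z - B%:Z).
apply: (@sub_finite_set _ _ (range f)); last first.
  by apply: finite_image; exact: finite_finset.
move=> m mB; exists [ffun l => inord `|(m 0 l + B%:Z)%R|%N] => //.
apply/rowP => l; rewrite mxE ffunE.
have := mB l; rewrite ler_norml => /andP[h1 h2].
rewrite inordK; first by rewrite gez0_abs; lia.
by lia.
Qed.

(** Source of the finite supports: the tents that are nonzero at a point, those reached by bounded
    jumps, and the nodes of a bounded region all lie in such a box. *)
Lemma finite_grid_box (R : realType) (d : nat) (h r : R) (x0 y : 'rV[R]_d) :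
  0 < h ->
  finite_set [set m | forall l, `|y 0 l - grid h x0 m 0 l| <= r].
Proof.
move=> h0; set S := [set _ | _].
pose b := `|r| / h + \sum_l `|y 0 l - x0 0 l| / h.
apply: (sub_finite_set _ (finite_int_box d (Num.trunc b).+1)).
move=> m mS l; have := mS l; rewrite /grid !mxE.
have b0 : 0 <= b.
  by rewrite addr_ge0 ?sumr_ge0// => *; rewrite divr_ge0// ltW.
set a := m 0 l; move=> Hl.
suff : `|a|%:~R <= b :> R.
  move=> ab; have := lt_succ_floor b; have := truncn_itv b0.
  move=> /andP[_ tb] _; have : (`|a|%:~R : R) < ((Num.trunc b).+1)%:Z%:~R.
    exact: le_lt_trans ab tb.
  by rewrite ltr_int => /ltW.
have -> : (`|a|%:~R : R) = `|h * a%:~R| / h.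
  by rewrite normrM gtr0_norm// mulrAC divff ?gt_eqF// mul1r intr_norm.
rewrite /b (bigD1 l)//= addrA -mulrDl.
apply: (@le_trans _ _ ((`|r| + `|y 0 l - x0 0 l|) / h)); last first.
  by rewrite lerDl sumr_ge0// => *; rewrite divr_ge0// ltW.
rewrite ler_pM2r ?invr_gt0//.
have -> : h * a%:~R = (y 0 l - x0 0 l) - (y 0 l - (x0 0 l + h * a%:~R)) by ring.
apply: le_trans (ler_normB _ _) _; rewrite addrC lerD2r.
by apply: le_trans Hl (ler_norm _).
Qed.

Section WeightedSums.
Variables (R : realType) (T : choiceType).
Implicit Types a X Y : T -> R.

Lemma fsumT_seq (r : seq T) X : uniq r -> (forall m, m \notin r -> X m = 0) ->
  \sum_(m \in [set: T]) X m = \sum_(m <- r) X m.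
Proof.
move=> ur out; rewrite (fsbigE _ _ ur); [|by []|by move=> m _; exact: out].
by apply: eq_bigl => m; rewrite in_setT.
Qed.

(** One sequence serves for all [X], so linear relations between weighted sums can be checked term
    by term. *)
Lemma fsum_seq a : finite_set [set m | a m != 0] -> exists r : seq T,
  [/\ uniq r, forall m, m \notin r -> a m = 0 &
      forall X, \sum_(m \in [set: T]) a m * X m = \sum_(m <- r) a m * X m].
Proof.
move=> fa; exists (enum_fset (fset_set [set m | a m != 0])).
have aout m : m \notin fset_set [set m | a m != 0] -> a m = 0.
  by rewrite in_fset_set// notin_setE /= => /negP; rewrite negbK => /eqP.
split; [exact: fset_uniq | by move=> m /aout | move=> X].
by apply: fsbigTE => m /aout ->; rewrite mul0r.
Qed.

Lemma fsum_le a X Y : finite_set [set m | a m != 0] ->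
  (forall m, 0 <= a m) -> (forall m, X m <= Y m) ->
  \sum_(m \in [set: T]) a m * X m <= \sum_(m \in [set: T]) a m * Y m.
Proof.
move=> /fsum_seq[r [_ _ E]] a0 XY; rewrite !E.
by apply: ler_sum => m _; rewrite ler_wpM2l.
Qed.

Lemma fsumB a X Y : finite_set [set m | a m != 0] ->
  \sum_(m \in [set: T]) a m * (X m - Y m) =
  \sum_(m \in [set: T]) a m * X m - \sum_(m \in [set: T]) a m * Y m.
Proof.
move=> /fsum_seq[r [_ _ E]]; rewrite !E -sumrB.
by apply: eq_bigr => m _; rewrite mulrBr.
Qed.

Lemma fsum_cst a (x : R) : finite_set [set m | a m != 0] ->
  \sum_(m \in [set: T]) a m * x = (\sum_(m \in [set: T]) a m) * x.
Proof.
move=> /fsum_seq[r [_ _ E]].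
rewrite [in RHS](eq_fsbigr (fun m => a m * 1)); last by move=> m _; rewrite mulr1.
by rewrite !E mulr_suml; apply: eq_bigr => m _; rewrite mulr1.
Qed.

(** The monotonicity of A, K and B in one inequality: raising the off-centre values raises the sum,
    and raising the centre costs at most the total weight times the rise. *)
Lemma fsum_centered a X Y (x y t : R) : finite_set [set m | a m != 0] ->
  (forall m, 0 <= a m) -> \sum_(m \in [set: T]) a m <= t ->
  (forall m, X m <= Y m) -> x <= y ->
  \sum_(m \in [set: T]) a m * (X m - x)
    <= \sum_(m \in [set: T]) a m * (Y m - y) + t * (y - x).
Proof.
move=> fa a0 at_ XY xy; rewrite !fsumB// !fsum_cst//.
have := fsum_le fa a0 XY.
have : (\sum_(m \in [set: T]) a m) * (y - x) <= t * (y - x).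
  by rewrite ler_wpM2r// subr_ge0.
lra.
Qed.

End WeightedSums.

Section Barycentric.
Variables (R : realType) (d : nat).
Implicit Types (y : 'rV[R]_d) (om : 'rV[int]_d -> 'rV[R]_d -> R).

(** Common form of the two kinds of tent basis: the vertices are those of a simplex or the 2^d
    corners of a cube. [s] may repeat a node, hence the sum over its fibre. *)
Definition barycentric (h : R) (x0 : 'rV[R]_d) om y (I : finType) (s : I -> 'rV[int]_d)
    (w : I -> R) : Prop :=
  [/\ forall v, 0 <= w v, \sum_v w v = 1,
      y = \sum_v w v *: grid h x0 (s v) &
      forall m, om m y = \sum_(v | s v == m) w v].

(** The corners of the cell of [y] are indexed by boolean functions and weighted by products of
    one-dimensional weights. Each claim is the expansion of a product over coordinates of sums over
    booleans. *)
Lemma multilinear_barycentric (h : R) (x0 : 'rV[R]_d) om y : 0 < h -> multilinear h x0 om ->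
  exists (I : finType) (s : I -> 'rV[int]_d) (w : I -> R),
    barycentric h x0 om y s w.
Proof.
move=> h0 omE.
pose z l : R := (y 0 l - x0 0 l) / h.
pose c l : int := Num.floor (z l).
pose f l : R := z l - (c l)%:~R.
pose F l (b : bool) : R := if b then f l else 1 - f l.
have f01 l : 0 <= f l < 1.
  have := mem_rg1_floor (z l); rewrite /range1 /mkset /f /c => /andP[c1 c2]; lra.
have F0 l b : 0 <= F l b by have := f01 l; rewrite /F; case: b; lra.
have sumF l : \sum_b F l b = 1 by rewrite big_bool /F /=; ring.
have zE l : y 0 l = x0 0 l + h * (z l).
  by rewrite /z mulrC divfK ?gt_eqF// addrC subrK.
exists {ffun 'I_d -> bool},
  (fun b : {ffun 'I_d -> bool} => \row_l (c l + (b l : nat)%:Z)),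
  (fun b : {ffun 'I_d -> bool} => \prod_l F l (b l)); split.
- by move=> b; apply: prodr_ge0.
- by rewrite -(bigA_distr_bigA F) big1.
- apply/rowP => l; rewrite summxE.
  transitivity (\sum_b F l b * (x0 0 l + h * (c l + (b : nat)%:Z)%:~R)).
    by rewrite big_bool /F /= zE {1}(_ : z l = (c l)%:~R + f l); [rewrite !intrD; ring|rewrite /f; ring].
  (* The corner's coordinate is inserted in the factor [l] only; the other factors sum to 1. *)
  pose G k b := if k == l then F l b * (x0 0 l + h * (c l + (b : nat)%:Z)%:~R)
                else F k b.
  transitivity (\prod_k \sum_b G k b).
    rewrite (bigD1 l)//= [X in _ * X]big1 ?mulr1; first by apply: eq_bigr => b _; rewrite /G eqxx.
    by move=> k kl; rewrite -(sumF k); apply: eq_bigr => b _; rewrite /G (negbTE kl).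
  rewrite (bigA_distr_bigA G); apply: eq_bigr => b _.
  rewrite /grid !mxE (bigD1 l)//= (bigD1 (P := predT) l)//= /G eqxx.
  rewrite mulrAC; congr (_ * _ * _).
  by apply: eq_bigr => k kl; rewrite (negbTE kl).
- move=> m; rewrite omE.
  (* In one dimension the hat function at p takes the value 1 - f if p is the floor of z, f if p is
     the next integer, and 0 otherwise. *)
  transitivity (\prod_l \sum_(b : bool) (if c l + (b : nat)%:Z == m 0 l then F l b else 0)).
    apply: eq_bigr => l _; rewrite /grid !mxE.
    have -> : `|y 0 l - (x0 0 l + h * (m 0 l)%:~R)| / h = `|z l - (m 0 l)%:~R|.
      rewrite zE (_ : _ - _ = h * (z l - (m 0 l)%:~R)); last by ring.
      by rewrite normrM gtr0_norm// mulrAC divff ?mul1r// gt_eqF.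
    rewrite big_bool /F /= addr0; have := f01 l.
    rewrite (_ : z l = (c l)%:~R + f l); last by rewrite /f; ring.
    move: (f l) (c l) (m 0 l) => u k p u01 {omE}.
    case: (eqVneq k p) => [->|kp].
      have -> : (p + 1 == p) = false by lia.
      rewrite addrAC subrr add0r add0r ger0_norm; last lra.
      by rewrite max_r//; lra.
    case: (eqVneq (k + 1) p) => [<-|k1p].
      rewrite intrD /= addr0 (_ : k%:~R + u - _ = u - 1); last by ring.
      rewrite ler0_norm ?max_r; lra.
    rewrite addr0 max_l// subr_le0.
    have /orP[kl|kl] : (p + 1 <= k) || (k + 2 <= p) by lia.
      have : (p + 1)%:~R <= (k%:~R : R) by rewrite ler_int.
      by rewrite intrD /= => ?; rewrite ger0_norm; lra.
    have : (k + 2)%:~R <= (p%:~R : R) by rewrite ler_int.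
    by rewrite intrD /= => ?; rewrite ler0_norm; lra.
  rewrite (bigA_distr_bigA (fun l (b : bool) => if c l + (b : nat)%:Z == m 0 l then F l b else 0)).
  rewrite [RHS]big_mkcond; apply: eq_bigr => b _ /=.
  case: eqP => [<-|bm].
    by apply: eq_bigr => l _; rewrite mxE eqxx.
  apply/eqP/prodf_eq0; have [l bl] : exists l, c l + (b l : nat)%:Z != m 0 l.
    apply/not_existsP => H; apply: bm; apply/rowP => l; rewrite mxE.
    by have /negP := H l; rewrite negbK => /eqP.
  by exists l => //; rewrite (negbTE bl).
Qed.

Lemma tent_barycentric (Cw h : R) x0 om y : 0 < h -> tent_basis Cw h x0 om ->
  exists (I : finType) (s : I -> 'rV[int]_d) (w : I -> R),
    barycentric h x0 om y s w.
Proof.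
move=> h0 [_ _ _ _ _ [pl|]]; last exact: multilinear_barycentric.
have [s [[w [w0 w1] yE] omE]] := pl y.
exists 'I_d.+1, s, w; split => // m.
by rewrite {1}yE omE.
Qed.

(** The tent at node [s v] is a sum of nonnegative weights that includes [w v], so it cannot vanish
    at [y] and its support condition applies. *)
Lemma barycentric_supp (Cw h : R) x0 om y (I : finType) (s : I -> 'rV[int]_d) w :
  tent_basis Cw h x0 om -> barycentric h x0 om y s w ->
  forall v, w v != 0 -> forall l, `|y 0 l - grid h x0 (s v) 0 l| <= 2 * h.
Proof.
move=> tb [w0 _ _ omE] v wv; apply: (tb_supp tb).
rewrite omE gt_eqF// (bigD1 v)//= ltr_wpDr ?sumr_ge0//.
by rewrite lt_neqAle eq_sym wv w0.
Qed.

Lemma tent_supp_finite (Cw h : R) x0 om y : 0 < h -> tent_basis Cw h x0 om ->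
  finite_set [set m | om m y != 0].
Proof.
move=> h0 tb; apply: sub_finite_set (finite_grid_box (2 * h) x0 y h0).
by move=> m /= /(tb_supp tb).
Qed.

Lemma barycentric_sum (Cw h : R) x0 om y (I : finType) (s : I -> 'rV[int]_d) w :
  0 < h -> tent_basis Cw h x0 om -> barycentric h x0 om y s w ->
  forall V : 'rV[int]_d -> R,
    \sum_(m \in [set: 'rV[int]_d]) om m y * V m = \sum_v w v * V (s v).
Proof.
move=> h0 tb bc V; have [w0 _ _ omE] := bc.
have [r [ur rout ->]] := fsum_seq (tent_supp_finite y h0 tb).
transitivity (\sum_(m <- r) \sum_(v | s v == m) w v * V (s v)).
  apply: eq_bigr => m _; rewrite omE mulr_suml.
  by apply: eq_bigr => v /eqP ->.
rewrite (exchange_big_dep predT)//=; apply: eq_bigr => v _.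
have [svr|/rout] := boolP (s v \in r).
  rewrite big_mkcond (bigD1_seq (s v))//= eqxx big1 ?addr0// => m.
  by rewrite eq_sym => /negbTE ->.
(* Off [r] the tent vanishes, hence so does every weight of the fibre, [w v] among them. *)
rewrite omE => /eqP; rewrite psumr_eq0// => /allP /(_ v (mem_index_enum _)).
rewrite eqxx /= => /eqP ->; rewrite mul0r big1// => m _; by rewrite mul0r.
Qed.

End Barycentric.

(** * Measurability and integrals against the Levy measure *)

Section RowVectorMeasurability.
Variables (R : realType) (d : nat).

(** An open set is the union of the countably many boxes with rational centre and radius 1/(k+1)
    that it contains, and the preimage of a box is measurable coordinate by coordinate. *)
Lemma measurable_preimage_open disp (T : measurableType disp) (D : set T)
    (f : T -> 'rV[R]_d) : measurable D ->
  (forall l, measurable_fun D (fun e => f e 0 l)) ->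
  forall O : set 'rV[R]_d, open O -> measurable (D `&` f @^-1` O).
Proof.
move=> mD mf O oO.
pose box (p : 'rV[rat]_d * nat) : set 'rV[R]_d :=
  [set y | forall l, ball (ratr (p.1 0 l) : R) (p.2.+1%:R^-1) (y 0 l)].
have mbox p : measurable (D `&` f @^-1` (box p)).
  rewrite (_ : _ `&` _ = D `\` \bigcup_(l in [set: 'I_d])
     (D `&` (fun e => f e 0 l) @^-1` (~` ball (ratr (p.1 0 l) : R) (p.2.+1%:R^-1)))).
    apply: measurableD => //; apply: fin_bigcup_measurable => // l _.
    by apply: (mf l) => //; apply: measurableC; exact: measurable_ball.
  apply/seteqP; split=> [e [De eb]|e [De eb]]; split=> //.
    by move=> [l _ [_]]; apply; exact: eb.
  by move=> l; apply: contrapT => H; apply: eb; exists l.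
pose F p : set T := if `[< box p `<=` O >] then D `&` f @^-1` (box p) else set0.
rewrite (_ : _ `&` _ = \bigcup_p F p).
  apply: countable_bigcupT_measurable => // p.
  by rewrite /F; case: ifP => // _; exact: measurable0.
apply/seteqP; split=> [e [De Oe]|e [p _]]; last first.
  by rewrite /F; case: ifP => // /asboolP bO [De /bO].
have /nbhs_ballP[r /= r0 rO] : nbhs (f e) O by apply: open_nbhs_nbhs.
(* Half of [r], because the box is centred at a rational point near [f e]: one radius leads from
   [f e] to the centre, another from the centre to [y]. *)
have [k kr] : exists k, k.+1%:R^-1 < r / 2.
  have [k _ /(_ k (leqnn _))] : \forall k \near \oo, k.+1%:R^-1 < r / 2.
    by apply: near_infty_natSinv_lt (PosNum _); rewrite divr_gt0.
  by exists k.
have k0 : 0 < k.+1%:R^-1 :> R by rewrite invr_gt0.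
have /choice[q qP] : forall l, exists q : rat,
    ball (f e 0 l) (k.+1%:R^-1) (ratr q : R).
  move=> l; have [|q] := @rat_in_itvoo R (f e 0 l - k.+1%:R^-1) (f e 0 l + k.+1%:R^-1).
    by rewrite ltrD2l gtrN.
  by rewrite in_itv /= => qi; exists q; rewrite /ball /= ltr_distlC.
pose p := (\row_l q l, k); exists p => //.
have pO : box p `<=` O.
  move=> y yp; apply: rO; split=> // i l; rewrite (ord1 i).
  apply: (@le_ball _ _ _ (k.+1%:R^-1 + k.+1%:R^-1)); first by rewrite ltW// [ltRHS](splitr r) ltrD.
  by apply: ball_triangle (qP l) _; have := yp l; rewrite mxE.
rewrite /F asboolT //; split=> // l; rewrite mxE; exact/ball_sym/qP.
Qed.

Lemma measurable_fun_open disp (T : measurableType disp) (D : set T)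
    (g : T -> R) :
  (forall O, open O -> measurable (D `&` g @^-1` O)) -> measurable_fun D g.
Proof.
move=> H; apply: (measurability _ (RGenOpens.measurableE R)).
move=> _ [_ [a [b ->] <-]]; exact/H/interval_open.
Qed.

Lemma measurable_fun_continuous_comp disp (T : measurableType disp) (D : set T)
    (f : T -> 'rV[R]_d) (g : 'rV[R]_d -> R) : measurable D ->
  (forall l, measurable_fun D (fun e => f e 0 l)) ->
  continuous g -> measurable_fun D (g \o f).
Proof.
move=> mD mf /continuousP cg; apply: measurable_fun_open => O /cg oO.
by rewrite comp_preimage; exact: measurable_preimage_open.
Qed.

Lemma open_borel (O : set 'rV[R]_d) : open O ->
  measurable (O : set (borel_rV R d)).
Proof. by move=> oO; apply: sub_sigma_algebra. Qed.

Lemma continuous_borel (g : 'rV[R]_d -> R) : continuous g ->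
  measurable_fun [set: borel_rV R d] (g : borel_rV R d -> R).
Proof.
move=> /continuousP cg; apply: measurable_fun_open => O /cg oO.
by rewrite setTI; exact: open_borel.
Qed.

End RowVectorMeasurability.

Section EuclideanNorm.
Variable R : realType.

Lemma enorm_ge0 m n (A : 'M[R]_(m, n)) : 0 <= enorm A.
Proof. exact: sqrtr_ge0. Qed.

Lemma coord_enorm m n (A : 'M[R]_(m, n)) i j : `|A i j| <= enorm A.
Proof.
rewrite -sqrtr_sqr ler_wsqrtr//.
rewrite (bigD1 i)//= (bigD1 j)//= -addrA lerDl addr_ge0//.
  by apply: sumr_ge0 => *; rewrite sqr_ge0.
by apply: sumr_ge0 => *; apply: sumr_ge0 => *; rewrite sqr_ge0.
Qed.

Lemma enorm_le_sum n (x : 'rV[R]_n) : enorm x <= \sum_l `|x 0 l|.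
Proof.
rewrite /enorm big_ord1 -[leRHS]ger0_norm ?sumr_ge0// -sqrtr_sqr ler_wsqrtr//.
rewrite expr2 mulr_suml; apply: ler_sum => l _.
rewrite -real_normK ?num_real// expr2 ler_wpM2l//.
by rewrite (bigD1 l)//= lerDl sumr_ge0.
Qed.

Lemma enorm0 m n : enorm (0 : 'M[R]_(m, n)) = 0.
Proof.
by rewrite /enorm big1 ?sqrtr0// => i _; rewrite big1// => j _; rewrite mxE expr0n.
Qed.

Lemma continuous_sum (T : topologicalType) (I : Type) (r : seq I)
    (f : I -> T -> R) : (forall i, continuous (f i)) ->
  continuous (fun x => \sum_(i <- r) f i x).
Proof.
move=> cf; elim: r => [|i r IH] x.
  under eq_fun do rewrite big_nil; exact: cvg_cst.
by under eq_fun do rewrite big_cons; apply: cvgD; [exact: cf | exact: IH].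
Qed.

Lemma continuous_enorm n : continuous (@enorm R 1 n).
Proof.
move=> x; apply: (@continuous_comp _ _ _ _ Num.sqrt); last exact: sqrt_continuous.
apply: continuous_sum => i; apply: continuous_sum => j y.
by apply: (@continuousM _ _ (fun z : 'rV[R]_n => z i j) (fun z => z i j));
  exact: coord_continuous.
Qed.

End EuclideanNorm.

Section Levy.
Variables (R : realType) (d n q : nat) (P : problem R d n q) (C C0 : R).
Hypothesis hP : standing_assumption P C C0.
Variable eps : R.
Hypothesis eps0 : 0 < eps.
Local Notation nu := (levy P).
Local Notation big := (@big_jumps R n eps).
Local Notation small := (@small_jumps R n eps).

Lemma measurable_big_jumps : measurable big.
Proof.
apply: open_borel; rewrite (_ : big = @enorm R 1 n @^-1` `]eps, +oo[%classic).
  by have /continuousP := @continuous_enorm R n; apply; exact: interval_open.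
by apply/seteqP; split => e /=; rewrite /big_jumps /= in_itv /= andbT.
Qed.

Lemma measurable_nonzero : measurable [set e : borel_rV R n | e != 0].
Proof.
apply: open_borel; rewrite (_ : mkset _ = @enorm R 1 n @^-1` `]0, +oo[%classic).
  by have /continuousP := @continuous_enorm R n; apply; exact: interval_open.
apply/seteqP; split => e /=; rewrite in_itv /= andbT.
  move=> e0; rewrite lt_neqAle enorm_ge0 andbT eq_sym; apply: contra e0 => /eqP E.
  apply/eqP/rowP => l; rewrite mxE; apply/eqP.
  by rewrite -normr_le0 -E coord_enorm.
by apply: contraTneq => ->; rewrite enorm0 ltxx.
Qed.

Lemma measurable_small_jumps : measurable small.
Proof.
rewrite (_ : small = [set e | e != 0] `&` @enorm R 1 n @^-1` `]-oo, eps[%classic).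
  apply: measurableI; first exact: measurable_nonzero.
  apply: open_borel.
  by have /continuousP := @continuous_enorm R n; apply; exact: interval_open.
by apply/seteqP; split => e /=; rewrite /small_jumps /= in_itv /=.
Qed.

Lemma big_jumps_neq0 e : big e -> e != 0.
Proof.
rewrite /big_jumps /=; apply: contraTneq => ->.
by rewrite enorm0 -leNgt ltW.
Qed.

Lemma measurable_levy_weight : measurable_fun [set e : borel_rV R n | e != 0]
  (fun e => (Num.min 1 (enorm (e : 'rV[R]_n) ^+ 2))%:E).
Proof.
apply/measurable_EFinP; apply: measurable_minr => //.
apply: measurable_funX; apply: measurable_funTS.
by apply: continuous_borel; exact: continuous_enorm.
Qed.

Lemma levy_weight_ge0 (e : 'rV[R]_n) : 0 <= Num.min 1 (enorm e ^+ 2).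
Proof. by rewrite le_min ler01 exprn_ge0// enorm_ge0. Qed.

(** Chebyshev's inequality: on the big jumps the integrable weight min(1, |e|^2) is at least min(1,
    eps^2) > 0. *)
Lemma levy_big_jumps : (nu big < +oo)%E.
Proof.
pose r := Num.min 1 (eps ^+ 2).
have r0 : 0 < r by rewrite lt_min ltr01 exprn_gt0.
suff : (r%:E * nu big < +oo)%E.
  have := measure_ge0 nu big; case: (nu big) => [s| |]//= _.
    by move=> _; exact: ltry.
  by rewrite gt0_muley ?lte_fin// ltxx.
rewrite -integral_cst; last exact: measurable_big_jumps.
apply: le_lt_trans (sa_levy hP).
apply: le_trans; last first.
  apply: (ge0_subset_integral nu measurable_big_jumps measurable_nonzero
    measurable_levy_weight).
  - by move=> e _; rewrite lee_fin levy_weight_ge0.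
  - by move=> e; exact: big_jumps_neq0.
apply: ge0_le_integral.
- exact: measurable_big_jumps.
- by move=> e _; rewrite lee_fin ltW.
- exact: measurable_cst.
- apply: measurable_funS measurable_levy_weight; first exact: measurable_nonzero.
  by move=> e; exact: big_jumps_neq0.
- move=> e be; rewrite lee_fin /r.
  have : eps ^+ 2 <= enorm (e : 'rV[R]_n) ^+ 2 by rewrite lerXn2r ?nnegrE ?enorm_ge0 ?(ltW eps0)// ltW.
  by move=> H; rewrite le_min !ge_min lexx /= H orbT.
Qed.

Definition big_mass : R := fine (nu big).

Lemma big_mass_ge0 : 0 <= big_mass.
Proof. exact/fine_ge0/measure_ge0. Qed.

(** As the big jumps have finite mass, this class consists of integrable functions; unlike
    integrability it is stable under products, which the weight [jweight] calls for. *)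
Definition bounded_measurable (f : borel_rV R n -> R) : Prop :=
  measurable_fun big f /\ exists M, forall e, big e -> `|f e| <= M.

Lemma bounded_measurable_integrable f : bounded_measurable f ->
  nu.-integrable big (EFin \o f).
Proof.
move=> [mf [M fM]]; apply: measurable_bounded_integrable => //.
- exact: measurable_big_jumps.
- exact: levy_big_jumps.
- exists M; split; first exact: num_real.
  by move=> x Mx e be; apply: le_trans (fM e be) (ltW Mx).
Qed.

Lemma bounded_measurable_cst (x : R) : bounded_measurable (fun=> x).
Proof. by split; [exact: measurable_cst | exists `|x|]. Qed.

Lemma bounded_measurableD f g : bounded_measurable f -> bounded_measurable g ->
  bounded_measurable (fun e => f e + g e).
Proof.
move=> [mf [M fM]] [mg [M' gM]]; split; first exact: measurable_funD.
exists (M + M') => e be; apply: le_trans (ler_normD _ _) _.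
by rewrite lerD ?fM ?gM.
Qed.

Lemma bounded_measurableM f g : bounded_measurable f -> bounded_measurable g ->
  bounded_measurable (fun e => f e * g e).
Proof.
move=> [mf [M fM]] [mg [M' gM]]; split; first exact: measurable_funM.
exists (M * M') => e be; rewrite normrM ler_pM ?fM ?gM//.
Qed.

Lemma bounded_measurableB f g : bounded_measurable f -> bounded_measurable g ->
  bounded_measurable (fun e => f e - g e).
Proof.
move=> bf [mg [M' gM]]; apply: bounded_measurableD => //.
split; first exact: measurable_funN.
by exists M' => e be; rewrite normrN gM.
Qed.

Lemma bounded_measurable_sum (I : Type) (r : seq I) (f : I -> borel_rV R n -> R) :
  (forall i, bounded_measurable (f i)) ->
  bounded_measurable (fun e => \sum_(i <- r) f i e).
Proof.
move=> bf; elim: r => [|i r IH].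
  by under eq_fun do rewrite big_nil; exact: bounded_measurable_cst.
by under eq_fun do rewrite big_cons; exact: bounded_measurableD.
Qed.

Lemma int_big_sum (I : Type) (r : seq I) (f : I -> borel_rV R n -> R) :
  (forall i, bounded_measurable (f i)) ->
  \int[nu]_(e in big) (\sum_(i <- r) f i e) =
  \sum_(i <- r) \int[nu]_(e in big) f i e.
Proof.
move=> bf; elim: r => [|i r IH].
  under eq_Rintegral do rewrite big_nil.
  by rewrite big_nil Rintegral_cst ?mul0r//; exact: measurable_big_jumps.
under eq_Rintegral do rewrite big_cons.
rewrite RintegralD ?IH ?big_cons//; first exact: measurable_big_jumps.
- exact: bounded_measurable_integrable.
- exact/bounded_measurable_integrable/bounded_measurable_sum.
Qed.

Lemma int_bigB f g : bounded_measurable f -> bounded_measurable g ->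
  \int[nu]_(e in big) (f e - g e) =
  \int[nu]_(e in big) f e - \int[nu]_(e in big) g e.
Proof.
move=> bf bg; apply: RintegralB; first exact: measurable_big_jumps.
- exact: bounded_measurable_integrable.
- exact: bounded_measurable_integrable.
Qed.

Lemma int_bigZr f (x : R) : bounded_measurable f ->
  \int[nu]_(e in big) (f e * x) = (\int[nu]_(e in big) f e) * x.
Proof.
move=> bf; apply: RintegralZr; first exact: measurable_big_jumps.
exact: bounded_measurable_integrable.
Qed.

Lemma int_big_le f (M : R) : bounded_measurable f ->
  (forall e, big e -> f e <= M) -> \int[nu]_(e in big) f e <= M * big_mass.
Proof.
move=> bf fM; rewrite /big_mass -Rintegral_cst; last exact: measurable_big_jumps.
apply: le_Rintegral => //; first exact: measurable_big_jumps.
- exact: bounded_measurable_integrable.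
- exact/bounded_measurable_integrable/bounded_measurable_cst.
Qed.

Lemma int_big_norm f (M : R) : bounded_measurable f ->
  (forall e, big e -> `|f e| <= M) -> `|\int[nu]_(e in big) f e| <= M * big_mass.
Proof.
move=> bf fM; apply: le_trans (le_normr_Rintegral _ _) _.
- exact: measurable_big_jumps.
- exact: bounded_measurable_integrable.
apply: int_big_le => //; split; last by exists M => e be; rewrite normr_id fM.
by apply: measurableT_comp; [exact: normr_measurable | case: bf].
Qed.

(** A section of the jointly measurable map, whose domain is measurable because the compact set
    [ctrl P] is closed. *)
Lemma measurable_jump a x l : ctrl P a ->
  measurable_fun [set e : borel_rV R n | e != 0] (fun e => jump P a x e 0 l).
Proof.
move=> ca.
pose f (e : borel_rV R n) : borel_rV R q * borel_rV R d * borel_rV R n := (a, x, e).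
apply: (measurable_comp (F := [set z : borel_rV R q * borel_rV R d * borel_rV R n |
       ctrl P z.1.1 /\ z.2 != 0]) (g := f) _ _ (sa_jump_meas hP l)).
- rewrite (_ : mkset _ = (ctrl P `*` setT) `*` [set e | e != 0]).
    apply: measurableX; last exact: measurable_nonzero.
    apply: measurableX => //; rewrite -[ctrl P]setCK; apply: measurableC.
    apply: open_borel; rewrite openC; apply: compact_closed; last exact: sa_ctrl hP.
    exact: norm_hausdorff.
  by apply/seteqP; split=> [[[? ?] ?] /= []|[[? ?] ?] /= [[]]].
- by move=> _ [e e0 <-].
- by apply: measurable_funTS; exact: measurable_fun_pair.
Qed.

Lemma measurable_jweight x :
  measurable_fun [set e : borel_rV R n | e != 0] (jweight P x).
Proof.
pose f (e : borel_rV R n) : borel_rV R d * borel_rV R n := (x, e).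
apply: (measurable_comp (F := [set z : borel_rV R d * borel_rV R n | z.2 != 0])
  (g := f) _ _ (sa_jweight_meas hP)).
- rewrite (_ : mkset _ = setT `*` [set e | e != 0]).
    by apply: measurableX => //; exact: measurable_nonzero.
  by apply/seteqP; split=> [[? ?] /=|[? ?] /= []].
- by move=> _ [e e0 <-].
- by apply: measurable_funTS; exact: measurable_fun_pair.
Qed.

Lemma jump_le a x e : ctrl P a -> e != 0 -> enorm (jump P a x e) <= C.
Proof.
move=> ca e0; apply: le_trans (sa_jump_bnd hP x ca e0) _.
rewrite -[leRHS]mulr1 ler_wpM2l ?(ltW (sa_C hP))//.
by rewrite ge_min lexx.
Qed.

Lemma jweight_le x e : e != 0 -> `|jweight P x e| <= C.
Proof.
move=> e0; apply: le_trans (sa_jweight_bnd hP x e0) _.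
rewrite -[leRHS]mulr1 ler_wpM2l ?(ltW (sa_C hP))//.
by rewrite ge_min lexx.
Qed.

Lemma bounded_measurable_jump a x l : ctrl P a ->
  bounded_measurable (fun e => jump P a x e 0 l).
Proof.
move=> ca; split; last first.
  exists C => e /big_jumps_neq0 e0.
  exact: le_trans (coord_enorm _ _ _) (jump_le _ ca e0).
apply: measurable_funS (measurable_jump x l ca); first exact: measurable_nonzero.
by move=> e; exact: big_jumps_neq0.
Qed.

Lemma bounded_measurable_jweight x : bounded_measurable (jweight P x).
Proof.
split; last by exists C => e /big_jumps_neq0 e0; exact: jweight_le.
apply: measurable_funS (measurable_jweight x); first exact: measurable_nonzero.
by move=> e; exact: big_jumps_neq0.
Qed.

Lemma bounded_measurable_jump_comp a x (g : 'rV[R]_d -> R) (M : R) : ctrl P a ->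
  continuous g -> (forall y, enorm y <= C -> `|g y| <= M) ->
  bounded_measurable (fun e => g (jump P a x e)).
Proof.
move=> ca cg gM; split.
  apply: (measurable_fun_continuous_comp measurable_big_jumps _ cg) => l.
  by have [] := bounded_measurable_jump x l ca.
by exists M => e /big_jumps_neq0 e0; exact/gM/jump_le.
Qed.

(** Follows from |eta|^2 <= C^2 min(1, |e|)^2 <= C^2 min(1, |e|^2). The bound is uniform in the
    control and in x, and serves to bound the diagonal of [tvol]. *)
Lemma small_jump_variance : exists V : R, forall a x l, ctrl P a ->
  \int[nu]_(e in small) (jump P a x e 0 l ^+ 2) <= V.
Proof.
pose I := (\int[nu]_(e in [set e : borel_rV R n | e != 0%R])
  (Num.min 1 (enorm (e : 'rV[R]_n) ^+ 2))%:E)%E.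
have I0 : (0 <= I)%E by apply: integral_ge0 => e _; rewrite lee_fin levy_weight_ge0.
exists (C ^+ 2 * fine I) => a x l ca.
have Ifin : I \is a fin_num by rewrite ge0_fin_numE// (sa_levy hP).
rewrite /Rintegral -(fineK Ifin) /=.
have mj : measurable_fun [set e : borel_rV R n | e != 0]
   (fun e => (jump P a x e 0 l ^+ 2)%:E).
  by apply/measurable_EFinP; apply: measurable_funX; exact: measurable_jump.
have le : (\int[nu]_(e in small) (jump P a x e 0 l ^+ 2)%:E <= (C ^+ 2 * fine I)%:E)%E.
  apply: le_trans (ge0_subset_integral nu measurable_small_jumps measurable_nonzero
    mj _ _) _.
  - by move=> e _; rewrite lee_fin sqr_ge0.
  - by move=> e [].
  rewrite EFinM fineK// -ge0_integralZl//; first last.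
  - by rewrite lee_fin sqr_ge0.
  - by move=> e _; rewrite lee_fin levy_weight_ge0.
  - exact: measurable_levy_weight.
  - exact: measurable_nonzero.
  apply: ge0_le_integral.
  - exact: measurable_nonzero.
  - by move=> e _; rewrite lee_fin sqr_ge0.
  - exact: mj.
  - by apply: measurable_funeM; exact: measurable_levy_weight.
  - move=> e e0; rewrite -EFinM lee_fin -real_normK ?num_real//.
    apply: (@le_trans _ _ ((C * Num.min 1 (enorm e)) ^+ 2)).
      rewrite lerXn2r ?nnegrE//.
        by rewrite mulr_ge0 ?(ltW (sa_C hP))// le_min ler01 enorm_ge0.
      exact: le_trans (coord_enorm _ _ _) (sa_jump_bnd hP x ca e0).
    rewrite exprMn ler_wpM2l ?sqr_ge0// le_min.
    rewrite exprn_ile1 ?ge_min ?lexx ?le_min ?ler01 ?enorm_ge0//=.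
    by rewrite lerXn2r ?nnegrE ?le_min ?ler01 ?enorm_ge0// ge_min lexx orbT.
rewrite -lee_fin fineK//; rewrite ge0_fin_numE ?(le_lt_trans le) ?ltry//.
by apply: integral_ge0 => e _; rewrite lee_fin sqr_ge0.
Qed.

End Levy.

(** * Taylor expansions, uniform on compact sets *)

Section DirectionalDerivatives.
Variable R : realType.

Lemma is_deriveE (V W : normedModType R) (f : V -> W) (a v : V) (l : W) :
  is_derive a v f l <-> h^-1 *: (f (h *: v + a) - f a) @[h --> 0^'] --> l.
Proof.
split=> [[dv <-]|fl]; first exact: dv.
by split; [apply: cvgP fl | exact: cvg_lim fl].
Qed.

Lemma is_derive_line (V : normedModType R) (f : V -> R) (y v : V) (s l : R) :
  is_derive (y + s *: v) v f l -> is_derive s 1 (fun r => f (y + r *: v)) l.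
Proof.
move=> /is_deriveE fl; apply/is_deriveE; apply: cvg_trans fl.
apply: near_eq_cvg; near=> h.
by rewrite scaler1 scalerDl addrCA [in RHS]/GRing.scale.
Unshelve. all: by end_near. Qed.

(** Stated without an order between [a] and [b], since the coordinates of an increment may have
    either sign. *)
Lemma mean_value (f df : R -> R) (a b : R) :
  (forall s : R, is_derive s 1 f (df s)) ->
  exists c, Num.min a b <= c <= Num.max a b /\ f b - f a = df c * (b - a).
Proof.
move=> fd; have cf : continuous f.
  by move=> s; apply/differentiable_continuous/derivable1_diffP; have [] := fd s.
wlog ab : a b / a <= b.
  move=> H; have [ab|/ltW ba] := leP a b.
    by have [c] := H _ _ ab; rewrite min_l ?max_r// => ?; exists c.
  have [c []] := H _ _ ba; rewrite (min_l ba) (max_r ba) => cI E; exists c.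
  by split=> //; rewrite -opprB E -mulrN opprB.
have [|c] := @MVT_segment R f df a b ab (fun s _ => fd s).
  exact: continuous_subspaceT.
by rewrite in_itv /= => cI E; exists c; rewrite min_l ?max_r.
Qed.

Variable d : nat.
Implicit Types (x y v : 'rV[R]_d).

(** The l^1 norm is the one that adding up the coordinate increments produces. *)
Definition norm1 v : R := \sum_l `|v 0 l|.

Lemma norm1_ge0 v : 0 <= norm1 v. Proof. exact: sumr_ge0. Qed.

Lemma coord_norm1 v l : `|v 0 l| <= norm1 v.
Proof. by rewrite /norm1 (bigD1 l)//= lerDl sumr_ge0. Qed.

Lemma norm1Z (s : R) v : norm1 (s *: v) = `|s| * norm1 v.
Proof.
by rewrite /norm1 mulr_sumr; apply: eq_bigr => l _; rewrite mxE normrM.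
Qed.

Lemma rV_scaleE (s : R) v l : (s *: v) 0 l = s * v 0 l.
Proof. exact: mxE. Qed.

Section FirstOrder.
Variables (F : 'rV[R]_d -> R) (G : 'I_d -> 'rV[R]_d -> R).
Hypothesis dF : forall y l, is_derive y (delta_mx 0 l : 'rV[R]_d) F (G l y).

(* The increment is telescoped along the coordinates, so that only partial
   derivatives are used. *)
Lemma taylor1 x v (e : R) :
  (forall y l, (forall m, `|y 0 m - x 0 m| <= `|v 0 m|) -> `|G l y - G l x| <= e) ->
  `|F (x + v) - F x - \sum_l G l x * v 0 l| <= e * norm1 v.
Proof.
move=> Ge.
pose w k : 'rV[R]_d := \row_l (if (l < k)%N then v 0 l else 0).
have w0 : x + w 0 = x by apply/rowP => l; rewrite !mxE addr0.
have wd : x + w d = x + v by apply/rowP => l; rewrite !mxE ltn_ord.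
have -> : F (x + v) - F x = \sum_(l < d) (F (x + w l.+1) - F (x + w l)).
  by rewrite -[in LHS]wd -[in X in _ - F X]w0 -(telescope_sumr (fun k => F (x + w k)))// big_mkord.
rewrite -sumrB; apply: le_trans (ler_norm_sum _ _ _) _.
rewrite /norm1 mulr_sumr; apply: ler_sum => l _.
have wS : x + w l.+1 = (x + w l) + v 0 l *: delta_mx 0 l.
  apply/rowP => m; rewrite !mxE eqxx /= ltnS leq_eqVlt -addrA; congr (_ + _).
  case: (eqVneq m l) => [->|ml] /=; first by rewrite eqxx ltnn mulr1 add0r.
  by rewrite (_ : (m == l :> nat) = false)//= ?mulr0 ?addr0//; apply/negbTE.
have [c [cI]] := @mean_value (fun r => F ((x + w l) + r *: delta_mx 0 l))
  (fun r => G l ((x + w l) + r *: delta_mx 0 l)) 0 (v 0 l)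
  (fun s => is_derive_line (dF _ _)).
rewrite scale0r addr0 -wS subr0 => ->.
rewrite -mulrBl normrM ler_wpM2r//; apply: Ge => m; rewrite !mxE.
(* The intermediate point has moved by [v] in the coordinates before [l], by a part of [v 0 l] in
   coordinate [l], and not at all after it: it stays in the box where [Ge] applies. *)
case: (eqVneq m l) => [->|ml].
  rewrite ltnn !addr0 mulr1 addrAC subrr add0r.
  have [v0|v0] := leP 0 (v 0 l).
    by move: cI; rewrite min_l// max_r// => /andP[c0 cv]; rewrite !ger0_norm.
  have {}v0 := ltW v0; move: cI; rewrite min_r ?max_l// => /andP[c0 cv].
  by rewrite !ler0_norm ?lerN2.
rewrite mulr0 addr0 addrAC subrr add0r.
by case: ifP => _; rewrite ?normr0.
Qed.

Hypothesis cG : forall l, continuous (G l).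

(** Continuous partial derivatives yield derivatives in every direction: [taylor1] at the scale
    [h *: v] has an error that is small relative to [h]. *)
Lemma is_derive_segment x v (s : R) :
  is_derive s 1 (fun r => F (x + r *: v)) (\sum_l G l (x + s *: v) * v 0 l).
Proof.
apply/is_deriveE/cvgrPdist_le => e e0.
set y := x + s *: v.
(* The added 1 keeps the divisor positive when [v] is 0. *)
have e'0 : 0 < e / (norm1 v + 1) by rewrite divr_gt0// ltr_pwDr// norm1_ge0.
have [r r0 Gr] : exists2 r : R, 0 < r & forall z : 'rV[R]_d, (forall m, `|z 0 m - y 0 m| < r) ->
    forall l, `|G l z - G l y| <= e / (norm1 v + 1).
  have : \forall z \near y, forall l, `|G l z - G l y| <= e / (norm1 v + 1).
    apply: (filter_forall (nbhs_filter y)) => l.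
    have /(@cvgrPdist_le _ _ _ _ (nbhs_filter y)) /(_ _ e'0) := cG (l := l) (x := y).
    by apply: filterS => z; rewrite distrC.
  move=> /nbhs_ballP[r /= r0 rP]; exists r => // z zr l; apply: rP; split=> // i m.
  by rewrite (ord1 i) /ball /= distrC.
near=> h.
have h0 : h != 0 by near: h; exact: nbhs_dnbhs_neq.
have -> : x + (h *: 1 + s) *: v = y + h *: v.
  by rewrite /y scaler1 scalerDl addrCA addrC.
have hr : `|h| * norm1 v < r.
  have : `|h| < r / (norm1 v + 1).
    by near: h; apply: dnbhs0_lt; rewrite divr_gt0// ltr_pwDr// norm1_ge0.
  rewrite ltr_pdivlMr ?ltr_pwDr ?norm1_ge0//; apply: le_lt_trans.
  by rewrite ler_wpM2l// lerDl.
have := @taylor1 y (h *: v) (e / (norm1 v + 1)).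
rewrite norm1Z => T1.
have {}T1 : `|F (y + h *: v) - F y - h * \sum_l G l y * v 0 l|
    <= e / (norm1 v + 1) * (`|h| * norm1 v).
  rewrite mulr_sumr; under eq_bigr do rewrite mulrCA -rV_scaleE.
  apply: T1 => z l zy; apply: Gr => m; apply: le_lt_trans (zy m) _.
  by apply: le_lt_trans hr; rewrite -norm1Z coord_norm1.
rewrite -[X in _ <= X]mul1r -(mulVf h0) distrC.
have -> : h^-1 *: (F (y + h *: v) - F y) - \sum_l G l y * v 0 l
  = h^-1 * (F (y + h *: v) - F y - h * \sum_l G l y * v 0 l).
  by rewrite [_ *: _]/GRing.scale /= !mulrBr mulKf.
rewrite normrM normfV.
have nh : 0 < `|h| by rewrite normr_gt0.
rewrite mulrC ler_pdivrMr//; apply: le_trans T1 _.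
rewrite mulVf// mul1r mulrCA mulrC ler_wpM2r//.
by rewrite -mulrA ler_piMr ?(ltW e0)// ler_pdivrMl ?mulr1 ?ltr_pwDr ?norm1_ge0// lerDl.
Unshelve. all: by end_near. Qed.

End FirstOrder.

(** The mean value theorem is applied to the remainder [r] along the segment. Its derivative at [c]
    pairs [v] with the first order remainders of the partial derivatives at displacement [c *: v],
    to which [taylor1] applies once more. *)
Lemma taylor2 (F : 'rV[R]_d -> R) (G : 'I_d -> 'rV[R]_d -> R)
    (H : 'I_d -> 'I_d -> 'rV[R]_d -> R) x v (e : R) :
  (forall y l, is_derive y (delta_mx 0 l : 'rV[R]_d) F (G l y)) ->
  (forall y l m, is_derive y (delta_mx 0 l : 'rV[R]_d) (G m) (H l m y)) ->
  (forall l, continuous (G l)) -> 0 <= e ->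
  (forall y l m, (forall k, `|y 0 k - x 0 k| <= `|v 0 k|) ->
     `|H l m y - H l m x| <= e) ->
  `|F (x + v) - F x - \sum_l G l x * v 0 l
     - 2^-1 * \sum_m (\sum_l H l m x * v 0 l) * v 0 m| <= e * norm1 v ^+ 2.
Proof.
move=> dF dG cG e0 He.
set g1 := \sum_l G l x * v 0 l; set q := \sum_m _ * v 0 m.
pose r s := F (x + s *: v) - s * g1 - 2^-1 * s ^+ 2 * q.
pose dr s := \sum_l G l (x + s *: v) * v 0 l - g1 - s * q.
have rd (s : R) : is_derive s 1 r (dr s).
  have d1 := is_derive_segment dF cG x v s.
  have d2 : is_derive s 1 (fun r : R => r * g1) g1.
    by apply: is_derive_eq; rewrite scaler0 add0r [_%:A]mulr1.
  have d3 : is_derive s 1 (fun r : R => 2^-1 * r ^+ 2 * q) (s * q).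
    apply: is_derive_eq; rewrite scaler0 add0r.
    have -> : s%:A = s by exact: mulr1.
    by rewrite [_ *: _]/GRing.scale /= [_ *: _]/GRing.scale /=; field.
  exact: (is_deriveB (is_deriveB d1 d2) d3).
have [c [+ E]] := mean_value 0 1 rd.
rewrite min_l ?ler01// max_r ?ler01// => /andP[c0 c1].
have -> : F (x + v) - F x - g1 - 2^-1 * q = dr c.
  move: E; rewrite /r subr0 mulr1 => <-.
  by rewrite scale0r scale1r addr0; field.
have -> : dr c = \sum_m v 0 m * (G m (x + c *: v) - G m x
    - \sum_l H l m x * (c *: v) 0 l).
  rewrite /dr /g1 /q mulr_sumr -!sumrB; apply: eq_bigr => m _.
  have -> : \sum_l H l m x * (c *: v) 0 l = c * \sum_l H l m x * v 0 l.
    by rewrite mulr_sumr; apply: eq_bigr => l _; rewrite mxE mulrCA.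
  ring.
apply: le_trans (ler_norm_sum _ _ _) _.
rewrite expr2 mulrCA mulr_suml; apply: ler_sum => m _.
rewrite normrM ler_wpM2l//.
have cv k : `|(c *: v) 0 k| <= `|v 0 k|.
  by rewrite mxE normrM ger0_norm// ler_piMl.
apply: le_trans (taylor1 (e := e) (fun y l => dG y l m) _) _.
  by move=> y l yx; apply: He => k; apply: le_trans (yx k) (cv k).
by rewrite ler_wpM2l//; apply: ler_sum => l _.
Qed.

End DirectionalDerivatives.

Section Cylinder.
Variables (R : realType) (d n q : nat) (P : problem R d n q).
Implicit Types (x y v : 'rV[R]_d) (rad : R).

Definition cyl rad : set (R * 'rV[R]_d) :=
  `[0, horizon P] `*` [set x : 'rV[R]_d | forall l, x 0 l \in `[- rad, rad]].

Lemma cylP rad t x : cyl rad (t, x) <->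
  0 <= t <= horizon P /\ forall l, `|x 0 l| <= rad.
Proof.
split=> -[/= tT xr]; split.
- by move: tT; rewrite in_itv.
- by move=> l; have := xr l; rewrite in_itv /= ler_norml.
- by rewrite /= in_itv.
- by move=> l; rewrite in_itv /= -ler_norml.
Qed.

Lemma compact_cyl rad : compact (cyl rad).
Proof.
apply: compact_setX; first exact: segment_compact.
by apply: (@rV_compact _ _ (fun=> `[- rad, rad]%classic)) => _; exact: segment_compact.
Qed.

Section Uniform.
Variables (V : normedModType R) (f : R -> 'rV[R]_d -> V).
Hypothesis cf : {within closed_cylinder P, continuous (fun z => f z.1 z.2)}.

Lemma cyl_cont (z : R * 'rV[R]_d) : 0 <= z.1 <= horizon P -> forall e : R, 0 < e ->
  exists2 r : R, 0 < r & forall w, ball z r w -> 0 <= w.1 <= horizon P ->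
    `|f z.1 z.2 - f w.1 w.2| < e.
Proof.
move=> zT e e0; have /subspace_continuousP/(_ z zT) H := cf.
have WF : Filter (within (closed_cylinder P) (nbhs z)) := within_filter _ (nbhs_filter z).
move/cvgrPdist_lt : H => /(_ e e0) /nbhs_ballP[r /= r0 rP].
by exists r => // w zw wT; exact: rP.
Qed.

Lemma cylinder_continuous t : 0 <= t <= horizon P -> continuous (f t).
Proof.
move=> tT x; apply/(@cvgrPdist_lt _ _ _ _ (nbhs_filter x)) => e e0.
have [r r0 rP] := @cyl_cont (t, x) tT e e0.
apply/nbhs_ballP; exists r => // y xy; apply: (rP (t, y)) => //.
by split => //=; exact: ballxx.
Qed.

(** A Heine-Cantor theorem in which only the first point has to lie in the compact box: the second
    may leave it, as shifted points and grid nodes do in the applications. *)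
Lemma cylinder_unif rad (e : R) : 0 < e -> exists2 r : R, 0 < r &
  forall t s x y, 0 <= t <= horizon P -> 0 <= s <= horizon P ->
    (forall l, `|x 0 l| <= rad) -> `|t - s| < r ->
    (forall l, `|x 0 l - y 0 l| < r) -> `|f t x - f s y| < e.
Proof.
move=> e0.
have /compact_near_coveringP cK := @compact_cyl rad.
pose Pr (r : R) (z : R * 'rV[R]_d) := 0 <= z.1 <= horizon P ->
  forall w, 0 <= w.1 <= horizon P -> ball z r w -> `|f z.1 z.2 - f w.1 w.2| < e.
have : \forall r \near 0^'+, cyl rad `<=` Pr r.
  apply: cK => -[t x] /cylP [tT xr].
  have e2 : 0 < e / 2 by rewrite divr_gt0.
  have [r r0 rP] := @cyl_cont (t, x) tT _ e2.
  have r2 : 0 < r / 2 by rewrite divr_gt0.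
  (* Both radii are halved so that a point near [z] is still within [r] of the centre, where the
     bound [e / 2] holds. *)
  exists (ball (t, x) (r / 2), [set s | s < r / 2]).
    split; first by exact: nbhsx_ballx.
    by apply: nbhs_right_lt.
  move=> [z s] [/= bz sr] zT w wT zw.
  rewrite (splitr e) -[f z.1 z.2](subrK (f t x)) -addrA.
  apply: le_lt_trans (ler_normD _ _) _; apply: ltrD.
    rewrite distrC; apply: rP => //; apply: le_ball bz.
    by rewrite ler_piMr ?(ltW r0)// invf_le1// ler1n.
  apply: rP => //; rewrite (splitr r); apply: ball_triangle bz _.
  by apply: le_ball zw; exact: ltW.
move=> H; near (0 : R)^'+ => r; exists r; first by near: r; exact: nbhs_right_gt.
move=> t s x y tT sT xr ts xy.
have Hr : cyl rad `<=` Pr r by near: r.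
apply: (Hr (t, x) _ tT (s, y)) => //; first by apply/cylP.
split => //=; split; first by near: r; exact: nbhs_right_gt.
by move=> i l; rewrite (ord1 i); exact: xy.
Unshelve. all: by end_near. Qed.

Lemma cylinder_bounded rad : exists M : R, forall t x, 0 <= t <= horizon P ->
    (forall l, `|x 0 l| <= rad) -> `|f t x| <= M.
Proof.
have /compact_near_coveringP cK := @compact_cyl rad.
pose Pr (M : R) (z : R * 'rV[R]_d) := 0 <= z.1 <= horizon P -> `|f z.1 z.2| <= M.
have : \forall M \near +oo, cyl rad `<=` Pr M.
  apply: cK => -[t x] /cylP [tT xr].
  have [r r0 rP] := @cyl_cont (t, x) tT 1 ltr01.
  exists (ball (t, x) r, [set M | `|f t x| + 1 <= M]).
    split; first by exact: nbhsx_ballx.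
    by apply: nbhs_pinfty_ge; exact: num_real.
  move=> [z M] [/= bz M1] zT; apply: le_trans M1.
  rewrite -[f z.1 z.2](subrK (f t x)) addrC.
  apply: le_trans (ler_normD _ _) _; rewrite lerD2l distrC ltW//.
  exact: rP.
move=> H; near (pinfty_nbhs R) => M; exists M => t x tT xr.
have Hr : cyl rad `<=` Pr M by near: M.
by apply: (Hr (t, x)) => //; apply/cylP.
Unshelve. all: by end_near. Qed.

End Uniform.

Lemma mx_coord_norm m k (A : 'M[R]_(m, k)) i j : `|A i j| <= `|A|.
Proof.
rewrite [leRHS]/Num.norm /= mx_normrE.
exact: (le_bigmax _ (fun ij : 'I_m * 'I_k => `|A ij.1 ij.2|) (i, j)).
Qed.

Section Taylor.
Variables (phi dtphi : R -> 'rV[R]_d -> R) (Dphi : R -> 'rV[R]_d -> 'rV[R]_d)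
  (D2phi : R -> 'rV[R]_d -> 'M[R]_d).
Hypothesis hphi : C12 P phi dtphi Dphi D2phi.

Lemma continuous_partial t l : 0 <= t <= horizon P ->
  continuous (fun x => Dphi t x 0 l).
Proof.
move=> tT x.
apply: (@continuous_comp _ _ _ (Dphi t) (fun y : 'rV[R]_d => y 0 l)).
  exact: (cylinder_continuous (C12_contD hphi) tT).
exact: coord_continuous.
Qed.

Lemma taylor1_unif rad (e : R) : 0 < e -> exists2 r : R, 0 < r &
  forall t x v, 0 <= t <= horizon P -> (forall l, `|x 0 l| <= rad) ->
    norm1 v < r ->
    `|phi t (x + v) - phi t x - dotv v (Dphi t x)| <= e * norm1 v.
Proof.
move=> e0; have [r r0 rP] := cylinder_unif (C12_contD hphi) rad e0.
exists r => // t x v tT xr vr.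
rewrite /dotv; under eq_bigr do rewrite mulrC.
apply: (@taylor1 _ _ (phi t) (fun l y => Dphi t y 0 l)) => [y l|y l yx]; first exact: (C12_D hphi).
rewrite distrC; apply: le_trans (ltW (rP t t x y tT tT xr _ _)).
- by apply: le_trans (mx_coord_norm _ 0 l); rewrite !mxE.
- by rewrite subrr normr0.
- move=> k; rewrite distrC; apply: le_lt_trans (yx k) _.
  by apply: le_lt_trans vr; exact: coord_norm1.
Qed.

Lemma taylor2_unif rad (e : R) : 0 < e -> exists2 r : R, 0 < r &
  forall t x v, 0 <= t <= horizon P -> (forall l, `|x 0 l| <= rad) ->
    norm1 v < r ->
    `|phi t (x + v) - phi t x - dotv v (Dphi t x)
      - 2^-1 * \sum_m (\sum_l D2phi t x l m * v 0 l) * v 0 m| <= e * norm1 v ^+ 2.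
Proof.
move=> e0; have [r r0 rP] := cylinder_unif (C12_contD2 hphi) rad e0.
exists r => // t x v tT xr vr.
rewrite /dotv; under eq_bigr do rewrite mulrC.
apply: (@taylor2 _ _ (phi t) (fun l y => Dphi t y 0 l) (fun l m y => D2phi t y l m)).
- by move=> y l; exact: (C12_D hphi).
- by move=> y l m; exact: (C12_D2 hphi).
- by move=> l; exact: continuous_partial.
- exact: ltW.
move=> y l m yx; rewrite distrC; apply: le_trans (ltW (rP t t x y tT tT xr _ _)).
- by apply: le_trans (mx_coord_norm _ l m); rewrite !mxE.
- by rewrite subrr normr0.
- move=> k; rewrite distrC; apply: le_lt_trans (yx k) _.
  by apply: le_lt_trans vr; exact: coord_norm1.
Qed.

(** The mean value theorem in time. Inside ]s, t[ the limit relative to [0, T] is a two-sided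
    derivative; at the endpoints, which may be 0 or T, continuity is enough. The modulus is that of
    the time derivative. *)
Lemma time_quotient_unif rad (e : R) : 0 < e -> exists2 r : R, 0 < r &
  forall t s x, 0 <= s <= horizon P -> 0 <= t <= horizon P ->
    (forall l, `|x 0 l| <= rad) -> s < t < s + r ->
    `|(phi t x - phi s x) / (t - s) - dtphi t x| <= e.
Proof.
move=> e0; have [r r0 rP] := cylinder_unif (C12_contt hphi) rad e0.
exists r => // t s x /andP[s0 sT] /andP[t0 tT] xr /andP[st tr].
have dphi u : u \in `]s, t[ -> is_derive u (1 : R) (phi^~ x) (dtphi u x).
  rewrite in_itv /= => /andP[su ut].
  have uT : 0 <= u <= horizon P by rewrite (le_trans s0 (ltW su)) (le_trans (ltW ut) tT).
  apply/is_deriveE/cvgrPdist_le => e' e'0.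
  move/cvgrPdist_le : (C12_dt hphi (x := x) uT) => /(_ e' e'0).
  move=> /nbhs_ballP[r' /= r'0 r'P].
  near=> h.
  have h0 : h != 0 by near: h; exact: nbhs_dnbhs_neq.
  have hr : `|h| < r' by near: h; exact: dnbhs0_lt.
  have hu : `|h| < u - s by near: h; apply: dnbhs0_lt; rewrite subr_gt0.
  have ht : `|h| < t - u by near: h; apply: dnbhs0_lt; rewrite subr_gt0.
  move: hu ht; rewrite !ltr_norml => /andP[hu _] /andP[_ ht].
  have := r'P (h + u); rewrite [_ *: _]/GRing.scale /= mulrC addrK.
  rewrite [h *: 1]/GRing.scale /= mulr1; apply.
  - by rewrite /ball /= opprD addrCA subrr addr0 normrN.
  - by apply: contra h0 => /eqP E; apply/eqP; lra.
  - by rewrite in_itv /=; apply/andP; split; lra.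
have [|c] := MVT_segment (ltW st) dphi.
  apply/subspace_continuousP => u; rewrite /= in_itv /= => /andP[su ut].
  have uT : 0 <= u <= horizon P by rewrite (le_trans s0 su) (le_trans ut tT).
  have WF : Filter (within `[s, t] (nbhs u)) := within_filter _ (nbhs_filter u).
  apply/cvgrPdist_lt => e' e'0.
  have [r' r'0 r'P] := cyl_cont (C12_cont hphi) (z := (u, x)) uT e'0.
  apply/nbhs_ballP; exists r' => // w uw; rewrite /= in_itv /= => /andP[sw wt].
  apply: (r'P (w, x)); first by split => //=; exact: ballxx.
  by rewrite /= (le_trans s0 sw) (le_trans wt tT).
rewrite in_itv /= => /andP[sc ct] ->.
rewrite mulfK ?subr_eq0 ?gt_eqF// ltW// distrC; apply: rP => //.
- by rewrite t0.
- by rewrite (le_trans s0 sc) (le_trans ct tT).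
- by rewrite ger0_norm ?subr_ge0//; lra.
- by move=> l; rewrite subrr normr0.
Unshelve. all: by end_near. Qed.

End Taylor.
End Cylinder.

(** * The discrete operators as averages *)

(** The Lipschitz bound on tents is in terms of [enorm], which is not the norm that carries the
    topology; continuity of [N] with value 0 at 0 bridges the two. *)
Lemma continuous_of_modulus (R : realType) (V : normedModType R) (N f : V -> R)
    (K : R) : continuous N -> N 0 = 0 ->
  (forall x y, `|f x - f y| <= K * N (x - y)) -> continuous f.
Proof.
move=> cN N0 fN x; apply/cvgrPdist_le => e e0.
have c0 : {for x, continuous (N \o (fun y => x - y))}.
  apply: continuous_comp; last exact: cN.
  by apply: cvgB; [exact: cvg_cst | exact: cvg_id].
have c1 : K * N (x - y) @[y --> x] --> 0.
  by rewrite -(mulr0 K) -N0 -(subrr x); apply: cvgMr; exact: c0.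
near=> y; apply: le_trans (fN x y) _.
near: y; move/cvgrPdist_le : c1 => /(_ e e0); apply: filterS => y.
by rewrite sub0r normrN; apply: le_trans; rewrite ler_norm.
Unshelve. all: by end_near. Qed.

Section Averaging.
Variables (R : realType) (T : choiceType).
Implicit Types (a b : T -> R) (E F : (T -> R) -> R).

(** The total weight is not normalised: it is [E] at the constant 1. Building [E] along with [a]
    gives closed forms for the discrete operators. *)
Definition averaging a E : Prop :=
  [/\ finite_set [set m | a m != 0], forall m, 0 <= a m &
      forall V, \sum_(m \in [set: T]) a m * V m = E V].

Lemma averagingD a b E F : averaging a E -> averaging b F ->
  averaging (fun m => a m + b m) (fun V => E V + F V).
Proof.
move=> [fa a0 aE] [fb b0 bE].
have fab : finite_set ([set m | a m != 0] `|` [set m | b m != 0]).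
  by rewrite finite_setU.
set S := _ `|` _ in fab.
have out V m : m \notin fset_set S -> a m * V m = 0 /\ b m * V m = 0.
  rewrite in_fset_set// notin_setE => /not_orP[/negP + /negP].
  by rewrite !negbK => /eqP -> /eqP ->; rewrite !mul0r.
split=> [|m|V].
- apply: sub_finite_set fab => m /= ab; apply: contrapT => /not_orP[/negP + /negP].
  by rewrite !negbK => /eqP am /eqP bm; rewrite am bm addr0 eqxx in ab.
- by rewrite addr_ge0.
- rewrite -aE -bE !(@fsbigTE _ _ _ _ (fset_set S)).
  + by rewrite -big_split; apply: eq_bigr => m _; rewrite mulrDl.
  + by move=> m /(out V)[].
  + by move=> m /(out V)[].
  + by move=> m /(out V)[am bm]; rewrite mulrDl am bm addr0.
Qed.

Lemma averagingZ (c : R) a E : 0 <= c -> averaging a E ->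
  averaging (fun m => c * a m) (fun V => c * E V).
Proof.
move=> c0 [fa a0 aE]; split=> [|m|V].
- by apply: sub_finite_set fa => m /=; rewrite mulf_eq0 negb_or => /andP[].
- exact: mulr_ge0.
- have [r [_ _ rE]] := fsum_seq fa.
  rewrite -aE (eq_fsbigr (fun m => a m * (c * V m))); last first.
    by move=> m _; rewrite mulrCA mulrA.
  by rewrite !rE mulr_sumr; apply: eq_bigr => m _; rewrite mulrCA.
Qed.

Lemma averaging0 : averaging (fun=> 0) (fun=> 0).
Proof.
split=> // [|V]; first by rewrite (_ : mkset _ = set0) ?eqxx//; apply/seteqP; split=> m //=; rewrite eqxx.
by rewrite fsbig1// => m _; rewrite mul0r.
Qed.

Lemma averaging_sum (I : Type) (r : seq I) (a : I -> T -> R)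
    (E : I -> (T -> R) -> R) :
  (forall i, averaging (a i) (E i)) ->
  averaging (fun m => \sum_(i <- r) a i m) (fun V => \sum_(i <- r) E i V).
Proof.
move=> aE; elim: r => [|i r IH].
  under eq_fun do rewrite big_nil; under [X in averaging _ X]eq_fun do rewrite big_nil.
  exact: averaging0.
under eq_fun do rewrite big_cons; under [X in averaging _ X]eq_fun do rewrite big_cons.
exact: averagingD.
Qed.

Lemma averaging_total a E : averaging a E ->
  \sum_(m \in [set: T]) a m = E (fun=> 1).
Proof.
by move=> [_ _ <-]; apply: eq_fsbigr => m _; rewrite mulr1.
Qed.

Lemma averaging_centered a E V (x : R) : averaging a E ->
  \sum_(m \in [set: T]) a m * (V m - x) = E V - E (fun=> 1) * x.
Proof.
move=> aE; have [fa _ eE] := aE.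
by rewrite fsumB// fsum_cst// (averaging_total aE) eE.
Qed.

End Averaging.

Section Scheme.
Variables (R : realType) (d n q J : nat) (P : problem R d n q) (C C0 : R).
Hypothesis hP : standing_assumption P C C0.
Variable eps : R.
Hypothesis eps0 : 0 < eps.
Variables (al : 'I_J -> 'rV[R]_q) (Q : discretization R d J).
Hypothesis ctrl_al : forall j, ctrl P (al j).
Hypothesis hQ : admissible_discretization Q.
Local Notation nu := (levy P).
Local Notation big := (@big_jumps R n eps).
Local Notation mass := (big_mass P eps).
Implicit Types (V : 'rV[int]_d -> R) (h : R) (j : 'I_J) (i : 'rV[int]_d).

Definition interp h (x0 y : 'rV[R]_d) V : R :=
  \sum_(m \in [set: 'rV[int]_d]) tent Q h x0 m y * V m.

Lemma mesh_gt0 h : mesh Q h -> 0 < h.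
Proof. by case/andP. Qed.

Lemma tentP h x0 : mesh Q h -> exists Cw, tent_basis Cw h x0 (tent Q h x0).
Proof. by move=> mh; have [Cw /(_ h x0 mh)] := ad_tent hQ; exists Cw. Qed.

Lemma averaging_interp h x0 y : mesh Q h ->
  averaging (fun m => tent Q h x0 m y) (interp h x0 y).
Proof.
move=> mh; have [Cw tb] := tentP x0 mh; split=> // [|m].
  exact: tent_supp_finite (mesh_gt0 mh) tb.
by have /andP[] := tb_range tb m y.
Qed.

Lemma interp1 h x0 y : mesh Q h -> interp h x0 y (fun=> 1) = 1.
Proof.
move=> mh; have [Cw tb] := tentP x0 mh.
by rewrite -(averaging_total (averaging_interp x0 y mh)) (tb_sum tb).
Qed.

Lemma interp_bary h x0 (y : 'rV[R]_d) : mesh Q h ->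
  exists (I : finType) (s : I -> 'rV[int]_d) (w : I -> R),
    [/\ forall v, 0 <= w v, \sum_v w v = 1, y = \sum_v w v *: grid h x0 (s v),
        forall v, w v != 0 -> forall l, `|y 0 l - grid h x0 (s v) 0 l| <= 2 * h &
        forall V, interp h x0 y V = \sum_v w v * V (s v)].
Proof.
move=> mh; have [Cw tb] := tentP x0 mh.
have [I [s [w bc]]] := tent_barycentric y (mesh_gt0 mh) tb.
have [w0 w1 yE _] := bc; exists I, s, w; split => //.
  exact: barycentric_supp tb bc.
exact: barycentric_sum (mesh_gt0 mh) tb bc.
Qed.

(** Nodes farther than 2h carry no weight, so a local bound on [V] suffices; this is how uniform
    continuity enters in [jump_consistent]. *)
Lemma interp_le h x0 (y : 'rV[R]_d) V (M : R) : mesh Q h ->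
  (forall m, (forall l, `|y 0 l - grid h x0 m 0 l| <= 2 * h) -> `|V m| <= M) ->
  `|interp h x0 y V| <= M.
Proof.
move=> mh VM; have [I [s [w [w0 w1 _ ws ->]]]] := interp_bary x0 y mh.
apply: le_trans (ler_norm_sum _ _ _) _.
rewrite -[M]mul1r -w1 mulr_suml; apply: ler_sum => v _.
rewrite normrM ger0_norm//; have [->|wv] := eqVneq (w v) 0; first by rewrite !mul0r.
by rewrite ler_wpM2l// VM//; exact: ws.
Qed.

Lemma interpD h x0 (y : 'rV[R]_d) V W : mesh Q h ->
  interp h x0 y (fun m => V m + W m) = interp h x0 y V + interp h x0 y W.
Proof.
move=> mh; have [I [s [w [_ _ _ _ E]]]] := interp_bary x0 y mh.
by rewrite !E -big_split; apply: eq_bigr => v _; rewrite mulrDr.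
Qed.

Lemma interpZ h x0 (y : 'rV[R]_d) (c : R) V : mesh Q h ->
  interp h x0 y (fun m => c * V m) = c * interp h x0 y V.
Proof.
move=> mh; have [I [s [w [_ _ _ _ E]]]] := interp_bary x0 y mh.
by rewrite !E mulr_sumr; apply: eq_bigr => v _; rewrite mulrCA.
Qed.

Definition A_avg h j i V : R :=
  let x := node Q h j i in
  let k := kstep Q h in
  let I y := interp h (origin Q h j) y V in
  2^-1 * (\sum_l (k ^+ 2)^-1 * (I (x + k *: (col l (tvol P eps (al j) x))^T) +
                  I (x - k *: (col l (tvol P eps (al j) x))^T))) +
  (k ^+ 2)^-1 * I (x + k ^+ 2 *: tdrift P eps (al j) x).

Lemma A_averaging h j i : mesh Q h -> averaging (A_coef P eps al Q h j i) (A_avg h j i).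
Proof.
move=> mh; have k2 : 0 <= (kstep Q h ^+ 2)^-1 by rewrite invr_ge0 sqr_ge0.
rewrite /A_coef /A_avg.
under eq_fun do under eq_bigr do rewrite mulrC.
under eq_fun do rewrite [X in _ + X]mulrC.
apply: averagingD; last by apply: averagingZ => //; exact: averaging_interp.
apply: averagingZ; first by rewrite invr_ge0.
apply: averaging_sum => l; apply: averagingZ => //.
by apply: averagingD; exact: averaging_interp.
Qed.

(** Jumps are bounded by C, so the same finitely many nodes serve for all of them, and the sum over
    nodes can be exchanged with the integral. *)
Lemma tent_jump_seq h : mesh Q h -> exists r : seq 'rV[int]_d, uniq r /\
  forall m y, m \notin r -> enorm y <= C -> tent Q h 0 m y = 0.
Proof.
move=> mh; have [Cw tb] := tentP 0 mh.
have fS := finite_grid_box (C + 2 * h) 0 (0 : 'rV[R]_d) (mesh_gt0 mh).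
exists (enum_fset (fset_set [set m | forall l, `|(0 : 'rV[R]_d) 0 l - grid h 0 m 0 l| <= C + 2 * h])).
split; first exact: fset_uniq.
move=> m y mS yC; apply/eqP; apply: contraT => /(tb_supp tb) ym.
have : m \in [set m | forall l, `|(0 : 'rV[R]_d) 0 l - grid h 0 m 0 l| <= C + 2 * h].
  apply/mem_set => l /=.
  have -> : (0 : 'rV[R]_d) 0 l - grid h 0 m 0 l = - y 0 l + (y 0 l - grid h 0 m 0 l).
    by rewrite mxE; ring.
  apply: le_trans (ler_normD _ _) _; rewrite lerD ?normrN//.
  exact: le_trans (coord_enorm _ _ _) yC.
by rewrite -in_fset_set// (negbTE mS).
Qed.

Lemma continuous_tent h x0 m : mesh Q h -> continuous (tent Q h x0 m).
Proof.
move=> mh; have [Cw tb] := tentP x0 mh.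
by apply: (continuous_of_modulus (@continuous_enorm R d) (enorm0 R 1 d) (tb_lip tb m)).
Qed.

Lemma bounded_measurable_tent h j i m : mesh Q h -> bounded_measurable eps
  (fun e => tent Q h 0 m (jump P (al j) (node Q h j i) e)).
Proof.
move=> mh; have [Cw tb] := tentP 0 mh.
apply: (@bounded_measurable_jump_comp _ _ _ _ _ _ _ hP _ eps0 _ _ _ 1) => //.
  exact: continuous_tent.
by move=> y _; have /andP[t0 t1] := tb_range tb m y; rewrite ger0_norm.
Qed.

Section JumpAverage.
Variables (h : R) (j : 'I_J) (i : 'rV[int]_d) (g : borel_rV R n -> R).
Hypotheses (mh : mesh Q h) (bg : bounded_measurable eps g).
Hypothesis g0 : forall e, big e -> 0 <= g e.
Let eta e := jump P (al j) (node Q h j i) e.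

(** Treats both nonlocal operators at once: the weight [g] is 1 for K and [jweight] for B. *)
Definition jump_avg V : R := \int[nu]_(e in big) (interp h 0 (eta e) V * g e).

Lemma interp_jump_seq : exists r : seq 'rV[int]_d,
  [/\ uniq r, forall m, m \notin r -> forall e, big e -> tent Q h 0 m (eta e) = 0 &
   forall V e, big e ->
  interp h 0 (eta e) V = \sum_(m <- r) tent Q h 0 m (eta e) * V m].
Proof.
have [r [ur rout]] := tent_jump_seq mh; exists r.
have out m e : m \notin r -> big e -> tent Q h 0 m (eta e) = 0.
  move=> mr be; apply: rout => //; exact: (jump_le hP _ (ctrl_al j) (big_jumps_neq0 eps0 be)).
split=> // [m mr e|V e be]; first exact: out.
by apply: fsumT_seq => // m mr; rewrite out ?mul0r.
Qed.

Lemma bounded_measurable_interp V :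
  bounded_measurable eps (fun e => interp h 0 (eta e) V * g e).
Proof.
have [r [ur _ rE]] := interp_jump_seq.
have bm : bounded_measurable eps
    (fun e => \sum_(m <- r) tent Q h 0 m (eta e) * V m).
  apply: bounded_measurable_sum => m; apply: bounded_measurableM.
    exact: bounded_measurable_tent.
  exact: bounded_measurable_cst.
have [mf [M fM]] := bounded_measurableM bm bg; split.
  by apply: eq_measurable_fun mf => e /set_mem be; rewrite rE.
by exists M => e be; rewrite rE// fM.
Qed.

Lemma jump_averaging : averaging
  (fun m => \int[nu]_(e in big) (tent Q h 0 m (eta e) * g e)) jump_avg.
Proof.
have [Cw tb] := tentP 0 mh.
have [r [ur rout rE]] := interp_jump_seq.
have out m : m \notin r -> \int[nu]_(e in big) (tent Q h 0 m (eta e) * g e) = 0.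
  move=> mr; rewrite (eq_Rintegral _ (g := fun=> 0)).
    by rewrite Rintegral_cst ?mul0r//; exact: measurable_big_jumps.
  by move=> e /set_mem be; rewrite (rout m mr e be) mul0r.
have bt m : bounded_measurable eps (fun e => tent Q h 0 m (eta e) * g e).
  by apply: bounded_measurableM bg; exact: bounded_measurable_tent.
split=> [|m|V].
- apply: (@sub_finite_set _ _ [set` r]); last exact: finite_seq.
  by move=> m /=; apply: contraNT => /out ->.
- apply: Rintegral_ge0 => e be; rewrite mulr_ge0 ?g0//.
  by have /andP[] := tb_range tb m (eta e).
- rewrite /jump_avg (eq_Rintegral _
    (g := fun e : borel_rV R n => \sum_(m <- r) tent Q h 0 m (eta e) * g e * V m)).
    rewrite (int_big_sum hP eps0); last first.
      by move=> m; apply: bounded_measurableM => //; exact: bounded_measurable_cst.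
    rewrite (fsumT_seq ur); last by move=> m mr; rewrite out ?mul0r.
    by apply: eq_bigr => m _; rewrite (int_bigZr hP eps0)//; exact: bt.
  move=> e /set_mem be; rewrite rE// mulr_suml; apply: eq_bigr => m _.
  by rewrite mulrAC.
Qed.

Lemma jump_avg1 : jump_avg (fun=> 1) = \int[nu]_(e in big) g e.
Proof. by apply: eq_Rintegral => e _; rewrite interp1// mul1r. Qed.

End JumpAverage.

Lemma K_averaging h j i : mesh Q h ->
  averaging (K_coef P eps al Q h j i) (jump_avg h j i (fun=> 1)).
Proof.
move=> mh; have := jump_averaging j i mh (bounded_measurable_cst n eps 1) (fun _ _ => ler01).
by under eq_fun do under eq_Rintegral do rewrite mulr1.
Qed.

Lemma B_averaging h j i : mesh Q h ->
  averaging (B_coef P eps al Q h j i) (jump_avg h j i (jweight P (node Q h j i))).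
Proof.
move=> mh; apply: jump_averaging => //; first exact: (bounded_measurable_jweight hP eps0).
by move=> e be; apply: (sa_jweight_ge0 hP); exact: (big_jumps_neq0 eps0).
Qed.

Lemma A_disc_avg h j U i : mesh Q h ->
  A_disc P eps al Q h j U i = A_avg h j i U - A_avg h j i (fun=> 1) * U i.
Proof. by move=> mh; exact: averaging_centered (A_averaging j i mh). Qed.

Lemma K_disc_avg h j U i : mesh Q h ->
  K_disc P eps al Q h j U i =
  jump_avg h j i (fun=> 1) (fun m => U (i + m)) - jump_avg h j i (fun=> 1) (fun=> 1) * U i.
Proof. by move=> mh; exact: (averaging_centered _ _ (K_averaging j i mh)). Qed.

Lemma B_disc_avg h j U i : mesh Q h ->
  B_disc P eps al Q h j U i =
  jump_avg h j i (jweight P (node Q h j i)) (fun m => U (i + m)) -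
  jump_avg h j i (jweight P (node Q h j i)) (fun=> 1) * U i.
Proof. by move=> mh; exact: (averaging_centered _ _ (B_averaging j i mh)). Qed.

(** The 2d diffusion points weigh 1/(2k^2) each and the drift point 1/k^2. *)
Lemma A_avg1 h j i : mesh Q h ->
  A_avg h j i (fun=> 1) = (d%:R + 1) / kstep Q h ^+ 2.
Proof.
move=> mh; rewrite /A_avg; under eq_bigr do rewrite !interp1//.
rewrite interp1// sumr_const card_ord -mulr_natl.
by set k := (_ ^+ 2)^-1; field.
Qed.

End Scheme.

(** * Monotonicity, well-posedness and stability *)

Section Monotonicity.
Variables (R : realType) (d n q J : nat) (P : problem R d n q) (C C0 : R).
Hypothesis hP : standing_assumption P C C0.
Variable eps : R.
Hypothesis eps0 : 0 < eps.
Variables (al : 'I_J -> 'rV[R]_q) (Q : discretization R d J).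
Hypothesis ctrl_al : forall j, ctrl P (al j).
Hypothesis hQ : admissible_discretization Q.
Variable L : R.
Hypothesis L0 : 0 <= L.
Hypothesis hL : hamiltonian_lipschitz P eps L.
Hypothesis htheta : forall h, mesh Q h -> L * lambda Q h < theta Q.
Local Notation nu := (levy P).
Local Notation big := (@big_jumps R n eps).
Local Notation mass := (big_mass P eps).
Local Notation S := (S_op P eps al Q).
Implicit Types (h : R) (j : 'I_J) (i : 'rV[int]_d) (U V W : 'rV[int]_d -> R).

Let C_gt0 : 0 < C := sa_C hP.

Lemma dt_gt0 h : mesh Q h -> 0 < dt Q h.
Proof. exact: ad_dt hQ h. Qed.

Lemma level_time h N : mesh Q h -> level P Q h N -> 0 <= time Q h N <= horizon P.
Proof. by move=> /dt_gt0 dt0 ->; rewrite andbT mulr_ge0// ltW. Qed.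

Lemma levelS h N : mesh Q h -> level P Q h N.+1 -> level P Q h N.
Proof.
move=> mh; apply: le_trans; rewrite /time ler_wpM2r ?ler_nat//.
exact/ltW/dt_gt0.
Qed.

Lemma hamiltonian_upper j t x (u v k k' : R) p :
  0 <= t <= horizon P ->
  `|hamiltonian P eps (al j) t x u p k - hamiltonian P eps (al j) t x v p k'|
     <= C * (`|u - v| + `|k - k'|).
Proof.
move=> tT; rewrite /hamiltonian.
apply: le_trans (sa_driver_lip hP x u v _ _ k k' (ctrl_al j) (ctrl_al j) tT) _.
by rewrite !subrr !enorm0 add0r addr0.
Qed.

Lemma jump_avg_jweight1 h j i : mesh Q h ->
  jump_avg P eps al Q h j i (jweight P (node Q h j i)) (fun=> 1) <= C * mass.
Proof.
move=> mh; rewrite jump_avg1//; apply: (int_big_le hP eps0).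
  exact: (bounded_measurable_jweight hP eps0).
move=> e be; apply: le_trans (ler_norm _) (jweight_le hP _ _).
exact: (big_jumps_neq0 eps0).
Qed.

Lemma jump_avg_one1 h j i : mesh Q h ->
  jump_avg P eps al Q h j i (fun=> 1) (fun=> 1) = mass.
Proof.
move=> mh; rewrite jump_avg1// Rintegral_cst ?mul1r//.
exact: measurable_big_jumps.
Qed.

(** How fast [S] can decrease in the centre value. In order: the weight of A, the weight of K, the
    Lipschitz bound of f through u and through the centre of B, and the centre coefficient of the
    viscosity. *)
Definition S_lip h : R :=
  (d%:R + 1) / kstep Q h ^+ 2 + mass + C * (1 + C * mass)
  + d%:R * (2 * (theta Q / lambda Q h / h)).

Lemma theta_lambda h : mesh Q h -> L <= theta Q / lambda Q h.
Proof.
move=> mh; rewrite ler_pdivlMr; first exact/ltW/htheta.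
by rewrite divr_gt0 ?dt_gt0 ?(mesh_gt0 mh).
Qed.

Lemma S_lip_ge0 h : mesh Q h -> 0 <= S_lip h.
Proof.
move=> mh; have C0' := ltW C_gt0; have m0 := big_mass_ge0 P eps.
have h0 := ltW (mesh_gt0 mh); have tl := le_trans L0 (theta_lambda mh).
have a0 : 0 <= (d%:R + 1) / kstep Q h ^+ 2 by rewrite divr_ge0 ?sqr_ge0.
have b0 : 0 <= C * (1 + C * mass) by rewrite mulr_ge0// addr_ge0// mulr_ge0.
have e0 : 0 <= d%:R * (2 * (theta Q / lambda Q h / h)).
  apply: mulr_ge0 => //; apply: mulr_ge0 => //; exact: divr_ge0.
by rewrite /S_lip !addr_ge0.
Qed.

Lemma S_op_le h N j U W i : mesh Q h -> level P Q h N ->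
  (forall m, U m <= W m) -> S h N j U i <= S h N j W i + S_lip h * (W i - U i).
Proof.
move=> mh lN UW; have tT := level_time mh lN; have h0 := mesh_gt0 mh.
have UWi := UW i; have di : 0 <= W i - U i by rewrite subr_ge0.
rewrite /S_op.
have HA : A_disc P eps al Q h j U i <= A_disc P eps al Q h j W i
    + (d%:R + 1) / kstep Q h ^+ 2 * (W i - U i).
  have [fa a0 _] := A_averaging P eps al hQ j i mh.
  apply: fsum_centered => //.
  by rewrite (averaging_total (A_averaging P eps al hQ j i mh)) A_avg1.
have HK : K_disc P eps al Q h j U i <= K_disc P eps al Q h j W i + mass * (W i - U i).
  have KA := K_averaging hP eps0 ctrl_al hQ j i mh; have [fa a0 _] := KA.
  apply: fsum_centered => //.
  by rewrite (averaging_total KA) jump_avg_one1.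
have HB : B_disc P eps al Q h j U i <= B_disc P eps al Q h j W i + C * mass * (W i - U i).
  have BA := B_averaging hP eps0 ctrl_al hQ j i mh; have [fa a0 _] := BA.
  apply: fsum_centered => //.
  by rewrite (averaging_total BA) jump_avg_jweight1.
rewrite /lax_friedrichs.
move: (A_disc _ _ _ _ _ _ U _) (A_disc _ _ _ _ _ _ W _) HA => AU AW HA.
move: (K_disc _ _ _ _ _ _ U _) (K_disc _ _ _ _ _ _ W _) HK => KU KW HK.
move: (B_disc _ _ _ _ _ _ U _) (B_disc _ _ _ _ _ _ W _) HB => BU BW HB.
set pU := (2 * h)^-1 *: _; set pW := (2 * h)^-1 *: _.
set H := hamiltonian P eps (al j) (time Q h N) (node Q h j i).
pose D l := (W (i + delta_mx 0 l) - U (i + delta_mx 0 l))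
          + (W (i - delta_mx 0 l) - U (i - delta_mx 0 l)).
have D0 l : 0 <= D l by rewrite addr_ge0// subr_ge0.
(* The off-centre part of B is handled by the monotonicity of f in k, without loss; only the centre
   correction is paid for with the Lipschitz constant, in [H2]. *)
have H1 : H (U i) pU BU <= H (U i) pU (BW + C * mass * (W i - U i)).
  exact: (sa_driver_k hP).
have H2 : `|H (U i) pU (BW + C * mass * (W i - U i)) - H (W i) pU BW|
    <= C * ((W i - U i) + C * mass * (W i - U i)).
  apply: le_trans (hamiltonian_upper _ _ _ _ _ _ _ tT) _.
  rewrite ler_pM2l// lerD//; first by rewrite distrC ger0_norm.
  by rewrite addrAC subrr add0r ger0_norm// !mulr_ge0 ?big_mass_ge0 ?(ltW C_gt0).
have H3 : `|H (W i) pU BW - H (W i) pW BW| <= L * ((2 * h)^-1 * \sum_l D l).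
  apply: le_trans (hL _ _ _ _ _ (ctrl_al j) tT) _.
  rewrite ler_wpM2l//; apply: le_trans (enorm_le_sum _) _.
  rewrite mulr_sumr; apply: ler_sum => l _; rewrite /pU /pW !mxE -mulrBr normrM.
  rewrite gtr0_norm ?invr_gt0 ?mulr_gt0// ler_pM2l ?invr_gt0 ?mulr_gt0//.
  rewrite (_ : _ - _ = (W (i - delta_mx 0 l) - U (i - delta_mx 0 l))
     - (W (i + delta_mx 0 l) - U (i + delta_mx 0 l))); last by rewrite /fwd /bwd; ring.
  apply: le_trans (ler_normB _ _) _.
  by rewrite !ger0_norm ?subr_ge0// addrC.
set th := theta Q / lambda Q h.
have H4 : \sum_l th * ((fwd U i l - bwd U i l) / h) =
    \sum_l th * ((fwd W i l - bwd W i l) / h) - th / h * \sum_l D l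
    + d%:R * (2 * (th / h)) * (W i - U i).
  have -> : d%:R * (2 * (th / h)) * (W i - U i) = \sum_(l < d) (2 * (th / h)) * (W i - U i).
    by rewrite sumr_const card_ord -[RHS]mulr_natl !mulrA.
  rewrite mulr_sumr -sumrB -big_split /=; apply: eq_bigr => l _.
  by rewrite /fwd /bwd /D; ring.
rewrite H4.
(* The centred difference sees the neighbours' increments with opposite signs, the viscosity sees
   both with a plus sign: as L <= theta / lambda, the viscosity pays for the gradient. *)
have H5 : L * ((2 * h)^-1 * \sum_l D l) <= th / h * \sum_l D l.
  have sD : 0 <= \sum_l D l by apply: sumr_ge0.
  rewrite mulrA ler_wpM2r//.
  apply: ler_pM => //; first by rewrite invr_ge0 mulr_ge0// ltW.
    exact: theta_lambda.
  by rewrite lef_pV2 ?posrE ?mulr_gt0// ler_pMl// ler1n.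
rewrite /S_lip -/th !mulrDl.
move: (ler_norm (H (U i) pU (BW + C * mass * (W i - U i)) - H (W i) pU BW)) => H2'.
move: (ler_norm (H (W i) pU BW - H (W i) pW BW)) => H3'.
have E : C * ((W i - U i) + C * mass * (W i - U i)) = C * (1 + C * mass) * (W i - U i).
  by ring.
rewrite E in H2.
lra.
Qed.

Lemma discs_shift h j U (x : R) i :
  [/\ A_disc P eps al Q h j (fun m => U m + x) i = A_disc P eps al Q h j U i,
      K_disc P eps al Q h j (fun m => U m + x) i = K_disc P eps al Q h j U i &
      B_disc P eps al Q h j (fun m => U m + x) i = B_disc P eps al Q h j U i].
Proof.
by split; apply: eq_fsbigr => m _; congr (_ * _); ring.
Qed.

(** All terms but one are built on differences of [U], which a constant leaves unchanged; only the
    argument u of the Hamiltonian moves. *)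
Lemma S_op_shift_eq h N j U (x : R) i :
  S h N j (fun m => U m + x) i - S h N j U i =
  hamiltonian P eps (al j) (time Q h N) (node Q h j i) (U i + x)
    ((2 * h)^-1 *: \row_l (fwd U i l + bwd U i l)) (B_disc P eps al Q h j U i)
  - hamiltonian P eps (al j) (time Q h N) (node Q h j i) (U i)
    ((2 * h)^-1 *: \row_l (fwd U i l + bwd U i l)) (B_disc P eps al Q h j U i).
Proof.
rewrite /S_op; have [-> -> ->] := discs_shift h j U x i.
rewrite /lax_friedrichs.
have fE l : fwd (fun m => U m + x) i l = fwd U i l by rewrite /fwd; ring.
have bE l : bwd (fun m => U m + x) i l = bwd U i l by rewrite /bwd; ring.
have -> : \row_l (fwd (fun m => U m + x) i l + bwd (fun m => U m + x) i l)
   = \row_l (fwd U i l + bwd U i l) by apply/rowP => l; rewrite !mxE fE bE.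
under eq_bigr do rewrite fE bE.
by ring.
Qed.

Lemma S_op_shift h N j U (x : R) i : mesh Q h -> level P Q h N -> 0 <= x ->
  S h N j (fun m => U m + x) i <= S h N j U i - C0 * x.
Proof.
move=> mh lN x0.
have := sa_driver_u hP (node Q h j i) (u := U i + x) (v := U i)
  (((2 * h)^-1 *: \row_l (fwd U i l + bwd U i l)) *m tvol P eps (al j) (node Q h j i))
  (B_disc P eps al Q h j U i) (ctrl_al j) (level_time mh lN).
rewrite lerDl => /(_ x0); rewrite addrAC subrr add0r => H.
have := S_op_shift_eq h N j U x i; rewrite /hamiltonian; lra.
Qed.

Lemma S_op_shift_norm h N j U (x : R) i : mesh Q h -> level P Q h N ->
  `|S h N j (fun m => U m + x) i - S h N j U i| <= C * `|x|.
Proof.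
move=> mh lN; rewrite S_op_shift_eq.
apply: le_trans (hamiltonian_upper _ _ _ _ _ _ _ (level_time mh lN)) _.
by rewrite addrAC subrr add0r subrr normr0 addr0.
Qed.

Lemma S_op_cst h N j (x : R) i :
  S h N j (fun=> x) i = driver P (al j) (time Q h N) (node Q h j i) x 0 0.
Proof.
have E0 (a : 'rV[int]_d -> R) : \sum_(m \in [set: 'rV[int]_d]) a m * (x - x) = 0.
  by apply: fsbig1 => m _; rewrite subrr mulr0.
rewrite /S_op /A_disc /K_disc /B_disc !E0 !add0r /lax_friedrichs /fwd /bwd.
rewrite big1 ?addr0; last by move=> l _; rewrite !subrr mul0r mulr0.
rewrite /hamiltonian (_ : \row_l _ = 0) ?scaler0 ?mul0mx//.
by apply/rowP => l; rewrite !mxE subrr addr0.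
Qed.

(** At the constant M only f(M, 0, 0) <= C - C0 M is left, which is at most 0 as soon as M >= C/C0;
    symmetrically at -M. *)
Lemma S_op_barrier h N j (M : R) i : mesh Q h -> level P Q h N -> C / C0 <= M ->
  S h N j (fun=> M) i <= 0 /\ 0 <= S h N j (fun=> - M) i.
Proof.
move=> mh lN CM; have tT := level_time mh lN; have c0 := sa_C0 hP.
have M0 : 0 <= M by apply: le_trans CM; rewrite divr_ge0 ?ltW.
have CM' : C <= C0 * M by rewrite mulrC -ler_pdivrMr.
have b := sa_driver_bnd hP (node Q h j i) (ctrl_al j) tT.
rewrite !S_op_cst.
have := sa_driver_u hP (node Q h j i) (u := M) (v := 0) 0 0 (ctrl_al j) tT M0.
have := sa_driver_u hP (node Q h j i) (u := 0) (v := - M) 0 0 (ctrl_al j) tT.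
rewrite oppr_le0 => /(_ M0); move: b; rewrite ler_norml => /andP[b1 b2].
rewrite subr0 sub0r opprK => H1 H2; split; lra.
Qed.

(** * Solution of one implicit time step *)

Section Step.
Variables (h : R) (N : nat) (j : 'I_J) (v : 'rV[int]_d -> R).
Hypotheses (mh : mesh Q h) (lN : level P Q h N).

(* The damping [rho] makes [relax] nondecreasing. *)
Definition rho : R := (1 + dt Q h * S_lip h)^-1.

Definition relax U i : R := U i - rho * (U i - dt Q h * S h N j U i - v i).

Let rho_gt0 : 0 < rho.
Proof.
by rewrite invr_gt0 ltr_pwDl// mulr_ge0 ?S_lip_ge0// ltW ?dt_gt0.
Qed.

Let rho_le1 : rho <= 1.
Proof.
by rewrite invf_le1 ?lerDl ?ltr_pwDl ?mulr_ge0 ?S_lip_ge0// ltW ?dt_gt0.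
Qed.

(** The damped terms lose at most rho (1 + dt S_lip) (W i - U i), which by the choice of [rho] is
    exactly the gain [W i - U i] of the identity. *)
Lemma relax_le U W : (forall m, U m <= W m) -> forall i, relax U i <= relax W i.
Proof.
move=> UW i; have := S_op_le j i mh lN UW; have dt0 := dt_gt0 mh.
have := UW i; rewrite -subr_ge0 /relax => di SU.
have E : rho * (1 + dt Q h * S_lip h) = 1.
  by rewrite mulVf// gt_eqF// ltr_pwDl// mulr_ge0 ?S_lip_ge0// ltW.
have : rho * dt Q h * S h N j U i <=
       rho * dt Q h * (S h N j W i + S_lip h * (W i - U i)).
  by rewrite ler_wpM2l// mulr_ge0// ltW.
have : (W i - U i) = rho * (1 + dt Q h * S_lip h) * (W i - U i) by rewrite E mul1r.
set s := S_lip h; set SU' := S h N j U i; set SW := S h N j W i.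
set r := rho; set k := dt Q h; nra.
Qed.

(** The factor [1 - rho] comes from the undamped and damped copies of [U i]; the decrease of [S]
    under the shift has the favourable sign. *)
Lemma relax_shift U (x : R) i : 0 <= x ->
  relax (fun m => U m + x) i <= relax U i + (1 - rho) * x.
Proof.
move=> x0; have dt0 := dt_gt0 mh; rewrite /relax.
have : rho * dt Q h * S h N j (fun m => U m + x) i <=
       rho * dt Q h * (S h N j U i - C0 * x).
  by rewrite ler_wpM2l ?S_op_shift// mulr_ge0// ltW.
have : 0 <= rho * dt Q h * (C0 * x).
  by rewrite !mulr_ge0// ltW// (sa_C0 hP).
set SU' := S h N j U i; set SW := S h N j _ i.
set r := rho; set k := dt Q h; nra.
Qed.

Lemma relax_fix U i : relax U i = U i <-> U i - dt Q h * S h N j U i - v i = 0.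
Proof.
rewrite /relax; split=> [E|->]; last by rewrite mulr0 subr0.
have /eqP : rho * (U i - dt Q h * S h N j U i - v i) = 0 by lra.
by rewrite mulf_eq0 gt_eqF//= => /eqP.
Qed.

(** Monotonicity turns V <= V' + x into V <= V' + (1 - rho) x for two fixed points. Boundedness
    supplies the start x = 2K, and iteration sends the gap to 0. *)
Lemma step_unique U W (K : R) :
  (forall i, relax U i = U i) -> (forall i, relax W i = W i) ->
  (forall i, `|U i| <= K) -> (forall i, `|W i| <= K) -> forall i, U i = W i.
Proof.
move=> fU fW UK WK.
have contr (x : R) V V' : 0 <= x -> (forall i, relax V i = V i) ->
   (forall i, relax V' i = V' i) -> (forall i, V i <= V' i + x) ->
   forall i, V i <= V' i + (1 - rho) * x.
  move=> x0 fV fV' VV' i; rewrite -(fV i).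
  by apply: le_trans (relax_le VV' i) _; rewrite -[in leRHS](fV' i) relax_shift.
have K0 : 0 <= K by apply: le_trans (UK 0).
have r1 : 0 <= 1 - rho by rewrite subr_ge0.
have pow m V V' : (forall i, relax V i = V i) -> (forall i, relax V' i = V' i) ->
   (forall i, `|V i| <= K) -> (forall i, `|V' i| <= K) ->
   forall i, V i <= V' i + (1 - rho) ^+ m * (2 * K).
  move=> fV fV' VK V'K; elim: m => [|m IH] i.
    have := VK i; have := V'K i; rewrite !ler_norml expr0 mul1r; lra.
  by rewrite exprS -mulrA; apply: contr => //; rewrite !mulr_ge0 ?exprn_ge0.
have le V V' : (forall i, relax V i = V i) -> (forall i, relax V' i = V' i) ->
   (forall i, `|V i| <= K) -> (forall i, `|V' i| <= K) -> forall i, V i <= V' i.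
  move=> fV fV' VK V'K i; rewrite -[leRHS]addr0.
  have c : V' i + (1 - rho) ^+ m * (2 * K) @[m --> \oo] --> V' i + 0.
    apply: cvgD; first exact: cvg_cst.
    rewrite -(mul0r (2 * K)); apply: cvgMl; apply: cvg_expr.
    by rewrite ger0_norm// gtrBl.
  apply: (cvgr_to_ge c); apply: nearW => m; exact: pow.
by move=> i; apply/eqP; rewrite eq_le !le.
Qed.

(* Knaster-Tarski on the lattice of the grid functions with values in [-M, M]:
   the supremum of the subsolutions is a fixed point of [relax]. *)
Lemma step_exists (M : R) : C / C0 <= M -> (forall i, `|v i| <= M) ->
  exists2 U, (forall i, `|U i| <= M) & forall i, relax U i = U i.
Proof.
move=> CM vM; have dt0 := dt_gt0 mh.
pose sub := [set U : 'rV[int]_d -> R |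
  (forall i, `|U i| <= M) /\ forall i, U i <= relax U i].
have M0 : 0 <= M by apply: le_trans (vM 0).
have relaxM i : relax (fun=> M) i <= M.
  have [SM _] := S_op_barrier j i mh lN CM.
  have := vM i; rewrite ler_norml => /andP[_ vi].
  have : dt Q h * S h N j (fun=> M) i <= 0 by rewrite mulr_ge0_le0// ltW.
  rewrite /relax; set s := _ * S _ _ _ _ _ => s0; rewrite gerBl.
  by apply: mulr_ge0; [exact: ltW | lra].
have relaxNM i : - M <= relax (fun=> - M) i.
  have [_ SM] := S_op_barrier j i mh lN CM.
  have := vM i; rewrite ler_norml => /andP[vi _].
  have : 0 <= dt Q h * S h N j (fun=> - M) i by rewrite mulr_ge0// ltW.
  rewrite /relax; set s := _ * S _ _ _ _ _ => s0; rewrite lerDl oppr_ge0.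
  by apply: mulr_ge0_le0; [exact: ltW | lra].
have relax_range U : (forall i, `|U i| <= M) -> forall i, `|relax U i| <= M.
  move=> UM i; rewrite ler_norml; apply/andP; split.
    apply: le_trans (relaxNM i) (relax_le _ i) => m.
    by have := UM m; rewrite ler_norml => /andP[].
  apply: le_trans (relax_le _ i) (relaxM i) => m.
  by have := UM m; rewrite ler_norml => /andP[].
have subNM : sub (fun=> - M) by split=> // i; rewrite normrN ger0_norm.
pose X i := [set U i | U in sub].
have supX i : has_sup (X i).
  split; first by exists (- M), (fun=> - M).
  by exists M => _ [U [UM _] <-]; have := UM i; rewrite ler_norml => /andP[].
pose U i := sup (X i).
have ubU V i : sub V -> V i <= U i.
  by move=> sV; apply: ub_le_sup; [case: (supX i) | exists V].
have UM i : `|U i| <= M.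
  rewrite ler_norml (ubU _ i subNM)/=; apply: ge_sup; first by case: (supX i).
  by move=> _ [V [VM _] <-]; have := VM i; rewrite ler_norml => /andP[].
have Ule i : U i <= relax U i.
  apply: ge_sup; first by case: (supX i).
  move=> _ [V sV <-]; apply: le_trans (sV.2 i) (relax_le _ i) => m.
  exact: ubU.
exists U => // i; apply/eqP; rewrite eq_le Ule andbT.
(* By monotonicity [relax U] is again a subsolution, so it lies below the supremum [U]. *)
apply: (ubU (relax U)); split; first exact: relax_range.
exact: relax_le.
Qed.

End Step.

(** * Time stepping: existence, uniqueness, stability and monotonicity *)

Hypothesis hpos : positive_interpolation P Q.

Lemma interpolant_le h N j i k' (V : 'I_J -> 'rV[int]_d -> R) (M : R) :
  mesh Q h -> level P Q h N -> k' != j -> (forall k a, `|V k a| <= M) ->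
  `|interpolant Q h N j i V k'| <= M.
Proof.
move=> mh lN kj VM; rewrite /interpolant.
have fn := pi_finite hpos i mh lN kj.
rewrite !fsbig_finite//; apply: le_trans (ler_norm_sum _ _ _) _.
have := pi_sum1 hpos i mh lN kj; rewrite fsbig_finite// => w1.
rewrite -[M]mul1r -w1 mulr_suml big_seq [leRHS]big_seq; apply: ler_sum => a.
rewrite in_fset_set// => /set_mem na; have w0 := Defs.pi_ge0 hpos mh lN kj na.
by rewrite normrM (ger0_norm w0) ler_wpM2l.
Qed.

(** The bound is free of c: from below the maximum contains [V j i], from above subtracting c > 0
    only helps. *)
Lemma half_step_le h c N j i (V : 'I_J -> 'rV[int]_d -> R) (M : R) :
  mesh Q h -> level P Q h N.+1 -> 0 < c -> C <= M -> (forall k a, `|V k a| <= M) ->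
  `|half_step P Q h c N j V i| <= M.
Proof.
move=> mh lN c0 CM VM; have lN' := levelS mh lN.
have b := sa_bnd hP (node Q h j i) (level_time mh lN).
have V1 := VM j i; move: V1; rewrite !ler_norml => /andP[V1 V2].
rewrite /half_step; apply/andP; split.
  apply: le_trans (bigmax_ge_id _ _ _ _).
  by rewrite le_max V1 orbT.
apply/bigmax_leP; split=> [|k kj].
  rewrite ge_max V2 andbT; apply: le_trans (ler_norm _) _.
  have := normr_ge0 (initial P (node Q h j i)); lra.
have := interpolant_le i mh lN' kj VM; rewrite ler_norml; lra.
Qed.

Lemma solution_exists h c (M : R) : mesh Q h -> 0 < c -> C <= M -> C / C0 <= M ->
  exists2 U, solves_scheme P eps al Q h c U & bounded_by P Q h U M.
Proof.
move=> mh c0 CM CM'.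
(* The hypotheses sit under the existential so that [next] is total and can be iterated; past the
   horizon, or from unbounded data, its value is arbitrary. *)
have /choice[next nextP] : forall NV : nat * ('I_J -> 'rV[int]_d -> R),
    exists W : 'I_J -> 'rV[int]_d -> R,
    level P Q h NV.1.+1 -> (forall k a, `|NV.2 k a| <= M) ->
    (forall k a, `|W k a| <= M) /\
    forall j i, W j i - dt Q h * S h NV.1.+1 j (W j) i
      - half_step P Q h c NV.1 j NV.2 i = 0.
  move=> [N V] /=; have [lN|] := pselect (level P Q h N.+1); last by exists V.
  have [VM|] := pselect (forall k a, `|V k a| <= M); last by exists V.
  have /choice[W WP] : forall j, exists Wj : 'rV[int]_d -> R,
     (forall i, `|Wj i| <= M) /\
     forall i, relax h N.+1 j (half_step P Q h c N j V) Wj i = Wj i.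
    move=> j; have [] := @step_exists h N.+1 j (half_step P Q h c N j V) mh lN M CM'.
      by move=> i; exact: half_step_le.
    by move=> Wj ? ?; exists Wj.
  exists W => _ _; split=> [k a|j i]; first by have [] := WP k.
  by apply/relax_fix => //; have [_] := WP j; apply.
pose U := fix F N : 'I_J -> 'rV[int]_d -> R :=
  if N is N'.+1 then next (N', F N') else fun j i => initial P (node Q h j i).
have UM N : level P Q h N -> forall j i, `|U N j i| <= M.
  elim: N => [_ j i|N IH lN] /=.
    have T0 : 0 <= (0 : R) <= horizon P by rewrite lexx ltW// (sa_T hP).
    have := sa_bnd hP (node Q h j i) T0; have := normr_ge0 (obstacle P 0 (node Q h j i)).
    lra.
  by have [] := nextP (N, U N) lN (IH (levelS mh lN)).
exists U; last by move=> N j i lN; exact: UM.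
split=> // N j i lN.
by have [_] := nextP (N, U N) lN (UM N (levelS mh lN)); apply.
Qed.

Lemma solution_unique h (c : R) (U V : nat -> 'I_J -> 'rV[int]_d -> R) : mesh Q h -> 0 < c ->
  (exists M, bounded_by P Q h U M) -> (exists M, bounded_by P Q h V M) ->
  solves_scheme P eps al Q h c U -> solves_scheme P eps al Q h c V ->
  forall N j i, level P Q h N -> V N j i = U N j i.
Proof.
move=> mh c0 [M UM] [M' VM] [U0 US] [V0 VS].
suff H N : level P Q h N -> V N = U N by move=> N j i /H ->.
elim: N => [_|N IH lN].
  by apply/funext => j; apply/funext => i; rewrite U0 V0.
have VU := IH (levelS mh lN); apply/funext => j; apply/funext => i.
apply: (@step_unique h N.+1 j (half_step P Q h c N j (U N)) mh lN _ _ (Num.max M M')).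
- by move=> m; apply/relax_fix => //; rewrite -VU; exact: VS.
- by move=> m; apply/relax_fix => //; exact: US.
- by move=> m; rewrite le_max (VM _ _ _ lN) orbT.
- by move=> m; rewrite le_max (UM _ _ _ lN).
Qed.

Lemma unique_bounded h c : mesh Q h -> 0 < c ->
  unique_bounded_solution P eps al Q h c.
Proof.
move=> mh c0.
have [U US UM] := solution_exists mh c0 (ler_wpDr (divr_ge0 (ltW C_gt0) (ltW (sa_C0 hP))) (lexx C)) (ler_wpDl (ltW C_gt0) (lexx (C / C0))).
exists U; split=> //; first by exists (C + C / C0).
by move=> V VM VS; apply: solution_unique US VS => //; exists (C + C / C0).
Qed.

Lemma scheme_stable : linf_stable P eps al Q.
Proof.
exists (C + C / C0) => h c mh c0; apply: solution_exists => //.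
  by rewrite lerDl divr_ge0 ?ltW// (sa_C0 hP).
by rewrite lerDr ltW.
Qed.

Lemma scheme_monotone : weakly_monotone P eps al Q.
Proof.
move=> h c mh c0 U V Ut Vt UV UVt N j i lN; rewrite /G_op.
have lN' := levelS mh lN; have dt0 := dt_gt0 mh.
set SV := S h N.+1 j _ i; set SU := S h N.+1 j _ i.
have SS : SU <= SV.
  (* Both grid functions have the same centre value, so the [S_lip] term drops out. *)
  have := @S_op_le h N.+1 j (fun a => if a == i then U N.+1 j i else U N.+1 j a)
     (fun a => if a == i then U N.+1 j i else V N.+1 j a) i mh lN.
  rewrite !eqxx subrr mulr0 addr0; apply=> m; case: eqP => // _; exact: UV.
have dSS : dt Q h * SU <= dt Q h * SV by rewrite ler_pM2l.
have min2 (x y z t : R) : x <= y -> z <= t -> Num.min x z <= Num.min y t.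
  by move=> xy zt; rewrite le_min !ge_min xy zt orbT.
elim/big_ind2 : _ => [|x y z t|k kj]; [|exact: min2|].
  apply: min2; first by lra.
  by apply: lerB => //; rewrite ler_pM2r ?invr_gt0// lerB// UV.
by have := UVt N j i k lN'; lra.
Qed.

End Monotonicity.

(** * Consistency *)

Section MinDistance.
Variable R : realType.

Lemma min_dist (e x y z t : R) : `|x - z| <= e -> `|y - t| <= e ->
  `|Num.min x y - Num.min z t| <= e.
Proof.
rewrite !ler_norml => /andP[? ?] /andP[? ?].
by have [?|?] := leP x y; have [?|?] := leP z t; apply/andP; split; lra.
Qed.

Lemma bigmin_dist (I : Type) (r : seq I) (p : pred I) (F G : I -> R) (e x y : R) :
  `|x - y| <= e -> (forall i, p i -> `|F i - G i| <= e) ->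
  `|\big[Num.min/x]_(i <- r | p i) F i - \big[Num.min/y]_(i <- r | p i) G i| <= e.
Proof.
move=> xy FG; elim/big_ind2 : _ => // x1 x2 y1 y2; exact: min_dist.
Qed.

End MinDistance.

Section Consistency.
Variables (R : realType) (d n q J : nat) (P : problem R d n q) (C C0 : R).
Hypothesis hP : standing_assumption P C C0.
Hypothesis hvol : vol_bounded P.
Variable eps : R.
Hypothesis eps0 : 0 < eps.
Variables (al : 'I_J -> 'rV[R]_q) (Q : discretization R d J).
Hypothesis ctrl_al : forall j, ctrl P (al j).
Hypothesis hQ : admissible_discretization Q.
Variable L : R.
Hypothesis L0 : 0 <= L.
Hypothesis hL : hamiltonian_lipschitz P eps L.
Hypotheses (dt_cvg : dt Q h @[h --> 0^'+] --> (0 : R))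
  (k_cvg : kstep Q h @[h --> 0^'+] --> (0 : R))
  (h2dt_cvg : h ^+ 2 / dt Q h @[h --> 0^'+] --> (0 : R))
  (hk_cvg : h / kstep Q h @[h --> 0^'+] --> (0 : R)).
Local Notation nu := (levy P).
Local Notation big := (@big_jumps R n eps).
Local Notation mass := (big_mass P eps).

Let C_ge0 : 0 <= C := ltW (sa_C hP).

Section FixedControl.
Variables (j : 'I_J) (rad : R).
Variables (phi dtphi : R -> 'rV[R]_d -> R) (Dphi : R -> 'rV[R]_d -> 'rV[R]_d)
  (D2phi : R -> 'rV[R]_d -> 'M[R]_d).
Hypothesis hphi : C12 P phi dtphi Dphi D2phi.
Local Notation a := (al j).

(** As in [G_op], [N] is the level before the one at which the scheme is evaluated. *)
Definition ok h N i : Prop :=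
  [/\ mesh Q h, level P Q h N.+1 & enorm (node Q h j i) <= rad].

(* [X] tends to 0 as h -> 0, uniformly over the nodes of the bounded region. *)
Definition ucv (X : R -> nat -> 'rV[int]_d -> R) : Prop :=
  forall e : R, 0 < e -> \forall h \near 0^'+,
    forall N i, ok h N i -> `|X h N i| <= e.

Local Notation t_ h N := (time Q h N.+1).
Local Notation x_ h i := (node Q h j i).

Lemma ok_time h N i : ok h N i -> 0 <= t_ h N <= horizon P.
Proof. by move=> [mh lN _]; exact: (level_time hQ mh lN). Qed.

Lemma ok_node h N i : ok h N i -> forall l, `|x_ h i 0 l| <= rad.
Proof. by move=> [_ _ xr] l; apply: le_trans xr; exact: coord_enorm. Qed.

Lemma ucv_le_near (K : R) X Y :
  (\forall h \near 0^'+, forall N i, ok h N i -> `|X h N i| <= K * `|Y h N i|) ->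
  ucv Y -> ucv X.
Proof.
move=> XY Y0 e e0; have K1 : 0 < `|K| + 1 by rewrite ltr_pwDr.
have := Y0 (e / (`|K| + 1)); rewrite divr_gt0// => /(_ isT) Y1.
near=> h => N i o.
have XYh : forall N i, ok h N i -> `|X h N i| <= K * `|Y h N i| by near: h.
have Yh : forall N i, ok h N i -> `|Y h N i| <= e / (`|K| + 1) by near: h.
apply: le_trans (XYh _ _ o) _.
apply: (@le_trans _ _ ((`|K| + 1) * `|Y h N i|)).
  rewrite ler_wpM2r//; have := ler_norm K; lra.
by rewrite mulrC -ler_pdivlMr//; exact: Yh.
Unshelve. all: by end_near. Qed.

Lemma ucv_le (K : R) X Y : (forall h N i, ok h N i -> `|X h N i| <= K * `|Y h N i|) ->
  ucv Y -> ucv X.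
Proof. by move=> XY; apply: (@ucv_le_near K); apply: nearW. Qed.

Lemma eq_ucv X Y : (forall h N i, ok h N i -> X h N i = Y h N i) -> ucv Y -> ucv X.
Proof. by move=> XY; apply: (@ucv_le 1) => h N i o; rewrite mul1r XY. Qed.

Lemma ucvD X Y : ucv X -> ucv Y -> ucv (fun h N i => X h N i + Y h N i).
Proof.
move=> X0 Y0 e e0; have e2 : 0 < e / 2 by rewrite divr_gt0.
near=> h => N i o; apply: le_trans (ler_normD _ _) _; rewrite (splitr e) lerD//.
  by move: N i o; near: h; exact: X0.
by move: N i o; near: h; exact: Y0.
Unshelve. all: by end_near. Qed.

Lemma ucv_sum (I : Type) (r : seq I) (X : I -> R -> nat -> 'rV[int]_d -> R) :
  (forall l, ucv (X l)) -> ucv (fun h N i => \sum_(l <- r) X l h N i).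
Proof.
move=> X0; elim: r => [|l r IH].
  by move=> e e0; near=> h => N i _; rewrite big_nil normr0 ltW.
by apply: eq_ucv (ucvD (X0 l) IH) => h N i _; rewrite big_cons.
Unshelve. all: by end_near. Qed.

Lemma ucv_fun (g : R -> R) : g h @[h --> 0^'+] --> 0 -> ucv (fun h _ _ => g h).
Proof.
move=> /cvgrPdist_le g0 e e0; have := g0 e e0.
by apply: filterS => h; rewrite sub0r normrN => gh N i _.
Qed.

(** * Consistency of the local operator A *)

Lemma kstep_gt0 h : mesh Q h -> 0 < kstep Q h.
Proof. exact: ad_kstep hQ h. Qed.

(** [vol_bounded] controls the entries of sigma and [small_jump_variance] the term added on the
    diagonal. *)
Lemma tvol_bounded : exists M : R, forall h N i, ok h N i ->
  forall l m, `|tvol P eps a (x_ h i) l m| <= M.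
Proof.
have [M vM] := hvol; have [V VP] := small_jump_variance hP eps.
exists (Num.max M (Num.sqrt (M ^+ 2 + V))) => h N i _ l m; rewrite mxE.
have vb u w : `|vol P a (x_ h i) u w| <= M.
  by apply: le_trans (vM _ _ (ctrl_al j)); exact: coord_enorm.
case: eqP => _; last by rewrite le_max vb.
rewrite le_max ger0_norm ?sqrtr_ge0// ler_wsqrtr ?orbT// lerD ?VP//.
rewrite -real_normK ?num_real// lerXn2r ?nnegrE//.
exact: le_trans (vb l l).
Qed.

Lemma column_bounded : exists M : R, forall h N i, ok h N i ->
  forall l, norm1 ((col l (tvol P eps a (x_ h i)))^T) <= M.
Proof.
have [M vM] := tvol_bounded; exists (\sum_(l < d) M) => h N i o l.
by apply: ler_sum => m _; rewrite 2!mxE; exact: vM o m l.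
Qed.

(** The drift is Lipschitz and may grow with x, so the bound depends on [rad]. *)
Lemma tdrift_bounded : exists M : R, forall h N i, ok h N i ->
  norm1 (tdrift P eps a (x_ h i)) <= M.
Proof.
exists (\sum_(l < d) ((`|drift P a 0 0 l| + C * rad) + C * mass)) => h N i [_ _ xr].
apply: ler_sum => l _; rewrite !mxE; apply: le_trans (ler_normD _ _) _.
rewrite normrN; apply: lerD.
  rewrite -[drift P a (x_ h i) 0 l](subrK (drift P a 0 0 l)) addrC.
  apply: le_trans (ler_normD _ _) _; rewrite lerD2l.
  have -> : drift P a (x_ h i) 0 l - drift P a 0 0 l
    = (drift P a (x_ h i) - drift P a 0) 0 l by rewrite !mxE.
  apply: le_trans (coord_enorm _ _ _) _.
  have := sa_drift_vol hP (x_ h i) 0 (ctrl_al j) (ctrl_al j).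
  rewrite subr0 subrr enorm0 addr0 => H.
  have : C * enorm (x_ h i) <= C * rad by rewrite ler_wpM2l.
  have := enorm_ge0 (vol P a (x_ h i) - vol P a 0); lra.
apply: (int_big_norm hP eps0); first exact: (bounded_measurable_jump hP eps0).
move=> e be; apply: le_trans (coord_enorm _ _ _) (jump_le hP _ (ctrl_al j) _).
exact: (big_jumps_neq0 eps0).
Qed.

(** First order terms cancel between the two opposite shifts, and the two second order remainders
    are small relative to k^2. *)
Lemma second_difference (s : R -> nat -> 'rV[int]_d -> 'rV[R]_d) (M : R) :
  (forall h N i, ok h N i -> norm1 (s h N i) <= M) ->
  ucv (fun h N i => (kstep Q h ^+ 2)^-1 *
     (phi (t_ h N) (x_ h i + kstep Q h *: s h N i)
      + phi (t_ h N) (x_ h i - kstep Q h *: s h N i) - 2 * phi (t_ h N) (x_ h i))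
     - \sum_m (\sum_l D2phi (t_ h N) (x_ h i) l m * s h N i 0 l) * s h N i 0 m).
Proof.
move=> sM e e0; have M1 : 0 < 2 * (`|M| + 1) ^+ 2.
  by rewrite mulr_gt0// exprn_gt0// ltr_pwDr.
(* The 2 counts the two Taylor remainders; the square bounds that of the l^1 norm of the
   direction. *)
have e'0 : 0 < e / (2 * (`|M| + 1) ^+ 2) by rewrite divr_gt0.
have [r r0 rP] := taylor2_unif hphi rad e'0.
near=> h.
have hk : `|kstep Q h| < r / (`|M| + 1).
  by near: h; apply: cvgr0_norm_lt => //; rewrite divr_gt0// ltr_pwDr.
move=> N i o; have [mh _ _] := o; have k0 := kstep_gt0 mh.
have tT := ok_time o; have xr := ok_node o.
set k := kstep Q h in k0 hk *; set x := x_ h i; set t := t_ h N; set v := s h N i.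
have vM : norm1 v <= `|M| + 1.
  by apply: le_trans (sM _ _ _ o) _; have := ler_norm M; lra.
have kv : norm1 (k *: v) < r.
  rewrite norm1Z; apply: (@le_lt_trans _ _ (`|k| * (`|M| + 1))); first by rewrite ler_wpM2l.
  by rewrite -ltr_pdivlMr ?ltr_pwDr.
have T1 := rP t x (k *: v) tT xr kv.
have kv' : norm1 (- (k *: v)) < r by rewrite -scaleN1r norm1Z normrN1 mul1r.
have T2 := rP t x (- (k *: v)) tT xr kv'.
set q2 := \sum_m _.
have Q1 (c : R) : \sum_m (\sum_l D2phi t x l m * (c *: v) 0 l) * (c *: v) 0 m = c ^+ 2 * q2.
  rewrite /q2 mulr_sumr; apply: eq_bigr => m _; rewrite mxE.
  have -> : \sum_l D2phi t x l m * (c *: v) 0 l = c * \sum_l D2phi t x l m * v 0 l.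
    by rewrite mulr_sumr; apply: eq_bigr => l _; rewrite mxE mulrCA.
  by ring.
have D1 (c : R) : dotv (c *: v) (Dphi t x) = c * dotv v (Dphi t x).
  by rewrite /dotv mulr_sumr; apply: eq_bigr => l _; rewrite mxE mulrA.
rewrite Q1 D1 norm1Z (gtr0_norm k0) in T1.
rewrite -scaleNr Q1 D1 norm1Z sqrrN normrN (gtr0_norm k0) in T2.
rewrite -scaleNr.
have kk : 0 < k ^+ 2 by rewrite exprn_gt0.
have -> : (k ^+ 2)^-1 * (phi t (x + k *: v) + phi t (x + - k *: v) - 2 * phi t x) - q2
  = (k ^+ 2)^-1 * ((phi t (x + k *: v) - phi t x - k * dotv v (Dphi t x)
      - 2^-1 * (k ^+ 2 * q2)) + (phi t (x + - k *: v) - phi t x - - k * dotv v (Dphi t x)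
      - 2^-1 * (k ^+ 2 * q2))).
  have : k != 0 by rewrite gt_eqF.
  by move=> kn; field.
rewrite normrM gtr0_norm ?invr_gt0// mulrC ler_pdivrMr//.
apply: le_trans (ler_normD _ _) _; apply: le_trans (lerD T1 T2) _.
have -> : e / (2 * (`|M| + 1) ^+ 2) * (k * norm1 v) ^+ 2
  = (e / 2 * k ^+ 2) * (norm1 v / (`|M| + 1)) ^+ 2.
  by field; rewrite gt_eqF// ltr_pwDr.
have : (norm1 v / (`|M| + 1)) ^+ 2 <= 1.
  have M0 : 0 < `|M| + 1 by rewrite ltr_pwDr.
  by rewrite exprn_ile1 ?divr_ge0 ?norm1_ge0 ?(ltW M0)// ler_pdivrMr ?mul1r.
have ek : 0 <= e / 2 * k ^+ 2 by rewrite mulr_ge0 ?divr_ge0 ?ltW.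
by move=> /(ler_wpM2l ek); lra.
Unshelve. all: by end_near. Qed.

(** The drift shift is of order k^2, so after division by k^2 a first order expansion is what is
    needed. *)
Lemma first_difference (s : R -> nat -> 'rV[int]_d -> 'rV[R]_d) (M : R) :
  (forall h N i, ok h N i -> norm1 (s h N i) <= M) ->
  ucv (fun h N i => (kstep Q h ^+ 2)^-1 *
     (phi (t_ h N) (x_ h i + kstep Q h ^+ 2 *: s h N i) - phi (t_ h N) (x_ h i))
     - dotv (s h N i) (Dphi (t_ h N) (x_ h i))).
Proof.
move=> sM e e0; have M1 : 0 < `|M| + 1 by rewrite ltr_pwDr.
have e'0 : 0 < e / (`|M| + 1) by rewrite divr_gt0.
have [r r0 rP] := taylor1_unif hphi rad e'0.
have k2_cvg : kstep Q h ^+ 2 @[h --> 0^'+] --> (0 : R).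
  under eq_fun do rewrite expr2.
  by have H := cvgM k_cvg k_cvg; rewrite mulr0 in H; exact: H.
near=> h.
have hk : `|kstep Q h ^+ 2| < r / (`|M| + 1).
  by near: h; apply: cvgr0_norm_lt => //; rewrite divr_gt0.
move=> N i o; have [mh _ _] := o; have k0 := kstep_gt0 mh.
have tT := ok_time o; have xr := ok_node o.
set x := x_ h i; set t := t_ h N; set v := s h N i.
have kk : 0 < kstep Q h ^+ 2 by rewrite exprn_gt0.
have vM : norm1 v <= `|M| + 1.
  by apply: le_trans (sM _ _ _ o) _; have := ler_norm M; lra.
have kv : norm1 (kstep Q h ^+ 2 *: v) < r.
  rewrite norm1Z; apply: (@le_lt_trans _ _ (`|kstep Q h ^+ 2| * (`|M| + 1))).
    by rewrite ler_wpM2l.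
  by rewrite -ltr_pdivlMr.
have := rP t x (kstep Q h ^+ 2 *: v) tT xr kv.
move: kk; set k := _ ^+ 2 => kk.
have D1 (c : R) : dotv (c *: v) (Dphi t x) = c * dotv v (Dphi t x).
  by rewrite /dotv mulr_sumr; apply: eq_bigr => l _; rewrite mxE mulrA.
rewrite D1 norm1Z (gtr0_norm kk) => T1.
have -> : k^-1 * (phi t (x + k *: v) - phi t x) - dotv v (Dphi t x)
  = k^-1 * (phi t (x + k *: v) - phi t x - k * dotv v (Dphi t x)).
  by rewrite !mulrBr mulKf// gt_eqF.
rewrite normrM gtr0_norm ?invr_gt0// mulrC ler_pdivrMr//.
apply: le_trans T1 _.
rewrite mulrCA mulrC ler_pM2r// mulrAC ler_pdivrMr// ler_pM2l//.
Unshelve. all: by end_near. Qed.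

(** [taylor2_unif] with error 1, the Hessian term being absorbed by its bound on the compact box. It
    yields the orders h^2 of the interpolation error and of the viscosity. *)
Lemma quadratic_bound rad' : exists M r : R, [/\ 0 <= M, 0 < r &
  forall t (x v : 'rV[R]_d), 0 <= t <= horizon P ->
    (forall l, `|x 0 l| <= rad') -> norm1 v < r ->
    `|phi t (x + v) - phi t x - dotv v (Dphi t x)| <= M * norm1 v ^+ 2].
Proof.
have [M2 M2P] := cylinder_bounded (C12_contD2 hphi) rad'.
have [r r0 rP] := taylor2_unif hphi rad' ltr01.
exists (1 + 2^-1 * `|M2|), r; split=> // t x v tT xr vr.
have T := rP t x v tT xr vr.
have H : `|2^-1 * \sum_m (\sum_l D2phi t x l m * v 0 l) * v 0 m|
    <= 2^-1 * `|M2| * norm1 v ^+ 2.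
  rewrite normrM ger0_norm ?invr_ge0// -mulrA ler_wpM2l ?invr_ge0//.
  rewrite expr2 mulrA; apply: le_trans (ler_norm_sum _ _ _) _.
  rewrite [X in _ <= _ * X]/norm1 mulr_sumr; apply: ler_sum => m _.
  rewrite normrM ler_wpM2r// /norm1 mulr_sumr.
  apply: le_trans (ler_norm_sum _ _ _) _; apply: ler_sum => l _.
  rewrite normrM ler_wpM2r//; apply: le_trans (mx_coord_norm _ _ _) _.
  exact: le_trans (M2P t x tT xr) (ler_norm _).
move: T H; set A := phi t (x + v) - _ - _; set B := 2^-1 * _ => T H.
rewrite -(subrK B A); apply: le_trans (ler_normD _ _) _; lra.
Qed.

Lemma distrC_row (x y : 'rV[R]_d) l : `|(x - y) 0 l| = `|y 0 l - x 0 l|.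
Proof. by rewrite !mxE distrC. Qed.

Lemma norm1_cube (h : R) (v : 'rV[R]_d) : (forall l, `|v 0 l| <= 2 * h) -> norm1 v <= d%:R * (2 * h).
Proof.
move=> vh; rewrite (_ : d%:R * _ = \sum_(l < d) (2 * h)); last first.
  by rewrite sumr_const card_ord [LHS]mulr_natl.
exact: ler_sum.
Qed.

(* The interpolation is exact on affine functions, hence the order h^2. *)
Lemma interp_error rad' : exists M r : R, [/\ 0 <= M, 0 < r &
  forall h t (x0 y : 'rV[R]_d), mesh Q h -> d%:R * (2 * h) < r -> 0 <= t <= horizon P ->
    (forall l, `|y 0 l| <= rad') ->
    `|interp Q h x0 y (fun m => phi t (grid h x0 m)) - phi t y| <= M * h ^+ 2].
Proof.
have [M [r [M0 r0 rP]]] := quadratic_bound rad'.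
exists (M * (d%:R * 2) ^+ 2), r; split=> // [|h t x0 y mh hr tT yr].
  by rewrite mulr_ge0// sqr_ge0.
have [I [s [w [w0 w1 yE ws ->]]]] := interp_bary hQ x0 y mh.
have -> : \sum_v w v * phi t (grid h x0 (s v)) - phi t y
  = \sum_v w v * (phi t (grid h x0 (s v)) - phi t y
                   - dotv (grid h x0 (s v) - y) (Dphi t y)).
  (* The point [y] is the barycentre of the vertices, so the first order terms sum to 0. *)
  have E : \sum_v w v * dotv (grid h x0 (s v) - y) (Dphi t y) = 0.
    rewrite /dotv; under eq_bigr do rewrite mulr_sumr.
    rewrite exchange_big /= big1// => l _.
    transitivity ((\sum_v w v *: grid h x0 (s v) - (\sum_v w v) *: y) 0 l * Dphi t y 0 l).
      rewrite mxE [in X in _ + X]mxE rV_scaleE summxE mulrBl !mulr_suml -sumrB.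
      by apply: eq_bigr => v _; rewrite !mxE; ring.
    by rewrite -yE w1 scale1r subrr mxE mul0r.
  under [RHS]eq_bigr do rewrite mulrBr mulrBr.
  by rewrite !sumrB E subr0 -mulr_suml w1 mul1r.
apply: le_trans (ler_norm_sum _ _ _) _.
rewrite -[X in _ <= X]mul1r -[X in _ <= X * _]w1 mulr_suml; apply: ler_sum => v _.
rewrite normrM ger0_norm//; have [->|wv] := eqVneq (w v) 0; first by rewrite !mul0r.
rewrite ler_wpM2l//; set z := grid _ _ _.
have zy : norm1 (z - y) <= d%:R * (2 * h).
  apply: norm1_cube => l; rewrite distrC_row; exact: ws.
have := rP t y (z - y) tT yr (le_lt_trans zy hr).
rewrite [y + _]addrC subrK => H; apply: le_trans H _.
rewrite (_ : M * (d%:R * 2) ^+ 2 * h ^+ 2 = M * (d%:R * (2 * h)) ^+ 2); last by ring.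
rewrite ler_wpM2l// lerXn2r ?nnegrE ?norm1_ge0//.
exact: le_trans (norm1_ge0 _) zy.
Qed.

Lemma small_cube (r : R) : 0 < r -> \forall h \near 0^'+, d%:R * (2 * h) < r.
Proof.
move=> r0; near=> h; have : h < r / (d%:R * 2 + 1).
  by near: h; apply: nbhs_right_lt; rewrite divr_gt0// ltr_wpDl// mulr_ge0.
rewrite ltr_pdivlMr ?ltr_wpDl ?mulr_ge0//.
have : 0 < h by near: h; exact: nbhs_right_gt.
lra.
Unshelve. all: by end_near. Qed.

(** An error of order h^2 divided by k^2: the condition h/k -> 0 is used here. The margin 1 around
    [rad] leaves room for the shifts. *)
Lemma interp_error_k2 (y : R -> nat -> 'rV[int]_d -> 'rV[R]_d) :
  (\forall h \near 0^'+, forall N i, ok h N i -> forall l, `|y h N i 0 l| <= rad + 1) ->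
  ucv (fun h N i => (kstep Q h ^+ 2)^-1 *
    (interp Q h (origin Q h j) (y h N i) (fun m => phi (t_ h N) (node Q h j m))
     - phi (t_ h N) (y h N i))).
Proof.
move=> yr e e0; have [M [r [M0 r0 rP]]] := interp_error (rad + 1).
have M1 : 0 < M + 1 by rewrite ltr_wpDl.
have e'0 : 0 < e / (M + 1) by rewrite divr_gt0.
have hk2 : (h / kstep Q h) * (h / kstep Q h) @[h --> 0^'+] --> (0 : R).
  by have H := cvgM hk_cvg hk_cvg; rewrite mulr0 in H; exact: H.
near=> h.
have hr : d%:R * (2 * h) < r by near: h; exact: small_cube.
have hkk : `|(h / kstep Q h) * (h / kstep Q h)| < e / (M + 1).
  by near: h; exact: cvgr0_norm_lt.
have yl : forall N i, ok h N i -> forall l, `|y h N i 0 l| <= rad + 1 by near: h.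
move=> N i o; have [mh _ _] := o; have k0 := kstep_gt0 mh.
have H := rP h _ (origin Q h j) (y h N i) mh hr (ok_time o) (yl _ _ o).
rewrite normrM gtr0_norm ?invr_gt0 ?exprn_gt0// mulrC ler_pdivrMr ?exprn_gt0//.
apply: le_trans H _; move: hkk; rewrite ltr_pdivlMr// => hkk.
have -> : h ^+ 2 = (h / kstep Q h) * (h / kstep Q h) * kstep Q h ^+ 2.
  by field; rewrite gt_eqF.
rewrite mulrA ler_wpM2r ?sqr_ge0//.
have := ler_norm ((h / kstep Q h) * (h / kstep Q h)).
set w := (h / kstep Q h) * (h / kstep Q h) in hkk *.
have w0 := normr_ge0 w; nra.
Unshelve. all: by end_near. Qed.

Lemma ucvZ (c : R) X : ucv X -> ucv (fun h N i => c * X h N i).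
Proof. by apply: (@ucv_le `|c|) => h N i _; rewrite normrM. Qed.

Lemma ucv_norm X : ucv X -> ucv (fun h N i => `|X h N i|).
Proof. by apply: (@ucv_le 1) => h N i _; rewrite normr_id mul1r. Qed.

Lemma shifted_node_le (s : R -> R) (v : R -> nat -> 'rV[int]_d -> 'rV[R]_d) (M : R) :
  s h @[h --> 0^'+] --> (0 : R) -> (forall h N i, ok h N i -> norm1 (v h N i) <= M) ->
  \forall h \near 0^'+, forall N i, ok h N i ->
    forall l, `|(x_ h i + s h *: v h N i) 0 l| <= rad + 1.
Proof.
move=> s0 vM; have M1 : 0 < `|M| + 1 by rewrite ltr_pwDr.
near=> h.
have sh : `|s h| < 1 / (`|M| + 1).
  by near: h; apply: cvgr0_norm_lt => //; rewrite divr_gt0.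
move=> N i o l; rewrite mxE; apply: le_trans (ler_normD _ _) _.
rewrite lerD ?(ok_node o)//; apply: le_trans (coord_norm1 _ l) _.
rewrite norm1Z; apply: (@le_trans _ _ (`|s h| * (`|M| + 1))).
  rewrite ler_wpM2l//; apply: le_trans (vM _ _ _ o) _.
  by have := ler_norm M; lra.
by rewrite -ler_pdivlMr// ltW.
Unshelve. all: by end_near. Qed.

Definition nodal t h : 'rV[int]_d -> R := fun m => phi t (node Q h j m).

Definition sigma_col h i l : 'rV[R]_d := (col l (tvol P eps a (x_ h i)))^T.

Definition hess_form t x (v : 'rV[R]_d) : R :=
  \sum_m (\sum_l D2phi t x l m * v 0 l) * v 0 m.

(** It contains [tdrift], hence the compensator of the big jumps, so that [L_op] only appears once
    the uncompensated limit of K is added. *)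
Definition A_lim t h i : R :=
  2^-1 * \sum_l hess_form t (x_ h i) (sigma_col h i l)
  + dotv (tdrift P eps a (x_ h i)) (Dphi t (x_ h i)).

Lemma A_consistent : ucv (fun h N i =>
  A_disc P eps al Q h j (nodal (t_ h N) h) i - A_lim (t_ h N) h i).
Proof.
have [Ms sM] := column_bounded; have [Mb bM] := tdrift_bounded.
have nk_cvg : - kstep Q h @[h --> 0^'+] --> (0 : R).
  by have H := cvgN k_cvg; rewrite oppr0 in H; exact: H.
have k2_cvg : kstep Q h ^+ 2 @[h --> 0^'+] --> (0 : R).
  under eq_fun do rewrite expr2.
  by have H := cvgM k_cvg k_cvg; rewrite mulr0 in H; exact: H.
have sMl l h N i : ok h N i -> norm1 (sigma_col h i l) <= Ms by move=> o; exact: sM o l.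
(* [e1], [e2] and [e4] replace interpolants by values of phi at the 2d + 1 shifted points; [e3] and
   [e5] expand the resulting differences. *)
have e1 l := interp_error_k2 (shifted_node_le k_cvg (sMl l)).
have e2 l := interp_error_k2 (shifted_node_le nk_cvg (sMl l)).
have e3 l := second_difference (sMl l).
have e4 := interp_error_k2 (shifted_node_le k2_cvg bM).
have e5 := first_difference bM.
have e6 := ucvZ 2^-1 (ucv_sum (index_enum 'I_d) (fun l => ucvD (ucvD (e1 l) (e2 l)) (e3 l))).
apply: eq_ucv (ucvD e6 (ucvD e4 e5)) => h N i o; have [mh _ _] := o.
rewrite A_disc_avg// A_avg1// /A_avg /A_lim.
set k := kstep Q h; set k2 := (k ^+ 2)^-1; set F := phi (t_ h N).
set x := x_ h i; set b := tdrift _ _ _ _.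
pose I y := interp Q h (origin Q h j) y (nodal (t_ h N) h).
have -> : \sum_l (k2 * (I (x + k *: sigma_col h i l) - F (x + k *: sigma_col h i l))
   + k2 * (I (x + - k *: sigma_col h i l) - F (x + - k *: sigma_col h i l))
   + (k2 * (F (x + k *: sigma_col h i l) + F (x - k *: sigma_col h i l) - 2 * F x)
      - hess_form (t_ h N) x (sigma_col h i l)))
  = \sum_l (k2 * (I (x + k *: sigma_col h i l) + I (x - k *: sigma_col h i l)))
    - d%:R * (2 * k2 * F x) - \sum_l hess_form (t_ h N) x (sigma_col h i l).
  have -> : d%:R * (2 * k2 * F x) = \sum_(l < d) (2 * k2 * F x).
    by rewrite sumr_const card_ord [LHS]mulr_natl.
  rewrite -!sumrB; apply: eq_bigr => l _; rewrite scaleNr; ring.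
rewrite /sigma_col; set S1 := \sum_l _; set S2 := \sum_l hess_form _ _ _.
have -> : nodal (t_ h N) h i = F x by [].
by rewrite -[_ / k ^+ 2]/(_ * k2); field.
Qed.

(** * Consistency of the nonlocal operators K and B *)

Lemma node_add h i m : node Q h j (i + m) = x_ h i + (grid h 0 m : 'rV[R]_d).
Proof. by rewrite /node /grid add0r map_mxD scalerDr addrA. Qed.

Lemma bounded_measurable_phi t x : 0 <= t <= horizon P ->
  bounded_measurable eps (fun e => phi t (x + jump P a x e)).
Proof.
move=> tT; have [M MP] := cylinder_bounded (C12_cont hphi) (enorm x + C).
apply: (@bounded_measurable_jump_comp _ _ _ _ _ _ _ hP _ eps0 _ _ (fun y => phi t (x + y)) M) => //.
  move=> y; apply: (@continuous_comp _ _ _ (fun z => x + z) (phi t)).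
    by apply: (@cvgD _ _ _ _ (nbhs_filter y)); [exact: cvg_cst | exact: cvg_id].
  exact: (cylinder_continuous (C12_cont hphi) tT).
move=> y yC; apply: MP => // l; rewrite mxE.
by apply: le_trans (ler_normD _ _) _; rewrite lerD// (le_trans (coord_enorm _ _ _)).
Qed.

Section JumpWeight.
Variables (g : 'rV[R]_d -> borel_rV R n -> R) (G : R).
Hypotheses (bg : forall x, bounded_measurable eps (g x))
  (gG : forall x e, big e -> 0 <= g x e <= G).

Definition jump_lim t h i : R :=
  \int[nu]_(e in big) ((phi t (x_ h i + jump P a (x_ h i) e) - phi t (x_ h i)) * g (x_ h i) e).

(** Nothing is divided by a step and the mass is finite, so it suffices that phi oscillates little
    over 2h around [x + eta], a point of the box of size rad + C. *)
Lemma jump_consistent : ucv (fun h N i =>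
  jump_avg P eps al Q h j i (g (x_ h i)) (fun m => nodal (t_ h N) h (i + m))
  - jump_avg P eps al Q h j i (g (x_ h i)) (fun=> 1) * nodal (t_ h N) h i
  - jump_lim (t_ h N) h i).
Proof.
move=> e e0; have m0 := big_mass_ge0 P eps.
have D0 : 0 < `|G| * mass + 1 by rewrite ltr_wpDl// mulr_ge0.
have e'0 : 0 < e / (`|G| * mass + 1) by rewrite divr_gt0.
have [r r0 rP] := cylinder_unif (C12_cont hphi) (rad + C) e'0.
near=> h.
have hr : 2 * h < r.
  have : h < r / 2 by near: h; apply: nbhs_right_lt; rewrite divr_gt0.
  by rewrite ltr_pdivlMr// mulrC.
move=> N i o; have [mh _ xr] := o; have tT := ok_time o.
set t := t_ h N; set x := x_ h i in xr *.
pose eta e := jump P a x e.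
pose V m := nodal t h (i + m).
have bx := bg x.
have bI := bounded_measurable_interp hP eps0 ctrl_al hQ j i mh bx.
have bF := bounded_measurable_phi x tT.
have bc := bounded_measurable_cst n eps (phi t x).
rewrite {2}/jump_avg -(int_bigZr hP eps0); last exact: bI.
rewrite {1}/jump_avg -(int_bigB hP eps0); last 2 first.
- exact: bI.
- by apply: bounded_measurableM; [exact: bI | exact: bounded_measurable_cst].
rewrite /jump_lim -(int_bigB hP eps0); last 2 first.
- apply: bounded_measurableB; first exact: bI.
  by apply: bounded_measurableM; [exact: bI | exact: bounded_measurable_cst].
- by apply: bounded_measurableM => //; exact: bounded_measurableB.
apply: (@le_trans _ _ (e / (`|G| * mass + 1) * `|G| * mass)); last first.
  rewrite -mulrA mulrAC ler_pdivrMr// ler_pM2l//; lra.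
apply: (int_big_norm hP eps0).
  apply: bounded_measurableB; last first.
    by apply: bounded_measurableM => //; exact: bounded_measurableB.
  apply: bounded_measurableB; first exact: bI.
  by apply: bounded_measurableM; [exact: bI | exact: bounded_measurable_cst].
move=> z bz; rewrite interp1// mul1r -/x -/(eta z) -/V.
have -> : nodal t h i = phi t x by [].
have -> : interp Q h 0 (eta z) V * g x z - g x z * phi t x
    - (phi t (x + eta z) - phi t x) * g x z
  = (interp Q h 0 (eta z) V - phi t (x + eta z)) * g x z by ring.
(* Constants are interpolated exactly, so the value at [x + eta z] can be moved inside the average
   and compared node by node. *)
have -> : interp Q h 0 (eta z) V - phi t (x + eta z)
   = interp Q h 0 (eta z) (fun m => V m + (- phi t (x + eta z)) * 1).
  by rewrite (interpD hQ)// (interpZ hQ)// interp1// mulr1.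
have /andP[g0 gle] := gG x bz.
rewrite normrM; apply: ler_pM => //; last first.
  by rewrite ger0_norm// (le_trans gle)// ler_norm.
apply: (interp_le hQ mh) => m mz; rewrite mulr1 /V /nodal node_add distrC.
have etaC : enorm (eta z) <= C.
  by apply: (jump_le hP _ (ctrl_al j)); exact: (big_jumps_neq0 eps0).
apply: ltW; apply: rP => //.
- move=> l; rewrite mxE; apply: le_trans (ler_normD _ _) _.
  by rewrite lerD// (le_trans (coord_enorm _ _ _)).
- by rewrite subrr normr0.
- move=> l; rewrite mxE [X in _ - X]mxE opprD addrACA subrr add0r.
  exact: le_lt_trans (mz l) hr.
Unshelve. all: by end_near. Qed.

Lemma jump_lim_bounded : exists M : R, forall h N i, ok h N i ->
  `|jump_lim (t_ h N) h i| <= M.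
Proof.
have [M MP] := cylinder_bounded (C12_cont hphi) (rad + C).
exists ((M + M) * `|G| * mass) => h N i o; have [_ _ xr] := o; have tT := ok_time o.
apply: (int_big_norm hP eps0).
  apply: bounded_measurableM => //; apply: bounded_measurableB.
    exact: bounded_measurable_phi.
  exact: bounded_measurable_cst.
move=> z bz; rewrite normrM; apply: ler_pM => //; last first.
  by have /andP[g0 gle] := gG (x_ h i) bz; rewrite ger0_norm// (le_trans gle)// ler_norm.
apply: le_trans (ler_normB _ _) _; apply: lerD; apply: MP => // l.
- rewrite mxE; apply: le_trans (ler_normD _ _) _; rewrite lerD ?(ok_node o)//.
  apply: le_trans (coord_enorm _ _ _) _.
  by apply: (jump_le hP _ (ctrl_al j)); exact: (big_jumps_neq0 eps0).
- by rewrite (le_trans (ok_node o l))// lerDl.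
Qed.

End JumpWeight.

(** * Consistency of the Lax-Friedrichs flux *)

Lemma node_fwd h i l : node Q h j (i + delta_mx 0 l) = x_ h i + h *: delta_mx 0 l.
Proof. by rewrite node_add /grid add0r map_delta_mx. Qed.

Lemma node_bwd h i l : node Q h j (i - delta_mx 0 l) = x_ h i - h *: delta_mx 0 l.
Proof. by rewrite node_add /grid add0r map_mxN map_delta_mx scalerN. Qed.

Lemma norm1_delta (c : R) l : norm1 (c *: (delta_mx 0 l : 'rV[R]_d)) = `|c|.
Proof.
rewrite norm1Z /norm1 (bigD1 l)//= mxE !eqxx /= normr1 big1 ?addr0 ?mulr1// => m ml.
by rewrite mxE eqxx (negbTE ml) normr0.
Qed.

Lemma dotv_delta (c : R) l (D : 'rV[R]_d) : dotv (c *: (delta_mx 0 l : 'rV[R]_d)) D = c * D 0 l.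
Proof.
rewrite /dotv (bigD1 l)//= !mxE !eqxx /= mulr1 big1 ?addr0// => m ml.
by rewrite !mxE eqxx (negbTE ml) mulr0 mul0r.
Qed.

Lemma neighbour_bound l : exists M : R, \forall h \near 0^'+, forall N i, ok h N i ->
  [/\ `|phi (t_ h N) (x_ h i + h *: delta_mx 0 l) - phi (t_ h N) (x_ h i)
        - h * Dphi (t_ h N) (x_ h i) 0 l| <= M * h ^+ 2 &
      `|phi (t_ h N) (x_ h i - h *: delta_mx 0 l) - phi (t_ h N) (x_ h i)
        + h * Dphi (t_ h N) (x_ h i) 0 l| <= M * h ^+ 2].
Proof.
have [M [r [M0 r0 rP]]] := quadratic_bound rad.
exists M; near=> h => N i o; have [mh _ _] := o; have h0 := mesh_gt0 mh.
have hr : `|h| < r by rewrite gtr0_norm//; near: h; exact: nbhs_right_lt.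
split.
  have := rP (t_ h N) _ (h *: delta_mx 0 l) (ok_time o) (ok_node o).
  by rewrite norm1_delta dotv_delta (gtr0_norm h0); apply; rewrite -[h in h < _]gtr0_norm.
have := rP (t_ h N) _ (- h *: delta_mx 0 l) (ok_time o) (ok_node o).
rewrite norm1_delta dotv_delta normrN (gtr0_norm h0) scaleNr mulNr opprK.
by apply; rewrite -[h in h < _]gtr0_norm.
Unshelve. all: by end_near. Qed.

(** As lambda = dt/h, the factor theta/(lambda h) is theta/dt, and it multiplies a second difference
    bounded by 2 M h^2. *)
Lemma flux_consistent : ucv (fun h N i => \sum_l theta Q / lambda Q h *
  ((fwd (nodal (t_ h N) h) i l - bwd (nodal (t_ h N) h) i l) / h)).
Proof.
apply: ucv_sum => l; have [M MP] := neighbour_bound l.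
apply: (@ucv_le_near (theta Q * (2 * M)) _ _ _ (ucv_fun h2dt_cvg)).
near=> h.
have Mh : forall N i, ok h N i ->
  [/\ `|phi (t_ h N) (x_ h i + h *: delta_mx 0 l) - phi (t_ h N) (x_ h i)
        - h * Dphi (t_ h N) (x_ h i) 0 l| <= M * h ^+ 2 &
      `|phi (t_ h N) (x_ h i - h *: delta_mx 0 l) - phi (t_ h N) (x_ h i)
        + h * Dphi (t_ h N) (x_ h i) 0 l| <= M * h ^+ 2] by near: h.
move=> N i o; have [mh _ _] := o; have h0 := mesh_gt0 mh; have dt0 := dt_gt0 hQ mh.
have [H1 H2] := Mh _ _ o.
rewrite /fwd /bwd /nodal node_fwd node_bwd.
set F := phi _ in H1 H2 *; set x := x_ h i in H1 H2 *.
set D := Dphi _ _ 0 l in H1 H2.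
set y1 := x + _ in H1 *; set y2 := x - _ in H2 *.
have th0 := ad_theta hQ.
have -> : theta Q / lambda Q h * ((F y1 - F x - (F x - F y2)) / h)
  = theta Q / dt Q h * ((F y1 - F x - h * D) + (F y2 - F x + h * D)).
  by rewrite /lambda; field; rewrite !gt_eqF.
rewrite normrM (gtr0_norm (divr_gt0 th0 dt0)).
rewrite (gtr0_norm (divr_gt0 (exprn_gt0 2 h0) dt0)).
have -> : theta Q * (2 * M) * (h ^+ 2 / dt Q h) = theta Q / dt Q h * (M * h ^+ 2 + M * h ^+ 2).
  by field; rewrite gt_eqF.
rewrite ler_pM2l ?divr_gt0//; apply: le_trans (ler_normD _ _) _; exact: lerD.
Unshelve. all: by end_near. Qed.

Lemma gradient_consistent l : ucv (fun h N i =>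
  (2 * h)^-1 * (fwd (nodal (t_ h N) h) i l + bwd (nodal (t_ h N) h) i l)
  - Dphi (t_ h N) (x_ h i) 0 l).
Proof.
have [M MP] := neighbour_bound l.
have id0 : h @[h --> (0 : R)^'+] --> (0 : R) by apply: cvg_at_right_filter; exact: cvg_id.
apply: (@ucv_le_near M _ _ _ (ucv_fun id0)).
near=> h.
have Mh : forall N i, ok h N i ->
  [/\ `|phi (t_ h N) (x_ h i + h *: delta_mx 0 l) - phi (t_ h N) (x_ h i)
        - h * Dphi (t_ h N) (x_ h i) 0 l| <= M * h ^+ 2 &
      `|phi (t_ h N) (x_ h i - h *: delta_mx 0 l) - phi (t_ h N) (x_ h i)
        + h * Dphi (t_ h N) (x_ h i) 0 l| <= M * h ^+ 2] by near: h.
move=> N i o; have [mh _ _] := o; have h0 := mesh_gt0 mh.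
have [H1 H2] := Mh _ _ o.
rewrite /fwd /bwd /nodal node_fwd node_bwd.
set F := phi _ in H1 H2 *; set x := x_ h i in H1 H2 *.
set D := Dphi _ _ 0 l in H1 H2 *.
set y1 := x + _ in H1 *; set y2 := x - _ in H2 *.
have -> : (2 * h)^-1 * (F y1 - F x + (F x - F y2)) - D
  = (2 * h)^-1 * ((F y1 - F x - h * D) - (F y2 - F x + h * D)).
  by field; rewrite gt_eqF.
rewrite normrM gtr0_norm ?invr_gt0 ?mulr_gt0// (gtr0_norm h0).
rewrite ler_pdivrMl ?mulr_gt0// (_ : 2 * h * (M * h) = M * h ^+ 2 + M * h ^+ 2); last by ring.
apply: le_trans (ler_normB _ _) _; exact: lerD.
Unshelve. all: by end_near. Qed.

(** * Limit of the step operator S and of the scheme *)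

Let Klim := jump_lim (fun=> fun=> 1).
Let Blim := jump_lim (jweight P).

Let bg1 (x : 'rV[R]_d) : bounded_measurable eps (fun _ : borel_rV R n => (1 : R)).
Proof. exact: bounded_measurable_cst. Qed.

Let bgw (x : 'rV[R]_d) : bounded_measurable eps (jweight P x).
Proof. exact: (bounded_measurable_jweight hP eps0). Qed.

Let g1G (x : 'rV[R]_d) (e : borel_rV R n) : big e -> 0 <= (1 : R) <= 1.
Proof. by rewrite ler01 lexx. Qed.

Let gwG (x : 'rV[R]_d) (e : borel_rV R n) : big e -> 0 <= jweight P x e <= C.
Proof.
move=> be; have e0 := big_jumps_neq0 eps0 be.
by rewrite (sa_jweight_ge0 hP)//= (le_trans (ler_norm _))// (jweight_le hP).
Qed.

(** The compensator moves from [tdrift] back under the integral of K, and the Hessian forms of the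
    columns of sigma~ add up to the trace. *)
Lemma A_lim_K_op t h i : 0 <= t <= horizon P ->
  A_lim t h i + Klim t h i =
  L_op P eps a (x_ h i) (phi t) (Dphi t (x_ h i)) (D2phi t (x_ h i)).
Proof.
move=> tT; set x := x_ h i; rewrite /A_lim /L_op /A_op /K_op -/x.
have -> : \sum_l hess_form t x (sigma_col h i l)
   = \tr (tvol P eps a x *m (tvol P eps a x)^T *m D2phi t x).
  rewrite /mxtrace; under [RHS]eq_bigr do rewrite mxE.
  under [RHS]eq_bigr do under eq_bigr do rewrite mxE mulr_suml.
  rewrite /hess_form; under [RHS]eq_bigr do rewrite exchange_big /=.
  rewrite [RHS]exchange_big /=; apply: eq_bigr => l _.
  apply: eq_bigr => m _; rewrite mulr_suml; apply: eq_bigr => k _.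
  by rewrite /sigma_col !(mxE trmx_key) 3!mxE; ring.
have bF := bounded_measurable_phi x tT.
have bc := bounded_measurable_cst n eps (phi t x).
have bD : bounded_measurable eps (fun e => dotv (jump P a x e) (Dphi t x)).
  apply: bounded_measurable_sum => l; apply: bounded_measurableM.
    exact: (bounded_measurable_jump hP eps0).
  exact: bounded_measurable_cst.
rewrite (int_bigB hP eps0)//; last exact: bounded_measurableB.
have -> : \int[nu]_(e in big) dotv (jump P a x e) (Dphi t x)
  = \sum_l (\int[nu]_(e in big) jump P a x e 0 l) * Dphi t x 0 l.
  rewrite /dotv (int_big_sum hP eps0); last first.
    move=> l; apply: bounded_measurableM; last exact: bounded_measurable_cst.
    exact: (bounded_measurable_jump hP eps0).
  apply: eq_bigr => l _; rewrite (int_bigZr hP eps0)//.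
  exact: (bounded_measurable_jump hP eps0).
have -> : dotv (tdrift P eps a x) (Dphi t x) = dotv (drift P a x) (Dphi t x)
  - \sum_l (\int[nu]_(e in big) jump P a x e 0 l) * Dphi t x 0 l.
  rewrite /dotv -sumrB; apply: eq_bigr => l _.
  by rewrite /tdrift mxE [X in _ + X]mxE; ring.
have -> : Klim t h i = \int[nu]_(e in big) (phi t (x + jump P a x e) - phi t x).
  by rewrite /Klim /jump_lim; apply: eq_Rintegral => e _; rewrite mulr1.
by ring.
Qed.

Definition f_lim t h i : R :=
  hamiltonian P eps a t (x_ h i) (phi t (x_ h i)) (Dphi t (x_ h i)) (Blim t h i).

Definition S_lim t h i : R := A_lim t h i + Klim t h i + f_lim t h i.

Lemma S_consistent : ucv (fun h N i =>
  S_op P eps al Q h N.+1 j (nodal (t_ h N) h) i - S_lim (t_ h N) h i).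
Proof.
have cK := jump_consistent bg1 g1G.
have cB := jump_consistent bgw gwG.
pose p h N i : 'rV[R]_d := (2 * h)^-1 *:
  \row_l (fwd (nodal (t_ h N) h) i l + bwd (nodal (t_ h N) h) i l).
pose Bh h N i := B_disc P eps al Q h j (nodal (t_ h N) h) i.
have cf : ucv (fun h N i =>
  hamiltonian P eps a (t_ h N) (x_ h i) (phi (t_ h N) (x_ h i)) (p h N i) (Bh h N i)
  - f_lim (t_ h N) h i).
  have c1 := ucvZ L (ucv_sum (index_enum 'I_d) (fun l => ucv_norm (gradient_consistent l))).
  have c2 := ucvZ C (ucv_norm cB).
  apply: (@ucv_le 1 _ _ _ (ucvD c1 c2)) => h N i o; have tT := ok_time o.
  have [mh _ _] := o.
  rewrite mul1r /f_lim; set t := t_ h N; set x := x_ h i.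
  (* The gradient is exchanged first, at the cost L, then the nonlocal argument, at the cost C. *)
  rewrite -[hamiltonian _ _ _ _ _ _ (p h N i) _](subrK
    (hamiltonian P eps a t x (phi t x) (Dphi t x) (Bh h N i))) -addrA.
  apply: le_trans (ler_normD _ _) _; rewrite [leRHS]ger0_norm; last first.
    by rewrite addr_ge0// mulr_ge0// sumr_ge0.
  apply: lerD.
    apply: le_trans (hL _ _ _ _ _ (ctrl_al j) tT) _; rewrite ler_wpM2l//.
    apply: le_trans (enorm_le_sum _) _; apply: ler_sum => l _.
    have -> // : (p h N i - Dphi t x) 0 l = (2 * h)^-1 *
      (fwd (nodal t h) i l + bwd (nodal t h) i l) - Dphi t x 0 l.
    by rewrite !mxE.
  apply: le_trans (hamiltonian_upper hP _ ctrl_al _ _ _ _ _ _ _ tT) _.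
  rewrite subrr normr0 add0r ler_wpM2l// /Bh.
  by rewrite (B_disc_avg hP eps0 ctrl_al hQ).
apply: eq_ucv (ucvD (ucvD A_consistent cK) (ucvD cf flux_consistent)) => h N i o.
have [mh _ _] := o.
rewrite /S_op /S_lim (K_disc_avg hP eps0 ctrl_al hQ)// /lax_friedrichs -/(p h N i) -/(Bh h N i).
by rewrite -/Klim; have -> : nodal (t_ h N) h i = phi (t_ h N) (x_ h i) by []; ring.
Qed.

(** The obstacle and switching branches of [G_op] carry an extra dt S, which tends to 0 because the
    limit of S is bounded on the region. *)
Lemma S_lim_bounded : exists M : R, forall h N i, ok h N i ->
  `|S_lim (t_ h N) h i| <= M.
Proof.
have [Ms sM] := column_bounded; have [Mb bM] := tdrift_bounded.
have [MK MKP] := jump_lim_bounded bg1 g1G.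
have [MB MBP] := jump_lim_bounded bgw gwG.
have [M0 M0P] := cylinder_bounded (C12_cont hphi) rad.
have [M1 M1P] := cylinder_bounded (C12_contD hphi) rad.
have [M2 M2P] := cylinder_bounded (C12_contD2 hphi) rad.
have dotv_le (v D : 'rV[R]_d) : `|dotv v D| <= norm1 v * `|D|.
  rewrite /dotv /norm1 mulr_suml; apply: le_trans (ler_norm_sum _ _ _) _.
  by apply: ler_sum => l _; rewrite normrM ler_wpM2l// mx_coord_norm.
have hess_le t (x v : 'rV[R]_d) : 0 <= t <= horizon P -> (forall l, `|x 0 l| <= rad) ->
    `|hess_form t x v| <= `|M2| * norm1 v * norm1 v.
  move=> tT xr; rewrite /hess_form [X in _ * X]/norm1 mulr_sumr.
  apply: le_trans (ler_norm_sum _ _ _) _; apply: ler_sum => m _.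
  rewrite normrM ler_wpM2r// /norm1 mulr_sumr.
  apply: le_trans (ler_norm_sum _ _ _) _; apply: ler_sum => l _.
  rewrite normrM ler_wpM2r//; apply: le_trans (mx_coord_norm _ _ _) _.
  exact: le_trans (M2P t x tT xr) (ler_norm _).
exists (2^-1 * (\sum_(l < d) `|M2| * `|Ms| * `|Ms|) + `|Mb| * `|M1| + MK
  + (C + C * (`|M0| + `|MB|) + L * (\sum_(l < d) `|M1|))).
move=> h N i o; have tT := ok_time o; have xr := ok_node o.
rewrite /S_lim; apply: le_trans (ler_normD _ _) _; apply: lerD.
  apply: le_trans (ler_normD _ _) _; apply: lerD; last exact: MKP.
  apply: le_trans (ler_normD _ _) _; apply: lerD.
    rewrite normrM ger0_norm ?invr_ge0// ler_wpM2l ?invr_ge0//.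
    apply: le_trans (ler_norm_sum _ _ _) _; apply: ler_sum => l _.
    apply: le_trans (hess_le _ _ _ tT xr) _.
    have sl : norm1 (sigma_col h i l) <= `|Ms|.
      by apply: le_trans (ler_norm _); exact: sM o l.
    by rewrite ler_pM ?mulr_ge0 ?norm1_ge0// ler_wpM2l.
  apply: le_trans (dotv_le _ _) _; apply: ler_pM; rewrite ?norm1_ge0//.
    by apply: le_trans (ler_norm _); exact: bM o.
  by apply: le_trans (ler_norm _); exact: M1P.
rewrite /f_lim; set t := t_ h N in tT *; set x := x_ h i in xr *.
set B := Blim t h i.
have h1 := hL x (phi t x) (Dphi t x) 0 B (ctrl_al j) tT.
have h2 := hamiltonian_upper hP eps ctrl_al j x (phi t x) 0 B 0 0 tT.
have h3 := sa_driver_bnd hP x (ctrl_al j) tT.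
have E : hamiltonian P eps a t x 0 0 0 = driver P a t x 0 0 0.
  by rewrite /hamiltonian mul0mx.
rewrite E !subr0 in h1 h2.
rewrite -[hamiltonian _ _ _ _ _ _ _ _](subrK (hamiltonian P eps a t x (phi t x) 0 B)).
apply: le_trans (ler_normD _ _) _; rewrite addrC; apply: lerD; last first.
  apply: le_trans h1 _; rewrite ler_wpM2l//; apply: le_trans (enorm_le_sum _) _.
  apply: ler_sum => l _; apply: le_trans (mx_coord_norm _ _ _) _.
  exact: le_trans (M1P _ _ tT xr) (ler_norm _).
rewrite -[hamiltonian _ _ _ _ _ _ _ _](subrK (driver P a t x 0 0 0)) addrC.
apply: le_trans (ler_normD _ _) _; apply: lerD => //.
apply: le_trans h2 _; rewrite ler_wpM2l//; apply: lerD.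
  exact: le_trans (M0P _ _ tT xr) (ler_norm _).
exact: le_trans (MBP h N i o) (ler_norm _).
Qed.

(** Level [N.+1] exists only if one step fits in the horizon. Unlike [dt_cvg], this bounds dt at
    every mesh size. *)
Lemma dt_le h N i : ok h N i -> 0 < dt Q h <= horizon P.
Proof.
move=> o; have [mh _ _] := o; have dt0 := dt_gt0 hQ mh; rewrite dt0/=.
have /andP[_] := ok_time o; apply: le_trans.
by rewrite /time ler_peMl ?(ltW dt0)// ler1n.
Qed.

Lemma dt_S_consistent : ucv (fun h N i =>
  dt Q h * S_op P eps al Q h N.+1 j (nodal (t_ h N) h) i).
Proof.
have [M MP] := S_lim_bounded.
have c1 : ucv (fun h N i => dt Q h *
    (S_op P eps al Q h N.+1 j (nodal (t_ h N) h) i - S_lim (t_ h N) h i)).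
  apply: (@ucv_le (horizon P) _ _ _ S_consistent) => h N i o.
  have /andP[d0 dT] := dt_le o.
  by rewrite normrM ler_wpM2r// gtr0_norm.
have c2 : ucv (fun h N i => dt Q h * S_lim (t_ h N) h i).
  apply: (@ucv_le M _ _ _ (ucv_fun dt_cvg)) => h N i o.
  by rewrite normrM mulrC ler_wpM2r//; exact: MP.
by apply: eq_ucv (ucvD c1 c2) => h N i o; ring.
Qed.

Lemma time_consistent : ucv (fun h N i =>
  (phi (t_ h N) (x_ h i) - phi (time Q h N) (x_ h i)) / dt Q h
  - dtphi (t_ h N) (x_ h i)).
Proof.
move=> e e0; have [r r0 rP] := time_quotient_unif hphi rad e0.
near=> h.
have dr : `|dt Q h| < r by near: h; exact: cvgr0_norm_lt.
move=> N i o; have [mh lN _] := o; have dt0 := dt_gt0 hQ mh.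
have E : t_ h N - time Q h N = dt Q h.
  by rewrite /time -[N.+1%:R]natr1; ring.
rewrite -[in X in _ / X]E; apply: rP.
- exact: (level_time hQ mh (levelS hQ mh lN)).
- exact: ok_time o.
- exact: ok_node o.
- rewrite gtr0_norm// in dr; apply/andP; split; lra.
Unshelve. all: by end_near. Qed.

Lemma switching_op_S_lim c (Wt : 'I_J -> R) t h i : 0 <= t <= horizon P ->
  switching_op P eps al c j phi dtphi Dphi D2phi Wt t (x_ h i) =
  \big[Num.min/Num.min (phi t (x_ h i) - obstacle P t (x_ h i))
         (dtphi t (x_ h i) - S_lim t h i)]_(k' | k' != j)
    (phi t (x_ h i) - (Wt k' - c)).
Proof.
move=> tT; rewrite /switching_op /S_lim A_lim_K_op//.
congr (bigop _ _ _); congr Num.min; rewrite -addrA; congr (_ + _).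
by rewrite [RHS]opprD.
Qed.

(** Uniform in [Wt]: the interpolated values enter both minima in the same way, and a minimum moves
    no more than its entries do. *)
Lemma G_op_near (c e : R) : 0 < e -> \forall h \near 0^'+, forall N i (Wt : 'I_J -> R),
  ok h N i ->
  `|G_op P eps al Q h c N j i (phi (t_ h N) (x_ h i)) (fun b => nodal (time Q h b) h) Wt
    - switching_op P eps al c j phi dtphi Dphi D2phi Wt (t_ h N) (x_ h i)| <= e.
Proof.
move=> e0; have e2 : 0 < e / 2 by rewrite divr_gt0.
near=> h => N i Wt o; have [mh _ _] := o; have dt0 := dt_gt0 hQ mh.
have H1 : `|dt Q h * S_op P eps al Q h N.+1 j (nodal (t_ h N) h) i| <= e.
  by move: N i o {Wt}; near: h; exact: dt_S_consistent.
have H2 : `|S_op P eps al Q h N.+1 j (nodal (t_ h N) h) i - S_lim (t_ h N) h i| <= e / 2.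
  by move: N i o {H1 Wt}; near: h; exact: S_consistent.
have H3 : `|(phi (t_ h N) (x_ h i) - phi (time Q h N) (x_ h i)) / dt Q h
  - dtphi (t_ h N) (x_ h i)| <= e / 2.
  by move: N i o {H1 H2 Wt}; near: h; exact: time_consistent.
rewrite switching_op_S_lim; last exact: ok_time o.
rewrite /G_op (_ : (fun m => _) = nodal (t_ h N) h); last first.
  by apply/funext => m; case: eqP => [->|].
set S := S_op _ _ _ _ _ _ _ _ _ in H1 H2 *.
apply: bigmin_dist => [|k _].
  apply: min_dist.
    set A := phi _ _ - obstacle _ _ _.
    by rewrite (_ : A - _ - A = - (dt Q h * S)); [rewrite normrN | ring].
  have -> : (phi (t_ h N) (x_ h i) - nodal (time Q h N) h i) / dt Q h - S
     - (dtphi (t_ h N) (x_ h i) - S_lim (t_ h N) h i)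
   = ((phi (t_ h N) (x_ h i) - phi (time Q h N) (x_ h i)) / dt Q h
      - dtphi (t_ h N) (x_ h i)) - (S - S_lim (t_ h N) h i).
    by rewrite /nodal; ring.
  by apply: le_trans (ler_normB _ _) _; rewrite (splitr e) lerD.
set A := phi _ _ - (Wt k - c).
by rewrite (_ : A - _ - A = - (dt Q h * S)); [rewrite normrN | ring].
Unshelve. all: by end_near. Qed.

(** In the branch of the time quotient xi cancels and S moves by at most C |xi|; in the others xi
    remains and dt S adds at most T C |xi|. The constant adds up all these contributions. *)
Lemma G_op_shift (c xi : R) h N i (Wt : 'I_J -> R) : ok h N i ->
  `|G_op P eps al Q h c N j i (phi (t_ h N) (x_ h i) + xi)
      (fun b m => nodal (time Q h b) h m + xi) Wt
    - G_op P eps al Q h c N j i (phi (t_ h N) (x_ h i))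
      (fun b => nodal (time Q h b) h) Wt| <= (1 + (horizon P + 1) * C) * `|xi|.
Proof.
move=> o; have [mh lN _] := o; have /andP[dt0 dtT] := dt_le o.
rewrite /G_op (_ : (fun m => if _ then _ else _ + xi) = (fun m => nodal (t_ h N) h m + xi));
  last by apply/funext => m; case: eqP => [->|].
rewrite (_ : (fun m => if _ then _ else _) = nodal (t_ h N) h); last first.
  by apply/funext => m; case: eqP => [->|].
have H := S_op_shift_norm hP eps ctrl_al hQ j (nodal (t_ h N) h) xi i mh lN.
set S' := S_op _ _ _ _ _ _ _ _ _ in H *; set S := S_op _ _ _ _ _ _ _ _ _ in H *.
have x0 := normr_ge0 xi.
have Cx : 0 <= C * `|xi| by rewrite mulr_ge0.
have dH : `|dt Q h * (S' - S)| <= horizon P * (C * `|xi|).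
  by rewrite normrM ler_pM// gtr0_norm.
have Tx : 0 <= horizon P * (C * `|xi|) by rewrite mulr_ge0// ltW// (sa_T hP).
have E : (1 + (horizon P + 1) * C) * `|xi| = `|xi| + horizon P * (C * `|xi|) + C * `|xi|.
  by ring.
apply: bigmin_dist => [|k _].
  apply: min_dist.
    rewrite (_ : _ - _ - _ - _ = xi - dt Q h * (S' - S)); last by ring.
    by apply: le_trans (ler_normB _ _) _; lra.
  rewrite (_ : _ - _ - _ = - (S' - S)); last by ring.
  by rewrite normrN; lra.
rewrite (_ : _ - _ - _ - _ = xi - dt Q h * (S' - S)); last by ring.
by apply: le_trans (ler_normB _ _) _; lra.
Qed.

(** * A modulus valid at every mesh size *)

Section Modulus.
Variables (c : R) (Wt : R -> nat -> 'rV[int]_d -> 'I_J -> R).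

Definition consistency_error h N i : R :=
  `|G_op P eps al Q h c N j i (phi (t_ h N) (x_ h i))
      (fun b => nodal (time Q h b) h) (Wt h N i)
    - switching_op P eps al c j phi dtphi Dphi D2phi (Wt h N i) (t_ h N) (x_ h i)|.

Definition error_set h : set R :=
  [set consistency_error h z.1 z.2 | z in [set z | ok h z.1 z.2]].

(** Makes the supremum of the errors finite even for the h away from 0, about which [G_op_near] says
    nothing. *)
Lemma finite_ok h : finite_set [set z | ok h z.1 z.2].
Proof.
have [mh|nmh] := pselect (mesh Q h); last first.
  by rewrite (_ : mkset _ = set0)//; apply/seteqP; split=> // z [].
have dt0 := dt_gt0 hQ mh.
apply: (@sub_finite_set _ _ (`I_(Num.trunc (horizon P / dt Q h)).+1 `*`
  [set m | forall l, `|(0 : 'rV[R]_d) 0 l - grid h (origin Q h j) m 0 l| <= rad])).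
  move=> [N i] /= [_ lN xr]; split => /=.
    by rewrite ltnS ltnW// truncn_gt_nat ler_pdivlMr.
  move=> l; rewrite mxE sub0r normrN; apply: le_trans xr; exact: coord_enorm.
apply: finite_setX; first exact: finite_II.
exact: finite_grid_box (mesh_gt0 mh).
Qed.

Lemma error_set_ub h : has_ubound (error_set h).
Proof.
have /finite_fsetP[X XE] : finite_set (error_set h).
  by apply: finite_image; exact: finite_ok.
exists (\sum_(x <- enum_fset X) `|x|) => x; rewrite XE => /= xX.
by rewrite (bigD1_seq x)//= ?fset_uniq// ler_wpDr ?sumr_ge0// ler_norm.
Qed.

Definition error_modulus h : R := sup (error_set h).

Lemma error_le_modulus h N i : ok h N i -> consistency_error h N i <= error_modulus h.
Proof.
by move=> o; apply: ub_le_sup; [exact: error_set_ub | exists (N, i)].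
Qed.

Lemma error_modulus_norm h (e : R) : 0 <= e ->
  (forall N i, ok h N i -> consistency_error h N i <= e) -> 0 <= error_modulus h <= e.
Proof.
move=> e0 He; rewrite /error_modulus.
(* No node may be in range, for instance when [h] is not a mesh size; the supremum then has the
   default value 0. *)
have [->|/set0P nE] := eqVneq (error_set h) set0; first by rewrite sup0 lexx.
apply/andP; split; last by apply: ge_sup => // _ [z o <-]; exact: He.
have [_ [z o _]] := nE.
apply: le_trans (error_le_modulus o); exact: normr_ge0.
Qed.

Lemma error_modulus_ge0 h : 0 <= error_modulus h.
Proof.
have [M MP] := error_set_ub h.
suff /andP[] : 0 <= error_modulus h <= `|M| by [].
apply: error_modulus_norm => // N i o.
by apply: le_trans (ler_norm M); apply: MP; exists (N, i).
Qed.

Lemma error_modulus_cvg : error_modulus h @[h --> 0^'+] --> 0.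
Proof.
apply/cvgrPdist_le => e e0; have := G_op_near c e0; apply: filterS => h Gh.
have /andP[w0 we] : 0 <= error_modulus h <= e.
  by apply: error_modulus_norm => [|N i o]; [exact: ltW | exact: Gh].
by rewrite sub0r normrN ger0_norm.
Qed.

End Modulus.

End FixedControl.

Lemma scheme_consistent : consistent P eps al Q.
Proof.
move=> c c0 phi dtphi Dphi D2phi psi hphi _ rad rad0.
pose Wt j h N i : 'I_J -> R :=
  interpolant Q h N j i (fun k' a => psi k' (time Q h N) (node Q h k' a)).
pose w j := error_modulus j rad (phi j) (dtphi j) (Dphi j) (D2phi j) c (Wt j).
(* Adding the nonnegative moduli of the finitely many controls gives one function of h for all
   [j]. *)
exists (fun h => \sum_j w j h), (fun xi => (1 + (horizon P + 1) * C) * `|xi|); split.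
- elim: (index_enum _) => [|j r IH].
    by under eq_fun do rewrite big_nil; exact: cvg_cst.
  under eq_fun do rewrite big_cons; rewrite -[X in nbhs X](addr0 0).
  by apply: cvgD IH; exact: error_modulus_cvg.
- suff H : (1 + (horizon P + 1) * C) * `|xi| @[xi --> (0 : R)] --> (1 + (horizon P + 1) * C) * `|0 : R|.
    by rewrite normr0 mulr0 in H.
  by apply: cvgMr; apply: cvg_norm; exact: cvg_id.
move=> h xi N j i mh lN xr; cbv zeta.
have o : ok j rad h N i by [].
rewrite -/(Wt j h N i) [leRHS]addrC -[X in `|X|](subrKA (G_op P eps al Q h c N j i
  (phi j (time Q h N.+1) (node Q h j i))
  (fun b => nodal j (phi j) (time Q h b) h) (Wt j h N i))).
apply: le_trans (ler_normD _ _) _; apply: lerD; first exact: G_op_shift.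
rewrite (bigD1 j)//=; apply: ler_wpDr.
  by apply: sumr_ge0 => k _; exact: error_modulus_ge0.
exact: error_le_modulus.
Qed.

End Consistency.

Theorem proposition4p11 (R : realType) (d n q J : nat)
  (P : problem R d n q) (C C0 : R) (hP : standing_assumption P C C0)
  (hvol : vol_bounded P)
  (eps : R) (heps : 0 < eps)
  (delta : R) (hdelta : 0 < delta)
  (al : 'I_J -> 'rV[R]_q) (hal : control_net P delta al)
  (Q : discretization R d J) (hQ : admissible_discretization Q)
  (hpos : positive_interpolation P Q)
  (L : R) (hL : hamiltonian_lipschitz P eps L)
  (htheta : forall h, mesh Q h -> L * lambda Q h < theta Q) :
  (forall h c, mesh Q h -> 0 < c -> unique_bounded_solution P eps al Q h c) /\
  [/\ linf_stable P eps al Q,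
      weakly_monotone P eps al Q &
      dt Q h @[h --> 0^'+] --> (0 : R) ->
      kstep Q h @[h --> 0^'+] --> (0 : R) ->
      h ^+ 2 / dt Q h @[h --> 0^'+] --> (0 : R) ->
      h / kstep Q h @[h --> 0^'+] --> (0 : R) ->
      consistent P eps al Q].
Proof.
have ctrl_al j : ctrl P (al j) by have [_ + _] := hal; apply.
(* [L] is not assumed to be nonnegative; its positive part is still a Lipschitz constant and still
   satisfies the condition on theta, since theta > 0. *)
pose L' := Num.max L 0.
have L'0 : 0 <= L' by rewrite le_max lexx orbT.
have hL' : hamiltonian_lipschitz P eps L'.
  move=> a t x u p p' k ca tT; apply: le_trans (hL a t x u p p' k ca tT) _.
  by rewrite ler_wpM2r ?enorm_ge0// le_max lexx.
have ht' h : mesh Q h -> L' * lambda Q h < theta Q.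
  move=> mh; rewrite /L'; have [_|_] := leP L 0; last exact: htheta.
  by rewrite mul0r (ad_theta hQ).
split=> [h c mh c0|]; first exact: (unique_bounded hP heps ctrl_al hQ L'0 hL' ht' hpos).
split=> [||dt_cvg k_cvg h2dt_cvg hk_cvg].
- exact: (scheme_stable hP heps ctrl_al hQ L'0 hL' ht' hpos).
- exact: (scheme_monotone hP heps ctrl_al hQ L'0 hL' ht').
- exact: (scheme_consistent hP hvol heps ctrl_al hQ L'0 hL').
Qed.
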